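(* Let $n\ge 1$ be an integer. The group $B_n(D)$ has the $R_\infty$ property if and only if $n>2$.
   Context: $B_n(D)$ denotes the full braid group on $n$ strings of the disk $D$, i.e. the Artin braid group on $n$ strings (the fundamental group of the space of unordered $n$-tuples of pairwise distinct points of $D$). For an automorphism $\phi$ of a group $G$, the Reidemeister classes (twisted $\phi$-conjugacy classes) are the equivalence classes of the relation $x\sim gx\phi(g^{-1})$, $g\in G$. The Reidemeister number $R(\phi)$ is the number of these classes ($\infty$ if there are infinitely many). A group $G$ has the $R_\infty$ property if $R(\phi)=\infty$ for every automorphism $\phi$ of $G$. *)

(* Defs.v *)
From HB Require Import structures.
From mathcomp Require Import all_boot all_order all_algebra all_fingroup.
From mathcomp Require Import generic_quotient.
From mathcomp Require Import lra.
From mathcomp Require Import all_classical all_reals all_analysis homotopy.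

Set Implicit Arguments.
Unset Strict Implicit.
Unset Printing Implicit Defensive.

Import Order.TTheory GRing.Theory Num.Theory.
Import numFieldNormedType.Exports.

Local Open Scope classical_set_scope.
Local Open Scope ring_scope.
Local Open Scope quotient_scope.

Local Ltac minmax_lra :=
  rewrite /Order.min /Order.max;
  repeat match goal with |- context [if ?c then _ else _] =>
    lazymatch c with
    | context [if _ then _ else _] => fail
    | _ => case: (boolP c); rewrite -?leNgt => ?
    end end; lra.

Section TwistedConjugacy.
Local Open Scope group_scope.
Variable G : groupType.

Definition reidemeister_class (phi : G -> G) (x : G) : set G :=
  [set y | exists g : G, y = g * x * phi g^-1].

Definition reidemeister_classes (phi : G -> G) : set (set G) :=
  range (reidemeister_class phi).

(* [bijective phi] makes the endomorphism [phi] an automorphism of [G]. *)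
Definition R_infty : Prop :=
  forall phi : {multiplicative G -> G}, bijective phi ->
    infinite_set (reidemeister_classes phi).

End TwistedConjugacy.

Section UnitInterval.
Variable R : realType.

Definition unit_itv : Type := set_type [set t : R | 0 <= t <= 1].

HB.instance Definition _ := Topological.on unit_itv.

Definition itv_val (t : unit_itv) : R := set_val t.

Lemma itv_val_continuous : continuous itv_val.
Proof. exact: (@initial_continuous unit_itv R set_val). Qed.

Lemma itv_val_ge0 t : 0 <= itv_val t.
Proof. by case: t => t /= /[dup] /set_mem /andP[]. Qed.

Lemma itv_val_le1 t : itv_val t <= 1.
Proof. by case: t => t /= /[dup] /set_mem /andP[]. Qed.

Lemma itv_val_inj : injective itv_val.
Proof. by move=> s t; exact: val_inj. Qed.

Lemma clamp_subproof (t : R) :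
  Num.max 0 (Num.min 1 t) \in [set t : R | 0 <= t <= 1].
Proof.
by rewrite inE /= le_max lexx /= ge_max ler01 ge_min lexx.
Qed.

(* The retraction of R onto [0, 1]. *)
Definition clamp (t : R) : unit_itv := @exist R (fun r => r \in [set t : R | 0 <= t <= 1]) _ (clamp_subproof t).

Lemma itv_val_clamp (t : R) : 0 <= t <= 1 -> itv_val (clamp t) = t.
Proof.
by move=> /andP[t0 t1]; rewrite /itv_val set_valE /= (min_idPr t1) (max_idPr t0).
Qed.

Lemma clampK t : clamp (itv_val t) = t.
Proof.
by apply: itv_val_inj; rewrite itv_val_clamp// itv_val_ge0 itv_val_le1.
Qed.

Lemma clamp_continuous : continuous clamp.
Proof.
apply: (@continuous_comp_initial unit_itv R R set_val).
apply: max_fun_continuous; first exact: cst_continuous.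
by apply: min_fun_continuous; [exact: cst_continuous|by move=> t; exact: cvg_id].
Qed.

Lemma clamp_neq : clamp 0 != clamp 1.
Proof.
apply/eqP => /(congr1 itv_val); rewrite !itv_val_clamp ?lexx ?ler01 //.
by move/eqP; rewrite eq_sym oner_eq0.
Qed.

HB.instance Definition _ := isBiPointed.Build unit_itv clamp_neq.

Lemma itv_val0 : itv_val zero = 0.
Proof. by rewrite itv_val_clamp // lexx ler01. Qed.

Lemma itv_val1 : itv_val one = 1.
Proof. by rewrite itv_val_clamp // lexx ler01. Qed.

Lemma clamp_le0 t : t <= 0 -> clamp t = zero.
Proof.
move=> t0; apply: itv_val_inj; rewrite itv_val0 /itv_val set_valE /=.
by apply/max_idPl; rewrite ge_min t0 orbT.
Qed.

Lemma clamp_ge1 t : 1 <= t -> clamp t = one.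
Proof.
move=> t1; apply: itv_val_inj; rewrite itv_val1 /itv_val set_valE /=.
by rewrite (min_idPl t1); apply/max_idPr.
Qed.

End UnitInterval.

Section Continuity.
Variables (R : realType) (X T : topologicalType).

Lemma continuous_cst (a : R) : continuous (fun _ : X => a).
Proof. by move=> x; exact: cvg_cst. Qed.

Lemma continuous_add (u v : X -> R) : continuous u -> continuous v ->
  continuous (fun x => u x + v x).
Proof. by move=> uc vc x; apply: cvgD; [exact: uc|exact: vc]. Qed.

Lemma continuous_sub (u v : X -> R) : continuous u -> continuous v ->
  continuous (fun x => u x - v x).
Proof. by move=> uc vc x; apply: cvgB; [exact: uc|exact: vc]. Qed.

Lemma continuous_mul (u v : X -> R) : continuous u -> continuous v ->
  continuous (fun x => u x * v x).
Proof. by move=> uc vc x; apply: cvgM; [exact: uc|exact: vc]. Qed.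

Lemma paste_continuous (h : X -> R) (f g : X -> T) :
  continuous h -> continuous f -> continuous g ->
  (forall x, h x = 0 -> f x = g x) ->
  continuous (fun x => if h x <= 0 then f x else g x).
Proof.
move=> hc fc gc fg.
pose A := [set x | h x <= 0]; pose B := [set x | 0 <= h x].
have cA : closed A.
  by apply: (closed_comp _ (@closed_le R 0)) => x _; exact: hc.
have cB : closed B.
  by apply: (closed_comp _ (@closed_ge R 0)) => x _; exact: hc.
have AB : A `|` B = setT.
  rewrite -subTset => x _ /=; case: (leP (h x) 0) => hx; [by left|right].
  exact: ltW.
apply/continuous_subspace_setT; rewrite -AB.
apply: withinU_continuous => //.
- apply: (@subspace_eq_continuous _ _ _ f); last exact: continuous_subspaceT.
  by move=> x /set_mem; rewrite /A /from_subspace /= => ->.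
- apply: (@subspace_eq_continuous _ _ _ g); last exact: continuous_subspaceT.
  move=> x /set_mem; rewrite /B /from_subspace /= => hx; case: ifP => // hx'.
  by apply/esym/fg/le_anti; rewrite hx hx'.
Qed.

Lemma comp_pair_continuous (U V : topologicalType) (H : U * V -> T)
    (f : X -> U) (g : X -> V) :
  continuous H -> continuous f -> continuous g ->
  continuous (fun x => H (f x, g x)).
Proof.
move=> Hc fc gc x; apply: (@continuous_comp _ _ _ (fun x => (f x, g x)) H).
  by apply: (@cvg_pair _ _ _ _ (nbhs (f x)) (nbhs (g x))); [exact: fc|exact: gc].
exact: Hc.
Qed.

End Continuity.

Section Homotopy.
Variables (R : realType) (T : topologicalType).
Local Notation I := (unit_itv R).

(* Homotopy relative to the end points. *)
Definition homotopic {x y : T} (p q : {path I from x to y}) : Prop :=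
  exists H : I * I -> T, [/\ continuous H,
    forall t, H (zero, t) = p t, forall t, H (one, t) = q t &
    forall s, H (s, zero) = x /\ H (s, one) = y].

Lemma clamp_comp_continuous (X : topologicalType) (f : I -> T) (u : X -> R) :
  continuous f -> continuous u -> continuous (fun x => f (clamp (u x))).
Proof.
move=> fc uc x; apply: (@continuous_comp _ _ _ (fun x => clamp (u x)) f).
  by apply: continuous_comp; [exact: uc|exact: clamp_continuous].
exact: fc.
Qed.

Lemma clamp_fun_continuous (X : topologicalType) (u : X -> R) :
  continuous u -> continuous (fun x => clamp (u x)).
Proof.
by move=> uc x; apply: continuous_comp; [exact: uc|exact: clamp_continuous].
Qed.

Lemma fst_val_continuous : continuous (fun z : I * I => itv_val z.1).
Proof.
by move=> z; apply: continuous_comp; [exact: cvg_fst|exact: itv_val_continuous].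
Qed.

Lemma snd_val_continuous : continuous (fun z : I * I => itv_val z.2).
Proof.
by move=> z; apply: continuous_comp; [exact: cvg_snd|exact: itv_val_continuous].
Qed.

Lemma reparam_homotopic {x y : T} (f : I -> T) (u v : I -> R)
    (p q : {path I from x to y}) :
  continuous f -> continuous u -> continuous v ->
  u zero = v zero -> u one = v one ->
  (forall t, p t = f (clamp (u t))) -> (forall t, q t = f (clamp (v t))) ->
  homotopic p q.
Proof.
move=> fc uc vc u0 u1 pE qE.
exists (fun z => f (clamp ((1 - itv_val z.1) * u z.2 + itv_val z.1 * v z.2))).
split.
- apply: clamp_comp_continuous => // z.
  apply: cvgD.
    apply: cvgM.
      by apply: cvgB; [exact: cvg_cst|exact: fst_val_continuous].
    by apply: (@continuous_comp _ _ _ snd u); [exact: cvg_snd|exact: uc].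
  apply: cvgM; first exact: fst_val_continuous.
  by apply: (@continuous_comp _ _ _ snd v); [exact: cvg_snd|exact: vc].
- by move=> t; rewrite pE /= itv_val0 subr0 mul1r mul0r addr0.
- by move=> t; rewrite qE /= itv_val1 subrr mul1r mul0r add0r.
- move=> s /=; rewrite -u0 -u1 -!mulrDl subrK !mul1r.
  by rewrite -!pE path_zero path_one.
Qed.

Section Equivalence.
Variables x y : T.
Implicit Types p q r : {path I from x to y}.

Lemma homotopic_refl p : homotopic p p.
Proof.
exists (fun z => p z.2); split => //.
- by move=> z; apply: continuous_comp; [exact: cvg_snd|exact: cts_fun].
- by move=> s /=; rewrite path_zero path_one.
Qed.

Lemma homotopic_eq p q : p =1 q -> homotopic p q.
Proof. by move=> /path_eqP ->; exact: homotopic_refl. Qed.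

Lemma homotopic_sym p q : homotopic p q -> homotopic q p.
Proof.
move=> [H [Hc H0 H1 He]].
exists (fun z => H (clamp (1 - itv_val z.1), z.2)); split => /=.
- apply: comp_pair_continuous => //; last by move=> z; exact: cvg_snd.
  apply: clamp_fun_continuous.
  by apply: continuous_sub; [exact: continuous_cst|exact: fst_val_continuous].
- by move=> t; rewrite itv_val0 subr0 clamp_ge1.
- by move=> t; rewrite itv_val1 subrr clamp_le0.
- by move=> s.
Qed.

Lemma homotopic_trans q p r : homotopic p q -> homotopic q r -> homotopic p r.
Proof.
move=> [H [Hc H0 H1 He]] [K [Kc K0 K1 Ke]].
exists (fun z => if 2 * itv_val z.1 - 1 <= 0 then H (clamp (2 * itv_val z.1), z.2)
  else K (clamp (2 * itv_val z.1 - 1), z.2)).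
have c2 : continuous (fun z : I * I => 2 * itv_val z.1).
  by apply: continuous_mul; [exact: continuous_cst|exact: fst_val_continuous].
have c3 : continuous (fun z : I * I => 2 * itv_val z.1 - 1).
  by apply: continuous_sub; [exact: c2|exact: continuous_cst].
split => /=.
- apply: paste_continuous => //.
  + apply: comp_pair_continuous => //; last by move=> z; exact: cvg_snd.
    exact: clamp_fun_continuous.
  + apply: comp_pair_continuous => //; last by move=> z; exact: cvg_snd.
    exact: clamp_fun_continuous.
  + move=> z z0; rewrite z0 clamp_ge1 ?clamp_le0 ?H1 ?K0 //.
    by move: z0 => /eqP; rewrite subr_eq0 => /eqP ->.
- by move=> t; rewrite itv_val0 mulr0 sub0r lerN10 clamp_le0.
- move=> t; rewrite itv_val1 mulr1 ifF ?clamp_ge1 //; first lra.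
  by apply/negbTE; rewrite -ltNge; lra.
- move=> s; case: ifP => _; [exact: He|exact: Ke].
Qed.

End Equivalence.

Section Concat.
Variables x y z : T.

Definition concat_fun (p q : I -> T) (t : I) : T :=
  if itv_val t <= 2^-1 then p (clamp (2 * itv_val t))
  else q (clamp (2 * itv_val t - 1)).

Variables (p : {path I from x to y}) (q : {path I from y to z}).

Lemma concat_continuous : continuous (concat_fun p q).
Proof.
rewrite (_ : concat_fun p q = fun t =>
  if itv_val t - 2^-1 <= 0 then p (clamp (2 * itv_val t))
  else q (clamp (2 * itv_val t - 1))); last first.
  by apply/funext => t; rewrite subr_le0.
have c2 : continuous (fun t : I => 2 * itv_val t).
  by apply: continuous_mul; [exact: continuous_cst|exact: itv_val_continuous].
apply: paste_continuous.
- by apply: continuous_sub; [exact: itv_val_continuous|exact: continuous_cst].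
- by apply: clamp_comp_continuous => //; exact: cts_fun.
- apply: clamp_comp_continuous; first exact: cts_fun.
  by apply: continuous_sub; [exact: c2|exact: continuous_cst].
- move=> t /eqP; rewrite subr_eq0 => /eqP ->.
  rewrite divff ?pnatr_eq0 // subrr (@clamp_ge1 _ 1) // (@clamp_le0 _ 0) //.
  by rewrite path_zero path_one.
Qed.

Lemma concat_zero : concat_fun p q zero = x.
Proof.
by rewrite /concat_fun itv_val0 invr_ge0 ler0n mulr0 clamp_le0 // path_zero.
Qed.

Lemma concat_one : concat_fun p q one = z.
Proof.
rewrite /concat_fun itv_val1 ifF ?clamp_ge1 ?path_one //; first lra.
by apply/negbTE; rewrite -ltNge; lra.
Qed.

Definition concat : {path I from x to z} :=
  mk_path concat_continuous concat_zero concat_one.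

End Concat.

Section Reverse.
Variables (x y : T) (p : {path I from x to y}).

Definition reverse_fun (t : I) : T := p (clamp (1 - itv_val t)).

Lemma reverse_continuous : continuous reverse_fun.
Proof.
apply: clamp_comp_continuous; first exact: cts_fun.
by apply: continuous_sub; [exact: continuous_cst|exact: itv_val_continuous].
Qed.

Lemma reverse_zero : reverse_fun zero = y.
Proof. by rewrite /reverse_fun itv_val0 subr0 clamp_ge1 // path_one. Qed.

Lemma reverse_one : reverse_fun one = x.
Proof. by rewrite /reverse_fun itv_val1 subrr clamp_le0 // path_zero. Qed.

Definition reverse : {path I from y to x} :=
  mk_path reverse_continuous reverse_zero reverse_one.

End Reverse.

Definition const_path (x : T) : {path I from x to x} := cst x.

Lemma concat_homotopic (x y z : T) (p p' : {path I from x to y})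
    (q q' : {path I from y to z}) :
  homotopic p p' -> homotopic q q' -> homotopic (concat p q) (concat p' q').
Proof.
move=> [H [Hc H0 H1 He]] [K [Kc K0 K1 Ke]].
exists (fun w => if itv_val w.2 - 2^-1 <= 0 then H (w.1, clamp (2 * itv_val w.2))
  else K (w.1, clamp (2 * itv_val w.2 - 1))).
have c2 : continuous (fun w : I * I => 2 * itv_val w.2).
  by apply: continuous_mul; [exact: continuous_cst|exact: snd_val_continuous].
have c3 : continuous (fun w : I * I => 2 * itv_val w.2 - 1).
  by apply: continuous_sub; [exact: c2|exact: continuous_cst].
split => /=.
- apply: paste_continuous.
  + by apply: continuous_sub; [exact: snd_val_continuous|exact: continuous_cst].
  + apply: comp_pair_continuous => //; first by move=> w; exact: cvg_fst.
    exact: clamp_fun_continuous.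
  + apply: comp_pair_continuous => //; first by move=> w; exact: cvg_fst.
    exact: clamp_fun_continuous.
  + move=> w /eqP; rewrite subr_eq0 => /eqP ->.
    rewrite divff ?pnatr_eq0 // subrr (@clamp_ge1 _ 1) // (@clamp_le0 _ 0) //.
    by rewrite (proj2 (He _)) (proj1 (Ke _)).
- by move=> t; rewrite /= /mk_path /concat_fun subr_le0 H0 K0.
- by move=> t; rewrite /= /mk_path /concat_fun subr_le0 H1 K1.
- move=> s; split.
    by rewrite itv_val0 sub0r oppr_le0 invr_ge0 ler0n mulr0 clamp_le0 ?(proj1 (He _)).
  rewrite itv_val1 ifF ?clamp_ge1 ?(proj2 (Ke _)) //; first lra.
  by apply/negbTE; rewrite -ltNge; lra.
Qed.

Lemma reverse_homotopic (x y : T) (p q : {path I from x to y}) :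
  homotopic p q -> homotopic (reverse p) (reverse q).
Proof.
move=> [H [Hc H0 H1 He]].
exists (fun w => H (w.1, clamp (1 - itv_val w.2))); split => /=.
- apply: comp_pair_continuous => //; first by move=> w; exact: cvg_fst.
  apply: clamp_fun_continuous.
  by apply: continuous_sub; [exact: continuous_cst|exact: snd_val_continuous].
- by move=> t; rewrite H0.
- by move=> t; rewrite H1.
- move=> s; rewrite itv_val0 itv_val1 subr0 subrr (@clamp_ge1 _ 1) // (@clamp_le0 _ 0) //.
  by split; case: (He s).
Qed.

Lemma concatA_homotopic (x y z w : T) (p : {path I from x to y})
    (q : {path I from y to z}) (r : {path I from z to w}) :
  homotopic (concat p (concat q r)) (concat (concat p q) r).
Proof.
apply: homotopic_sym.
pose u (t : I) := Num.min (Num.min (2 * itv_val t) (itv_val t + 4^-1))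
  ((itv_val t + 1) / 2).
apply: (@reparam_homotopic _ _ (concat p (concat q r)) u (@itv_val R)).
- exact: cts_fun.
- apply: min_fun_continuous; first apply: min_fun_continuous.
  + by apply: continuous_mul; [exact: continuous_cst|exact: itv_val_continuous].
  + by apply: continuous_add; [exact: itv_val_continuous|exact: continuous_cst].
  + apply: continuous_mul; last exact: continuous_cst.
    by apply: continuous_add; [exact: itv_val_continuous|exact: continuous_cst].
- exact: itv_val_continuous.
- by rewrite /u itv_val0; minmax_lra.
- by rewrite /u itv_val1; minmax_lra.
- move=> t; have := itv_val_ge0 t; have := itv_val_le1 t.
  rewrite /u /= /mk_path /concat_fun; move: (itv_val t) => a a1 a0.
  set m := Num.min (Num.min (2 * a) (a + 4^-1)) ((a + 1) / 2).
  have [a4|a4] := leP a 4^-1.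
    rewrite (_ : m = 2 * a); last by rewrite /m; minmax_lra.
    rewrite ifT; last by lra.
    rewrite itv_val_clamp; last by lra.
    by rewrite (_ : (2 * a <= 2^-1) = true) //; lra.
  have [a2|a2] := leP a 2^-1.
    rewrite (_ : m = a + 4^-1); last by rewrite /m; minmax_lra.
    rewrite !itv_val_clamp; [|lra..].
    rewrite ifF; last by lra.
    rewrite ifF; last by lra.
    rewrite ifT; last by lra.
    by congr (q (clamp _)); lra.
  rewrite (_ : m = (a + 1) / 2); last by rewrite /m; minmax_lra.
  rewrite !itv_val_clamp; [|lra..].
  rewrite ifF; last by lra.
  rewrite ifF; last by lra.
  by congr (r (clamp _)); lra.
- by move=> t; rewrite clampK.
Qed.

Lemma concat1_homotopic (x y : T) (p : {path I from x to y}) :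
  homotopic (concat (const_path x) p) p.
Proof.
apply: (@reparam_homotopic _ _ p (fun t => Num.max 0 (2 * itv_val t - 1))
  (@itv_val R)).
- exact: cts_fun.
- apply: max_fun_continuous; first exact: cst_continuous.
  apply: continuous_sub; last exact: continuous_cst.
  by apply: continuous_mul; [exact: continuous_cst|exact: itv_val_continuous].
- exact: itv_val_continuous.
- by rewrite itv_val0; minmax_lra.
- by rewrite itv_val1; minmax_lra.
- move=> t /=; rewrite /mk_path /concat_fun; case: leP => t2 /=.
    by rewrite (max_idPl _) ?clamp_le0 ?path_zero //; lra.
  by rewrite (max_idPr _) //; lra.
- by move=> t; rewrite clampK.
Qed.

Lemma concatp1_homotopic (x y : T) (p : {path I from x to y}) :
  homotopic (concat p (const_path y)) p.
Proof.
apply: (@reparam_homotopic _ _ p (fun t => Num.min 1 (2 * itv_val t))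
  (@itv_val R)).
- exact: cts_fun.
- apply: min_fun_continuous; first exact: cst_continuous.
  by apply: continuous_mul; [exact: continuous_cst|exact: itv_val_continuous].
- exact: itv_val_continuous.
- by rewrite itv_val0; minmax_lra.
- by rewrite itv_val1; minmax_lra.
- move=> t /=; rewrite /mk_path /concat_fun; case: leP => t2 /=.
    by rewrite (min_idPr _) //; lra.
  by rewrite (min_idPl _) ?clamp_ge1 ?path_one //; lra.
- by move=> t; rewrite clampK.
Qed.

Lemma concatVp_homotopic (x y : T) (p : {path I from x to y}) :
  homotopic (concat (reverse p) p) (const_path y).
Proof.
apply: (@reparam_homotopic _ _ p
  (fun t => Num.max (1 - 2 * itv_val t) (2 * itv_val t - 1)) (fun=> 1)).
- exact: cts_fun.
- have c2 : continuous (fun t : I => 2 * itv_val t).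
    by apply: continuous_mul; [exact: continuous_cst|exact: itv_val_continuous].
  apply: max_fun_continuous; apply: continuous_sub => //; exact: continuous_cst.
- exact: cst_continuous.
- by rewrite itv_val0; minmax_lra.
- by rewrite itv_val1; minmax_lra.
- move=> t /=; have t0 := itv_val_ge0 t.
  rewrite /mk_path /concat_fun /=; case: leP => t2 /=.
    rewrite /mk_path /reverse_fun itv_val_clamp ?(max_idPl _) //; first lra.
    by apply/andP; split; lra.
  by rewrite (max_idPr _) //; lra.
- by move=> t; rewrite clamp_ge1 // path_one.
Qed.

Lemma reverseK (x y : T) (p : {path I from x to y}) : reverse (reverse p) = p.
Proof.
apply/path_eqP => t; have := itv_val_ge0 t; have := itv_val_le1 t => t1 t0.
rewrite /= /mk_path /reverse_fun /= /mk_path /reverse_fun itv_val_clamp.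
  by rewrite subKr clampK.
by apply/andP; split; lra.
Qed.

End Homotopy.

Section FundamentalGroup.
Variables (R : realType) (T : topologicalType) (x : T).
Local Notation loop := {path (unit_itv R) from x to x}.

Definition homotopicb (p q : loop) : bool := `[< homotopic p q >].

Lemma homotopicb_refl : reflexive homotopicb.
Proof. by move=> p; apply/asboolP; exact: homotopic_refl. Qed.

Lemma homotopicb_sym : symmetric homotopicb.
Proof. by move=> p q; apply/asboolP/asboolP; exact: homotopic_sym. Qed.

Lemma homotopicb_trans : transitive homotopicb.
Proof.
move=> q p r /asboolP pq /asboolP qr; apply/asboolP.
exact: homotopic_trans pq qr.
Qed.

Canonical homotopicb_equiv :=
  EquivRel homotopicb homotopicb_refl homotopicb_sym homotopicb_trans.

Definition pi1 : Type := {eq_quot homotopicb_equiv}.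

HB.instance Definition _ := Choice.on pi1.

Definition pi1_class (p : loop) : pi1 := \pi_{eq_quot homotopicb_equiv} p.

Lemma pi1_classP p q : pi1_class p = pi1_class q <-> homotopic p q.
Proof. by split => [/eqmodP/asboolP|pq] //; apply/eqmodP/asboolP. Qed.

Definition pi1_repr (a : pi1) : loop := repr (a : {eq_quot homotopicb_equiv}).

Lemma pi1_reprK a : pi1_class (pi1_repr a) = a.
Proof. exact: reprK. Qed.

Definition pi1_one : pi1 := pi1_class (const_path R x).
Definition pi1_mul (a b : pi1) : pi1 :=
  pi1_class (concat (pi1_repr a) (pi1_repr b)).
Definition pi1_inv (a : pi1) : pi1 := pi1_class (reverse (pi1_repr a)).

Lemma pi1_classM p q : pi1_mul (pi1_class p) (pi1_class q) = pi1_class (concat p q).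
Proof. by apply/pi1_classP/concat_homotopic; apply/pi1_classP; rewrite pi1_reprK. Qed.

Lemma pi1_classV p : pi1_inv (pi1_class p) = pi1_class (reverse p).
Proof. by apply/pi1_classP/reverse_homotopic; apply/pi1_classP; rewrite pi1_reprK. Qed.

Lemma pi1_mulA : associative pi1_mul.
Proof.
move=> a b c; rewrite -(pi1_reprK a) -(pi1_reprK b) -(pi1_reprK c) !pi1_classM.
exact/pi1_classP/concatA_homotopic.
Qed.

Lemma pi1_mul1 : left_id pi1_one pi1_mul.
Proof.
move=> a; rewrite -(pi1_reprK a) pi1_classM; exact/pi1_classP/concat1_homotopic.
Qed.

Lemma pi1_mulr1 : right_id pi1_one pi1_mul.
Proof.
move=> a; rewrite -(pi1_reprK a) pi1_classM; exact/pi1_classP/concatp1_homotopic.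
Qed.

Lemma pi1_mulV : left_inverse pi1_one pi1_inv pi1_mul.
Proof.
move=> a; rewrite -(pi1_reprK a) pi1_classV pi1_classM.
exact/pi1_classP/concatVp_homotopic.
Qed.

Lemma pi1_mulrV : right_inverse pi1_one pi1_inv pi1_mul.
Proof.
move=> a; rewrite -(pi1_reprK a) pi1_classV pi1_classM.
apply/pi1_classP; rewrite -{1}(reverseK (pi1_repr a)).
exact: concatVp_homotopic.
Qed.

HB.instance Definition _ :=
  isGroup.Build pi1 pi1_mulA pi1_mul1 pi1_mulr1 pi1_mulV pi1_mulrV.

End FundamentalGroup.

Section Configurations.
Variables (n : nat) (X : topologicalType).

Definition ordered_conf : topologicalType :=
  set_type [set c : {ptws 'I_n -> X} | injective c].

Definition same_points (c d : ordered_conf) : bool :=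
  `[< exists s : 'S_n, forall i, set_val d i = set_val c (s i) >].

Lemma same_points_refl : reflexive same_points.
Proof. by move=> c; apply/asboolP; exists 1%g => i; rewrite perm1. Qed.

Lemma same_points_sym : symmetric same_points.
Proof.
suff sym c d : same_points c d -> same_points d c.
  by move=> c d; apply/idP/idP; exact: sym.
move=> /asboolP[s sE]; apply/asboolP; exists s^-1%g => i.
by rewrite sE permKV.
Qed.

Lemma same_points_trans : transitive same_points.
Proof.
move=> d c e /asboolP[s sE] /asboolP[t tE]; apply/asboolP; exists (t * s)%g => i.
by rewrite tE sE permM.
Qed.

Canonical same_points_equiv :=
  EquivRel same_points same_points_refl same_points_sym same_points_trans.

(* Unordered n-tuples of pairwise distinct points of X, with the quotient of
   the subspace topology inherited from the product X^n. *)
Definition unordered_conf : topologicalType :=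
  quotient_topology {eq_quot same_points_equiv}.

End Configurations.

Section Disk.
Variable R : realType.

(* The closed unit disk of the Euclidean plane. *)
Definition disk_set : set (R * R) := [set z | z.1 ^+ 2 + z.2 ^+ 2 <= 1].

Definition disk : topologicalType := set_type disk_set.

(* The configuration space is path connected, so the choice of the base point
   [b] does not matter up to isomorphism. *)
Definition braid_group (n : nat) (b : unordered_conf n disk) : groupType :=
  pi1 R b.

Lemma unordered_conf_disk_inhabited (n : nat) :
  inhabited (unordered_conf n disk).
Proof.
have Dp (i : 'I_n) : ((i.+1%:R^-1 : R), (0 : R)) \in disk_set.
  rewrite inE /disk_set /= expr0n /= addr0 expr_le1 ?invr_ge0 ?ler0n //.
  by rewrite invf_le1 ?ltr0n // ler1n.
pose c (i : 'I_n) : disk := @exist _ (fun z => z \in disk_set) _ (Dp i).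
pose A := [set c : {ptws 'I_n -> disk} | injective c].
have cinj : (c : {ptws 'I_n -> disk}) \in A.
  rewrite inE /= => i j /(congr1 (fun z : disk => (set_val z).1)).
  rewrite !set_valE /= => /invr_inj /eqP; rewrite eqr_nat eqSS => /eqP.
  exact: val_inj.
constructor; exact: (\pi_{eq_quot (same_points_equiv n disk)}
  (@exist _ (fun c => c \in A) _ cinj : ordered_conf n disk)).
Qed.

End Disk.

(* Main.v *)
Require Import Defs.
From HB Require Import structures.
From mathcomp Require Import all_boot all_order all_algebra all_fingroup.
From mathcomp Require Import alt gseries commutator cyclic generic_quotient.
From mathcomp Require Import zify ring lra.
From mathcomp Require Import all_classical all_reals all_analysis homotopy.

(** For one or two strings the braid group is generated by one element, and
    inversion is an automorphism with at most two Reidemeister classes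
    ([braid_le2_not_R_infty]).

    For more strings, the argument uses only the permutation of a braid, the
    signed numbers of crossings of its pairs of strands, and the generation of
    the group by positive permutation braids, which are multiplicative when no
    pair crosses twice. These facts are collected in the record [braid_data].
    They are proved from the definition of the braid group as a fundamental
    group ([braid_data_disk]). Homotopies are straight-line homotopies
    ([homotopic_straight]). Generation holds because a loop can be cut into
    short paths, and a short path, closed up at a base configuration by paths
    that keep the lexicographic order of the points, is a quotient of two
    permutation braids ([base_loop_star], [Gen_all]). Permutation and crossing
    numbers are the monodromy of a cocycle defined for nearby configurations
    ([monodromy_homotopic], [crossings_loc], [crossings_swing]).

    The pure subgroup P is then the normal closure of the square of one crossing
    ([pure_ind]), and its homomorphisms to the integers are the combinations of
    the crossing numbers ([pure_hom_expand]). For strands a and b let lam a b be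
    the difference of their total crossing numbers. Up to a factor it is the
    only homomorphism on P that the transposition of a and b changes into its
    opposite and that the disjoint transpositions fix ([lam_rigid]). An
    automorphism psi that preserves P preserves transpositions modulo P, as the
    trace of their action on the abelianization of P shows ([al_tperm]);
    therefore it permutes the functions lam a b ([lam_image]).

    Suppose first that phi preserves P and that lam 0 1 (phi p) = lam a b p.
    Choose x with a permutation sending a, b to 0, 1. Twisted conjugation of
    p x by an element g of P changes p into g p (x phi(g)^-1 x^-1), which has
    the same value of lam a b. As P has finite index and lam a b takes
    infinitely many values, there are infinitely many classes.

    For at least five strings it is not assumed that phi preserves P. Some
    positive power of phi does, because there are finitely many homomorphisms to
    a finite group; with k the least such exponent, the argument is applied to
    the twisted norms x phi(x) ... phi^(k-1)(x), whose classes for phi^k depend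
    only on the class of x for phi. Simplicity of the alternating group provides
    an x for which these norms are controlled ([R_infty_ge5]). For three and
    four strings P is replaced by the kernel of a surjection onto the symmetric
    group of degree 3, which every automorphism preserves ([S3_R_infty]). With
    four strings this surjection comes from the Klein group of translations of
    four points, and crossings are counted along the three partitions of the
    strands into two pairs ([R_infty_4]). *)

Set Implicit Arguments.
Unset Strict Implicit.
Unset Printing Implicit Defensive.
Import Order.TTheory GRing.Theory Num.Theory.
Import numFieldNormedType.Exports.

Local Open Scope classical_set_scope.
Local Open Scope ring_scope.
Local Open Scope quotient_scope.

(** * Configurations of points in the disk *)

Section Conf.
Variables (R : realType) (n : nat).
Local Notation D := (disk R).
Local Notation OC := (ordered_conf n D).
Local Notation UC := (unordered_conf n D).

(** An ordered family of points of the plane, indexed by the strands. *)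
Definition pts := 'I_n -> R * R.

Definition oc_pts (o : OC) : pts := fun i => set_val (set_val o i).

Definition uc_of (o : OC) : UC := \pi_{eq_quot (same_points_equiv n D)} o.

(** [c] is one of the n! listings of the unordered configuration [x]. *)
Definition confs (x : UC) (c : pts) : Prop :=
  exists2 o : OC, uc_of o = x & oc_pts o = c.

(** The families that list a configuration: distinct points of the disk. *)
Definition valid (c : pts) : Prop := (forall i, disk_set (c i)) /\ injective c.

Lemma oc_pts_valid o : valid (oc_pts o).
Proof.
split => [i|i j /val_inj]; first exact: set_valP.
by apply: (set_mem (valP o)).
Qed.

Lemma confs_valid x c : confs x c -> valid c.
Proof. by case=> o _ <-; exact: oc_pts_valid. Qed.

Lemma oc_pts_inj : injective oc_pts.
Proof.
by move=> o p op; apply/val_inj/funext => i; apply/val_inj/(congr1 (@^~ i) op).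
Qed.

Lemma oc_of (c : pts) : valid c -> {o : OC | oc_pts o = c}.
Proof.
move=> [cDx ci].
pose d (i : 'I_n) : D := @exist _ (fun z => z \in @disk_set R) _ (mem_set (cDx i)).
have dinj : (d : {ptws 'I_n -> D}) \in [set c : {ptws 'I_n -> D} | injective c].
  by rewrite inE => i j /(congr1 set_val) /ci.
exists (@exist _ (fun c => c \in _) _ dinj); exact/funext.
Qed.

Definition conf_of (c : pts) (vc : valid c) : UC := uc_of (projT1 (cid (ex_intro (fun o => oc_pts o = c) _ (projT2 (sigT_of_sig (oc_of vc)))))).

Lemma confs_conf_of c (vc : valid c) : confs (conf_of vc) c.
Proof. by rewrite /conf_of; case: cid => o /= oc; exists o. Qed.

(** Two listings of the same configuration differ by a permutation of the
    indices. *)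
Lemma uc_ofP (o p : OC) : uc_of o = uc_of p <->
  exists s : 'S_n, forall i, oc_pts p i = oc_pts o (s i).
Proof.
split.
  move=> /eqmodP/asboolP[s sE]; exists s => i.
  by rewrite /oc_pts sE.
move=> [s sE]; apply/eqmodP/asboolP; exists s => i; exact: val_inj (sE i).
Qed.

Lemma confs_perm x c (s : 'S_n) : confs x c -> confs x (c \o s).
Proof.
case=> o ox oc.
have [p pc] : {p | oc_pts p = c \o s}.
  apply: oc_of; have [cDx ci] := oc_pts_valid o; rewrite -oc; split => [i|i j /=].
    exact: cDx.
  by move/ci/perm_inj.
exists p => //; rewrite -ox; apply/esym/uc_ofP; exists s => i.
by rewrite pc oc.
Qed.

Lemma confs_uniq x c d : confs x c -> confs x d -> exists s : 'S_n, d = c \o s.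
Proof.
move=> [ o ox <-] [p px <-]; have [s sE] := (uc_ofP o p).1 (etrans ox (esym px)).
by exists s; exact/funext.
Qed.

Lemma confs_fun x y c : confs x c -> confs y c -> x = y.
Proof. by move=> [ o <- oc] [p <- pc]; congr uc_of; apply: oc_pts_inj; rewrite oc. Qed.

Lemma confs_ex x : exists c, confs x c.
Proof. by exists (oc_pts (repr (x : {eq_quot (same_points_equiv n D)}))); exists (repr (x : {eq_quot (same_points_equiv n D)})) => //; exact: reprK. Qed.

Lemma oc_pts_continuous (i : 'I_n) : continuous (fun o : OC => oc_pts o i).
Proof.
move=> o.
apply: (@continuous_comp _ _ _ (fun o : OC => set_val o i) (@set_val _ (@disk_set R))); last exact: initial_continuous.
apply: (@continuous_comp _ _ _ (@set_val _ [set c : {ptws 'I_n -> D} | injective c]) (fun f : {ptws 'I_n -> D} => f i)); first exact: initial_continuous.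
exact: (@proj_continuous _ (fun _ => D)).
Qed.

(** A map into the unordered configurations is continuous as soon as its
    points can be listed continuously; this is how every path and homotopy
    below is built. *)
Lemma lift_continuous (Y : topologicalType) (p : Y -> UC) (C : Y -> pts) :
  (forall i, continuous (C^~ i)) -> (forall y, confs (p y) (C y)) -> continuous p.
Proof.
move=> Cc pC.
have pE : p = fun y => conf_of (confs_valid (pC y)).
  by apply/funext => y; exact: confs_fun (pC y) (confs_conf_of _).
have /choice[ o oE] : forall y, exists o : OC, uc_of o = p y /\ oc_pts o = C y.
  by move=> y; case: (pC y) => o; exists o.
have -> : p = uc_of \o o by apply/funext => y /=; rewrite (oE y).1.
suff oc : continuous o.
  by move=> y; apply: continuous_comp; [exact: oc|exact: pi_continuous].
apply: (@continuous_comp_initial OC Y {ptws 'I_n -> D} set_val).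
move=> y; apply/cvg_sup => i.
apply: (@continuous_comp_initial (initial_topology (fun f : 'I_n -> D => f i)) Y D (fun f : 'I_n -> D => f i)).
apply: (@continuous_comp_initial D Y (R * R)%type set_val).
rewrite (_ : _ \o _ = C^~ i) //.
by apply/funext => z; rewrite /= -(oE z).2.
Qed.

(** Distances in the plane are measured with the sup norm. *)
Definition within_box (r : R) (a b : R * R) : Prop := `|a.1 - b.1| < r /\ `|a.2 - b.2| < r.

Lemma within_box_open r a : open [set b | within_box r a b].
Proof.
have -> : [set b | within_box r a b] = (fun b : R * R => `|a.1 - b.1|) @^-1` [set x | x < r] `&` (fun b : R * R => `|a.2 - b.2|) @^-1` [set x | x < r] by [].
have abs_c (u : R * R -> R) : continuous u -> continuous (fun b => `|u b|).
  by move=> uc b; apply: continuous_comp; [exact: uc|exact: norm_continuous].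
apply: openI; (apply: open_comp; last exact: open_lt) => b _; apply: abs_c => {b};
  apply: continuous_sub; try exact: continuous_cst.
  by move=> b; exact: cvg_fst.
by move=> b; exact: cvg_snd.
Qed.

(** The configurations that have, for each [i], a point [r]-close to [c i];
    these form a basis of neighbourhoods of the configuration listed by [c]. *)
Definition conf_box (c : pts) (r : R) : set UC :=
  [set x | exists2 d, confs x d & forall i, within_box r (c i) (d i)].

Lemma conf_box_open c r : open (conf_box c r).
Proof.
rewrite /open /= /quotient_open.
have -> : \pi_(quotient_topology {eq_quot same_points_equiv n D}) @^-1` conf_box c r =
  \bigcup_(s : 'S_n) [set o | forall i, within_box r (c i) (oc_pts o (s i))].
  apply/seteqP; split => o /=.
    move=> [d od cd]; have [|s sE] := @confs_uniq _ (oc_pts o) _ _ od; first by exists o.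
    by exists s => // i /=; have := cd i; rewrite sE.
  move=> [s _ sE]; exists (oc_pts o \o s); last by move=> i; exact: sE.
  by apply: confs_perm; exists o.
apply: bigcup_open => s _; rewrite openE => o oD.
suff : \forall o' \near o, forall i, within_box r (c i) (oc_pts o' (s i)) by [].
apply: (@filter_forall _ _ (fun i => [set o' : OC | within_box r (c i) (oc_pts o' (s i))]) (nbhs o) (nbhs_filter o)) => i.
apply: (@oc_pts_continuous (s i) o [set b | within_box r (c i) b]).
by apply: open_nbhs_nbhs; split; [exact: within_box_open|exact: oD].
Qed.

Lemma conf_box_nbhs x c r : confs x c -> 0 < r -> nbhs x (conf_box c r).
Proof.
move=> xc r0; apply: open_nbhs_nbhs; split; first exact: conf_box_open.
by exists c => // i; rewrite /within_box !subrr normr0.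
Qed.

End Conf.

(** * Lifted paths and straight-line homotopies *)

Section Lifts.
Variables (R : realType) (n : nat).
Local Notation D := (disk R).
Local Notation UC := (unordered_conf n D).
Local Notation I := (unit_itv R).
Local Notation pts := (pts R n).

(** [C] lists the points of the configurations [p t] continuously in [t]. *)
Definition lifts (C : I -> pts) (p : I -> UC) : Prop :=
  (forall i, continuous (C^~ i)) /\ forall t, confs (p t) (C t).

(** The vectors [d] and [e] are nonzero and not antipodal: the segment from
    [d] to [e] avoids the origin. *)
Definition nap (d e : R * R) : Prop :=
  forall s : R, 0 <= s <= 1 -> (1 - s) *: d + s *: e != 0.

Lemma napN d e : nap d e -> nap (- d) (- e).
Proof. by move=> h s /h; rewrite !scalerN -opprD oppr_eq0. Qed.

Lemma nap_refl d : d != 0 -> nap d d.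
Proof. by move=> d0 s _; rewrite -scalerDl subrK scale1r. Qed.

Lemma nap_sym d e : nap d e -> nap e d.
Proof.
move=> h s s01; rewrite addrC -{1}(subKr 1 s); apply: h.
by case/andP: s01 => s0 s1; apply/andP; split; lra.
Qed.

Lemma nap_re d e : 0 < d.1 -> 0 < e.1 -> nap d e.
Proof.
move=> d0 e0 s /andP[s0 s1]; apply/eqP => /(congr1 fst) /= /eqP; apply/negP.
rewrite gt_eqF //; have [s12|s12] := leP s 2^-1.
  apply: ltr_wpDr; first by rewrite mulr_ge0 // ltW.
  by rewrite mulr_gt0 //; lra.
apply: ltr_wpDl; first by apply: mulr_ge0; [lra|exact: ltW].
by rewrite mulr_gt0 //; lra.
Qed.

Lemma nap_im d e : 0 < d.2 -> 0 <= e.2 -> e != 0 -> nap d e.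
Proof.
move=> d0 e0 en s /andP[s0 s1]; have [->|s1'] := eqVneq s 1.
  by rewrite subrr scale0r add0r scale1r.
apply/eqP => /(congr1 snd) /= /eqP; apply/negP.
rewrite gt_eqF //; apply: ltr_wpDr; first by rewrite mulr_ge0.
by rewrite mulr_gt0 // subr_gt0 lt_neqAle s1' s1.
Qed.

Lemma nap_im_neg d e : d.2 < 0 -> e.2 <= 0 -> e != 0 -> nap d e.
Proof.
move=> d0 e0 en; rewrite -(opprK d) -(opprK e); apply: napN; apply: nap_im => /=.
- by rewrite oppr_gt0.
- by rewrite oppr_ge0.
- by rewrite oppr_eq0.
Qed.

Lemma disk_convex (a b : R * R) (s : R) : 0 <= s <= 1 ->
  disk_set a -> disk_set b -> disk_set ((1 - s) *: a + s *: b).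
Proof.
move=> /andP[s0 s1]; case: a b => [a a'] [b b']; rewrite /disk_set /=.
rewrite /GRing.scale /= => ha hb.
have key : 0 <= s * (1 - s) * ((a - b) ^+ 2 + (a' - b') ^+ 2).
  apply: mulr_ge0; first by apply: mulr_ge0; lra.
  by apply: addr_ge0; exact: sqr_ge0.
have : (1 - s) * (a ^+ 2 + a' ^+ 2) + s * (b ^+ 2 + b' ^+ 2) <= 1.
  apply: (@le_trans _ _ ((1 - s) * 1 + s * 1)); last by lra.
  by apply: lerD; apply: ler_wpM2l => //; lra.
rewrite !expr2 in key *; lra.
Qed.

Lemma straight_valid (c d : pts) (s : R) : 0 <= s <= 1 -> valid c -> valid d ->
  (forall i j : 'I_n, (i < j)%N -> nap (c j - c i) (d j - d i)) ->
  valid (fun i => (1 - s) *: c i + s *: d i).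
Proof.
move=> s01 [cD ci] [dD di] h; split=> [i|]; first exact: disk_convex.
have key (i j : 'I_n) : (i < j)%N -> (1 - s) *: c i + s *: d i != (1 - s) *: c j + s *: d j.
  move=> ij; have := h i j ij s s01.
  by apply: contra_neq => e; rewrite !scalerBr addrACA -opprD e subrr.
move=> i j e; have [ij|ji|/val_inj//] := ltngtP i j.
- by have := key i j ij; rewrite e eqxx.
- by have := key j i ji; rewrite e eqxx.
Qed.

(** The fundamental homotopy. If at each time the difference vectors of two
    lifts are not antipodal, then moving every point along the straight
    segment from one lift to the other never makes two points collide. It is
    used for all homotopies between explicit braids. *)
Lemma homotopic_straight (x y : UC) (p q : {path I from x to y}) C E :
  lifts C p -> lifts E q -> C zero = E zero -> C one = E one ->
  (forall t (i j : 'I_n), (i < j)%N -> nap (C t j - C t i) (E t j - E t i)) ->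
  homotopic p q.
Proof.
move=> [Cc Cp] [Ec Eq] C0 C1 h.
pose K (z : I * I) : pts := fun i =>
  (1 - itv_val z.1) *: C z.2 i + itv_val z.1 *: E z.2 i.
have Kv z : valid (K z).
  apply: straight_valid; first by rewrite itv_val_ge0 itv_val_le1.
  - exact: confs_valid (Cp _).
  - exact: confs_valid (Eq _).
  - by move=> i j; exact: h.
exists (fun z => conf_of (Kv z)); split.
- apply: (@lift_continuous _ _ _ _ K); last by move=> z; exact: confs_conf_of.
  move=> i z; rewrite /K.
  apply: cvgD; apply: cvgZ.
  + apply: cvgB; first exact: cvg_cst.
    exact: fst_val_continuous.
  + apply: (@continuous_comp _ _ _ snd (C^~ i)); [exact: cvg_snd|exact: Cc].
  + exact: fst_val_continuous.
  + apply: (@continuous_comp _ _ _ snd (E^~ i)); [exact: cvg_snd|exact: Ec].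
- move=> t; apply: confs_fun (confs_conf_of _) _.
  suff -> : K (zero, t) = C t by exact: Cp.
  by apply/funext => i; rewrite /K /= itv_val0 subr0 scale1r scale0r addr0.
- move=> t; apply: confs_fun (confs_conf_of _) _.
  suff -> : K (one, t) = E t by exact: Eq.
  by apply/funext => i; rewrite /K /= itv_val1 subrr scale1r scale0r add0r.
- move=> s; split; apply: confs_fun (confs_conf_of _) _.
  + suff -> : K (s, zero) = C zero by have := Cp zero; rewrite path_zero.
    by apply/funext => i; rewrite /K /= -C0 -scalerDl subrK scale1r.
  + suff -> : K (s, one) = C one by have := Cp one; rewrite path_one.
    by apply/funext => i; rewrite /K /= -C1 -scalerDl subrK scale1r.
Qed.

Lemma path_of_lift (x y : UC) (C : I -> pts) :
  (forall i, continuous (C^~ i)) -> (forall t, valid (C t)) ->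
  confs x (C zero) -> confs y (C one) ->
  {p : {path I from x to y} | lifts C p}.
Proof.
move=> Cc Cv xC yC.
pose f t := conf_of (Cv t).
have fc : continuous f.
  by apply: (lift_continuous Cc) => t; exact: confs_conf_of.
have f0 : f zero = x by exact: confs_fun (confs_conf_of _) xC.
have f1 : f one = y by exact: confs_fun (confs_conf_of _) yC.
by exists (mk_path fc f0 f1); split => // t; exact: confs_conf_of.
Qed.

Lemma lifts_concat (x y z : UC) (p : {path I from x to y})
    (q : {path I from y to z}) C E :
  lifts C p -> lifts E q -> C one = E zero ->
  lifts (fun t i => concat_fun (C^~ i) (E^~ i) t) (concat p q).
Proof.
move=> [Cc Cp] [Ec Eq] CE; split.
  move=> i; have := Cc i; have := Ec i => Eci Cci.
  have pc : {path I from (C zero i) to (C one i)}.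
    exact: (mk_path Cci erefl erefl).
  exact: (@concat_continuous _ _ _ _ _ (mk_path Cci erefl erefl)
    (mk_path Eci (congr1 (@^~ i) (esym CE)) erefl)).
by move=> t; rewrite /= /mk_path /concat_fun; case: ifP => _; [exact: Cp|exact: Eq].
Qed.

Lemma lifts_reverse (x y : UC) (p : {path I from x to y}) C :
  lifts C p -> lifts (fun t => C (clamp (1 - itv_val t))) (reverse p).
Proof.
move=> [Cc Cp]; split => [i|t]; last exact: Cp.
by apply: (@clamp_comp_continuous R (R * R)%type I (C^~ i)) => //; apply: continuous_sub; [exact: continuous_cst|exact: itv_val_continuous].
Qed.

Lemma lifts_perm (p : I -> UC) C (s : 'S_n) :
  lifts C p -> lifts (fun t => C t \o s) p.
Proof.
by move=> [Cc Cp]; split => [i|t]; [exact: Cc|exact: confs_perm].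
Qed.

Lemma lifts_const (x : UC) c : confs x c -> lifts (fun=> c) (const_path R x).
Proof. by move=> xc; split => // i; exact: cst_continuous. Qed.

End Lifts.

(** * Swings between configurations on the base segment *)

Section Swing.
Variables (R : realType) (n : nat).
Local Notation D := (disk R).
Local Notation UC := (unordered_conf n D).
Local Notation I := (unit_itv R).
Local Notation pts := (pts R n).

(** The abscissa of the k-th base point; the values for [k < n] are
    increasing in [0, 1/2]. *)
Definition xr (k : nat) : R := k%:R / (2 * n)%:R.

Lemma xr_lt (k l : 'I_n) : (xr k < xr l) = (k < l)%N.
Proof.
rewrite /xr ltr_pM2r ?ltr_nat // invr_gt0 ltr0n muln_gt0 /=.
exact: leq_ltn_trans (ltn_ord k).
Qed.

Lemma xr_ge0 (k : nat) : 0 <= xr k.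
Proof. by rewrite /xr divr_ge0. Qed.

Lemma xr_le (k : 'I_n) : xr k <= 2^-1.
Proof.
have n0 : (0 < n)%N := leq_ltn_trans (leq0n _) (ltn_ord k).
rewrite /xr ler_pdivrMr ?ltr0n ?muln_gt0 // natrM mulrA mulVf ?pnatr_eq0 // mul1r.
by rewrite ler_nat ltnW.
Qed.

(** The motion in which the i-th point goes from the base point of index
    [s i] to that of index [e i] along a parabola of height proportional to
    the abscissa of index [k i]. Strictly between the ends, points have
    distinct heights, as [k] is injective; when two points exchange their
    order, [k] decides which of them passes above. *)
Definition swing (s e k : 'S_n) (t : R) : pts := fun i =>
  ((1 - t) * xr (s i) + t * xr (e i), t * (1 - t) * xr (k i)).

(** The base configuration: [n] points of the first coordinate axis. *)
Definition base_pts : pts := fun i => (xr i, 0).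

Lemma swing0 s e k : swing s e k 0 = base_pts \o s.
Proof. by apply/funext => i; rewrite /swing /base_pts /= !mul0r subr0 mul1r addr0. Qed.

Lemma swing1 s e k : swing s e k 1 = base_pts \o e.
Proof. by apply/funext => i; rewrite /swing /base_pts /= subrr mulr0 !mul0r mul1r add0r. Qed.

Lemma swing_comp s e k (u : 'S_n) t : swing s e k t \o u = swing (u * s)%g (u * e)%g (u * k)%g t.
Proof. by apply/funext => i; rewrite /swing /= !permM. Qed.

Lemma swing_disk s e k t i : 0 <= t <= 1 -> disk_set (swing s e k t i).
Proof.
move=> /andP[t0 t1]; rewrite /disk_set /swing /=.
set a := xr (s i); set b := xr (e i); set c := xr (k i).
have := (xr_ge0 (s i), xr_ge0 (e i), xr_ge0 (k i), xr_le (s i), xr_le (e i), xr_le (k i)).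
rewrite -/a -/b -/c => -[[[[[a0 b0] c0] a1] b1] c1].
have h1 : 0 <= (1 - t) * a + t * b <= 2^-1.
  apply/andP; split; first by apply: addr_ge0; apply: mulr_ge0 => //; lra.
  apply: (@le_trans _ _ ((1 - t) * 2^-1 + t * 2^-1)); last by lra.
  by apply: lerD; apply: ler_wpM2l => //; lra.
have h2 : 0 <= t * (1 - t) * c <= 2^-1.
  apply/andP; split; first by apply: mulr_ge0 => //; apply: mulr_ge0; lra.
  apply: (@le_trans _ _ (1 * 2^-1)); last by lra.
  apply: ler_pM => //; first by apply: mulr_ge0; lra.
  by apply: mulr_ile1; lra.
move: h1 h2; move: (_ + _) (_ * _) => x y /andP[x0 x1] /andP[y0 y1].
have := ler_pM x0 x0 x1 x1; have := ler_pM y0 y0 y1 y1.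
rewrite !expr2; lra.
Qed.

Lemma swing_diff s e k t i j : swing s e k t j - swing s e k t i =
  ((1 - t) * (xr (s j) - xr (s i)) + t * (xr (e j) - xr (e i)),
   t * (1 - t) * (xr (k j) - xr (k i))).
Proof. by rewrite /swing; congr (_, _) => /=; ring. Qed.

Lemma perm_ltn_neq (s : 'S_n) (i j : 'I_n) : i != j -> (s i < s j)%N = ~~ (s j < s i)%N.
Proof.
move=> ij; rewrite -leqNgt ltn_neqAle.
by rewrite (_ : (s i != s j :> nat)) // (inj_eq val_inj) (inj_eq perm_inj).
Qed.

Lemma swing_neq s e k t i j : i != j -> swing s e k t j - swing s e k t i != 0.
Proof.
move=> ij; have [->|t0] := eqVneq t 0.
  apply/eqP => /(congr1 fst); rewrite swing_diff /= subr0 mul1r mul0r addr0 => /eqP.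
  apply/negP; have := perm_ltn_neq s ij; rewrite -!xr_lt => h.
  by rewrite subr_eq0; case: (ltgtP (xr (s j)) (xr (s i))) h.
have [->|t1] := eqVneq t 1.
  apply/eqP => /(congr1 fst); rewrite swing_diff /= subrr mul1r mul0r add0r => /eqP.
  apply/negP; have := perm_ltn_neq e ij; rewrite -!xr_lt => h.
  by rewrite subr_eq0; case: (ltgtP (xr (e j)) (xr (e i))) h.
apply/eqP => /(congr1 snd); rewrite swing_diff /= => /eqP.
apply/negP; have := perm_ltn_neq k ij; rewrite -!xr_lt => h.
rewrite !mulf_eq0 (negbTE t0) subr_eq0 eq_sym (negbTE t1) /=.
by rewrite subr_eq0; case: (ltgtP (xr (k j)) (xr (k i))) h.
Qed.

Lemma swing_valid s e k t : 0 <= t <= 1 -> valid (swing s e k t).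
Proof.
move=> t01; split => [i|i j eq]; first exact: swing_disk.
by apply/eqP; apply: contraT => ij; have := swing_neq s e k t ij; rewrite eq subrr eqxx.
Qed.

Lemma base_valid : valid base_pts.
Proof.
by have := @swing_valid 1 1 1 0; rewrite swing0 lexx ler01 => /(_ isT); congr valid; apply/funext => i /=; rewrite perm1.
Qed.

Definition b0 : UC := conf_of base_valid.

Lemma confs_b0 (s : 'S_n) : confs b0 (base_pts \o s).
Proof. exact/confs_perm/confs_conf_of. Qed.

Lemma swing_continuous s e k i : continuous (fun t : I => swing s e k (itv_val t) i).
Proof.
have c1 : continuous (fun t : I => 1 - itv_val t).
  by apply: continuous_sub; [exact: continuous_cst|exact: itv_val_continuous].
apply: (@comp_pair_continuous I (R * R)%type R R id).
- by move=> z; exact: cvg_id.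
- by apply: continuous_add; apply: continuous_mul => //;
    [exact: continuous_cst|exact: itv_val_continuous|exact: continuous_cst].
- apply: continuous_mul; last exact: continuous_cst.
  by apply: continuous_mul => //; exact: itv_val_continuous.
Qed.

Lemma swing_path_ex s e k :
  {p : {path I from b0 to b0} | lifts (fun t => swing s e k (itv_val t)) p}.
Proof.
apply: path_of_lift.
- exact: swing_continuous.
- by move=> t; apply: swing_valid; rewrite itv_val_ge0 itv_val_le1.
- by rewrite itv_val0 swing0; exact: confs_b0.
- by rewrite itv_val1 swing1; exact: confs_b0.
Qed.

Definition swing_path s e k := sval (swing_path_ex s e k).
Lemma swing_pathP s e k : lifts (fun t => swing s e k (itv_val t)) (swing_path s e k).
Proof. exact: svalP (swing_path_ex s e k). Qed.

Lemma xr_comb_gt0 (t : R) (a b c d : 'I_n) : 0 <= t <= 1 -> (a < b)%N -> (c < d)%N ->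
  0 < (1 - t) * (xr b - xr a) + t * (xr d - xr c).
Proof.
rewrite -!xr_lt => /andP[t0 t1] ab cd.
have [t2|t2] := leP t 2^-1.
  apply: ltr_wpDr; first by apply: mulr_ge0; lra.
  by apply: mulr_gt0; lra.
apply: ltr_wpDl; first by apply: mulr_ge0; lra.
by apply: mulr_gt0; lra.
Qed.

(** Two swings with the same ends are straight-line homotopic when the
    heights agree on the order of every pair of points that cross: a pair
    that does not cross keeps a positive horizontal difference, and for a
    pair that does cross the second coordinates of both differences have the
    same sign. *)
Lemma swing_nap (s e k k' : 'S_n) (t : R) (i j : 'I_n) : 0 <= t <= 1 -> (s i < s j)%N -> i != j ->
  ((e j < e i)%N -> (k i < k j)%N = (k' i < k' j)%N) ->
  nap (swing s e k t j - swing s e k t i) (swing s e k' t j - swing s e k' t i).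
Proof.
move=> t01 sij ij ek.
have [eij|] := boolP (e i < e j)%N.
  by apply: nap_re; rewrite swing_diff /=; exact: xr_comb_gt0.
rewrite perm_ltn_neq // negbK => /ek kk.
have [->|t0] := eqVneq t 0.
  by rewrite !swing0; apply: nap_refl; rewrite -(swing0 s e k); exact: swing_neq.
have [->|t1] := eqVneq t 1.
  by rewrite !swing1; apply: nap_refl; rewrite -(swing1 s e k); exact: swing_neq.
have tt : 0 < t * (1 - t).
  case/andP: t01 => t0' t1'; apply: mulr_gt0; first by rewrite lt_neqAle eq_sym t0.
  by rewrite subr_gt0 lt_neqAle t1.
have [kij|] := boolP (k i < k j)%N.
  apply: nap_im; last exact: swing_neq; rewrite swing_diff /=.
    by rewrite mulr_gt0 // subr_gt0 xr_lt.
  by rewrite mulr_ge0 ?(ltW tt) // subr_ge0 ltW // xr_lt -kk.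
move=> /[dup] kij'; rewrite perm_ltn_neq // negbK => kij.
apply: nap_im_neg; last exact: swing_neq; rewrite swing_diff /=.
  by rewrite pmulr_rlt0 // subr_lt0 xr_lt.
rewrite pmulr_rle0 // subr_le0 ltW // xr_lt.
by move: kij'; rewrite kk perm_ltn_neq // negbK.
Qed.

End Swing.

(** * Permutation braids *)

Section Braids.
Variables (R : realType) (n : nat).
Local Notation I := (unit_itv R).
Local Notation b0 := (b0 R n).
Local Notation bp := (@swing_path R n).
Implicit Types s e k u v : 'S_n.

Lemma itv_01 (t : I) : 0 <= itv_val t <= 1.
Proof. by rewrite itv_val_ge0 itv_val_le1. Qed.

(** Only the relative heights of the crossing pairs matter. *)
Lemma swing_height s e k k' :
  (forall i j : 'I_n, (s i < s j)%N -> (e j < e i)%N -> (k i < k j)%N = (k' i < k' j)%N) ->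
  homotopic (bp s e k) (bp s e k').
Proof.
move=> h; apply: (@homotopic_straight R n _ _ _ _ _ _ (swing_pathP R s e k) (swing_pathP R s e k')).
- by rewrite itv_val0 !swing0.
- by rewrite itv_val1 !swing1.
move=> t i j ij; have ij' : i != j by rewrite -(inj_eq val_inj) ltn_eqF.
have [sij|] := boolP (s i < s j)%N.
  by apply: swing_nap => //; [exact: itv_01|exact: h].
rewrite perm_ltn_neq // negbK => sij.
rewrite -[X in nap X _]opprB -[X in nap _ X]opprB; apply: napN.
by apply: swing_nap; [exact: itv_01| |rewrite eq_sym|exact: h].
Qed.

(** Renaming the strands does not change the path of unordered
    configurations. *)
Lemma swing_relabel u s e k :
  homotopic (bp s e k) (bp (u * s)%g (u * e)%g (u * k)%g).
Proof.
apply: (@homotopic_straight R n _ _ _ _ _ _ (lifts_perm u (swing_pathP R s e k)) (swing_pathP R _ _ _)).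
- by rewrite swing_comp.
- by rewrite swing_comp.
move=> t i j ij; rewrite swing_comp; apply/nap_refl/swing_neq.
by rewrite -(inj_eq val_inj) ltn_eqF.
Qed.

(** Two successive swings with the same heights [k] amount to one: in both
    motions the point with the larger height index is never below the other. *)
Lemma swing_concat s e f k :
  homotopic (concat (bp s e k) (bp e f k)) (bp s f k).
Proof.
have hl := lifts_concat (swing_pathP R s e k) (swing_pathP R e f k).
apply: (@homotopic_straight R n _ _ _ _ _ _ (hl _) (swing_pathP R s f k)) => {hl}.
- by rewrite itv_val0 itv_val1 swing0 swing1.
- by apply/funext => i; rewrite /concat_fun itv_val0 invr_ge0 ler0n mulr0 clamp_le0 // itv_val0 !swing0.
- apply/funext => i; rewrite /concat_fun itv_val1 ifF; last first.
    by apply/negbTE; rewrite -ltNge; lra.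
  by rewrite clamp_ge1 ?itv_val1 ?swing1 //; lra.
move=> t.
suff key (i j : 'I_n) : (k i < k j)%N -> nap
  (concat_fun (fun t => swing s e k (itv_val t) j) (fun t => swing e f k (itv_val t) j) t -
   concat_fun (fun t => swing s e k (itv_val t) i) (fun t => swing e f k (itv_val t) i) t)
  (swing s f k (itv_val t) j - swing s f k (itv_val t) i).
  move=> i j ij; have ij' : i != j by rewrite -(inj_eq val_inj) ltn_eqF.
  have [|] := boolP (k i < k j)%N; first exact: key.
  rewrite perm_ltn_neq // negbK => kji.
  rewrite -[X in nap X _]opprB -[X in nap _ X]opprB; apply: napN; exact: key.
move=> kij; have ij : i != j by apply: contraTN kij => /eqP ->; rewrite ltnn.
have [t0 t1] := (itv_val_ge0 t, itv_val_le1 t).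
have im_ge0 s' e' (r : R) : 0 <= r <= 1 -> 0 <= (swing s' e' k r j - swing s' e' k r i : R * R).2.
  case/andP => r0 r1; rewrite swing_diff /=; apply: mulr_ge0; first by apply: mulr_ge0; lra.
  by rewrite subr_ge0 ltW // xr_lt.
have [tE|tn0] := eqVneq (itv_val t) 0.
  rewrite /concat_fun tE invr_ge0 ler0n mulr0 clamp_le0 // itv_val0 !swing0 /=.
  by apply: nap_refl; have := @swing_neq R n s s k 0 _ _ ij; rewrite swing0.
have [tE|tn1] := eqVneq (itv_val t) 1.
  have h21 : (1 <= 2^-1 :> R) = false by apply/negbTE; rewrite -ltNge; lra.
  rewrite /concat_fun tE !h21 clamp_ge1 ?itv_val1 ?swing1; last by lra.
  by apply: nap_refl; have := @swing_neq R n f f k 0 _ _ ij; rewrite swing0.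
apply: nap_sym; apply: nap_im.
- rewrite swing_diff /= mulr_gt0 ?subr_gt0 ?xr_lt //.
  apply: mulr_gt0; first by rewrite lt_neqAle eq_sym tn0.
  by rewrite subr_gt0 lt_neqAle tn1.
- by rewrite /concat_fun; case: ifP => _; apply: im_ge0; exact: itv_01.
- by rewrite /concat_fun; case: ifP => _; exact: swing_neq.
Qed.

(** The positive permutation braid of [u]: the point of larger index passes
    above. *)
Definition perm_braid u : braid_group b0 := pi1_class (bp 1%g u 1%g).

(** Multiplicativity in the length-additive case: no pair of strands crosses
    in both factors. After relabelling, the heights of the second factor
    agree with those of the first on the pairs that cross in the second. *)
Lemma perm_braidM u v :
  (forall i j : 'I_n, (i < j)%N -> (u j < u i)%N -> (v (u j) < v (u i))%N) ->
  (perm_braid u * perm_braid v)%g = perm_braid (u * v)%g.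
Proof.
move=> h; rewrite /perm_braid.
have -> : pi1_class (bp 1%g v 1%g) = pi1_class (bp u (u * v)%g 1%g).
  apply/pi1_classP; apply: homotopic_trans (swing_relabel u _ _ _) _.
  rewrite !mulg1; apply: swing_height => i j uij; rewrite !permM !perm1 => vij.
  rewrite uij; apply/esym; case: ltngtP => // [ji|/val_inj ij].
    by have := h _ _ ji uij; rewrite ltnNge ltnW.
  by move: uij; rewrite ij ltnn.
rewrite [LHS]pi1_classM; apply/pi1_classP; exact: swing_concat.
Qed.

End Braids.

(** * Orders on indices, subdivision of the unit interval *)

(** An increasing permutation is the identity. *)
Lemma perm_mono1 n (w : 'S_n) :
  (forall i j : 'I_n, (i < j)%N -> (w i < w j)%N) -> w = 1%g.
Proof.
have key (v : 'S_n) : (forall i j : 'I_n, (i < j)%N -> (v i < v j)%N) ->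
    forall k (i : 'I_n), nat_of_ord i = k -> (k <= v i)%N.
  move=> h; elim=> [//|k IH] i ik.
  have kn : (k < n)%N by apply: ltn_trans (ltn_ord i); rewrite ik.
  by apply: leq_ltn_trans (IH (Ordinal kn) erefl) (h _ _ _); rewrite /= ik.
move=> h; have h' (i j : 'I_n) : (i < j)%N -> ((w^-1)%g i < (w^-1)%g j)%N.
  move=> ij; case: ltngtP => // [/h|/val_inj/perm_inj ji].
    by rewrite !permKV ltnNge ltnW.
  by move: ij; rewrite ji ltnn.
apply/permP => i; apply/val_inj/eqP; rewrite perm1 eqn_leq (key _ h _ i) // andbT.
by have := key _ h' _ (w i) erefl; rewrite permK.
Qed.

(** A strict total order on the indices is the usual order transported by the
    permutation sending each index to its rank. *)
Lemma rank_perm n (lt : rel 'I_n) : irreflexive lt -> transitive lt ->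
  (forall i j, i != j -> lt i j || lt j i) ->
  exists r : 'S_n, forall i j, lt i j = (r i < r j)%N.
Proof.
move=> irr tr tot.
have rk_lt i : (#|[pred j | lt j i]| < n)%N.
  rewrite -[X in (_ < X)%N]card_ord; apply/proper_card/properP; split.
    by apply/fintype.subsetP.
  by exists i; rewrite // !inE irr.
pose r i := Ordinal (rk_lt i).
have mono i j : lt i j -> (r i < r j)%N.
  move=> ij; apply/proper_card/properP; split.
    by apply/fintype.subsetP => k; rewrite !inE => /tr; apply.
  by exists i; rewrite !inE ?irr.
have r_inj : injective r.
  move=> i j rij; apply/eqP; apply: contraT => /tot /orP[] /mono;
  by rewrite rij ltnn.
exists (perm r_inj) => i j; rewrite !permE; apply/idP/idP; first exact: mono.
move=> rij; have ij : i != j by apply: contraTN rij => /eqP ->; rewrite ltnn.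
by have /orP[//|/mono] := tot _ _ ij; rewrite ltnNge ltnW.
Qed.

Section ContinuousInduction.
Variable R : realType.

(** An additive property of subintervals that holds on all small intervals
    around each point holds on [0, 1]. *)
Lemma segment_induction (Q : R -> R -> Prop) :
  (forall x, 0 <= x <= 1 -> exists2 e, 0 < e & forall a b, 0 <= a -> a <= b ->
     b <= 1 -> x - e < a -> b < x + e -> Q a b) ->
  (forall a b c, 0 <= a -> a <= b -> b <= c -> c <= 1 -> Q a b -> Q b c -> Q a c) ->
  Q 0 1.
Proof.
move=> loc add.
pose S := [set t : R | 0 <= t <= 1 /\ Q 0 t].
have S0 : S 0.
  split; first by rewrite lexx ler01.
  have [|e e0 h] := loc 0; first by rewrite lexx ler01.
  by apply: h => //; rewrite ?ler01 ?add0r ?oppr_lt0.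
have supS : has_sup S.
  by split; [exists 0|exists 1 => t [/andP[]]].
have s0 : 0 <= sup S by apply: ub_le_sup => //; case: supS.
have s1 : sup S <= 1.
  by apply: ge_sup; [exists 0|move=> t [/andP[]]].
have [|e e0 h] := loc (sup S); first by rewrite s0 s1.
have [t [/andP[t0 t1] Qt] te] := sup_adherent e0 supS.
have ts : t <= sup S by apply: ub_le_sup; [case: supS|split; rewrite ?t0].
pose b := Num.min 1 (sup S + e / 2).
have tb : t <= b by rewrite /b le_min t1 /=; lra.
have b1 : b <= 1 by rewrite /b ge_min lexx.
have be : b < sup S + e by rewrite /b gt_min; apply/orP; right; lra.
have Qb : Q 0 b by apply: add Qt _ => //; apply: h.
have : b <= sup S.
  apply: ub_le_sup; first by case: supS.
  by split => //; rewrite b1 (le_trans t0 tb).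
rewrite /b; case: (leP 1 (sup S + e / 2)) Qb; rewrite /b; last by move=> *; lra.
by move=> h1; rewrite (min_idPl h1).
Qed.
End ContinuousInduction.

(** * Paths to the base configuration *)

Section LexPath.
Variables (R : realType) (n : nat).
Local Notation UC := (unordered_conf n (disk R)).
Local Notation I := (unit_itv R).
Local Notation b0 := (b0 R n).
Local Notation base := (@base_pts R n).
Local Notation pts := (pts R n).

Lemma comb_continuous (Y : topologicalType) (a : Y -> R) (f g : Y -> R * R) :
  continuous a -> continuous f -> continuous g ->
  continuous (fun y => (1 - a y) *: f y + a y *: g y).
Proof.
move=> ac fc gc y; apply: cvgD; apply: cvgZ.
- by apply: cvgB; [exact: cvg_cst|exact: ac].
- exact: fc.
- exact: ac.
- exact: gc.
Qed.

(** The lexicographic order of the plane. *)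
Definition lexlt (a b : R * R) := (a.1 < b.1) || ((a.1 == b.1) && (a.2 < b.2)).

Lemma lex_sorted_ex (x : UC) : exists c : pts, confs x c /\
  forall i j : 'I_n, (i < j)%N = lexlt (c i) (c j).
Proof.
have [c xc] := confs_ex x.
have [cD ci] := confs_valid xc.
have [|b a d| |r rP] := @rank_perm n (fun i j => lexlt (c i) (c j)).
- by move=> i; rewrite /lexlt !ltxx andbF.
- rewrite /lexlt => /orP[ab|/andP[/eqP -> ab]] /orP[bd|/andP[/eqP <- bd]].
  + by rewrite (lt_trans ab bd).
  + by rewrite ab.
  + by rewrite bd.
  + by rewrite eqxx (lt_trans ab bd) orbT.
- move=> i j; apply: contraR; rewrite /lexlt; case: (ltgtP (c i).1 (c j).1) => //= e1.
  case: (ltgtP (c i).2 (c j).2) => //= e2 _; apply/eqP/ci.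
  by rewrite (surjective_pairing (c i)) e1 e2 -surjective_pairing.
exists (c \o (r^-1)%g); split; first exact: confs_perm.
by move=> i j /=; rewrite (rP ((r^-1)%g i)) !permKV.
Qed.

(** The lexicographically increasing listing of the configuration [x]. *)
Definition lexc (x : UC) : pts := sval (cid (lex_sorted_ex x)).
Lemma confs_lexc x : confs x (lexc x).
Proof. exact: (svalP (cid (lex_sorted_ex x))).1. Qed.
Lemma lexcP x (i j : 'I_n) : (i < j)%N = lexlt (lexc x i) (lexc x j).
Proof. exact: (svalP (cid (lex_sorted_ex x))).2. Qed.

(** The straight motion from the family [c] to the family [d]. *)
Definition seg (c d : pts) (t : I) : pts :=
  fun i => (1 - itv_val t) *: c i + itv_val t *: d i.

Lemma seg0 c d : seg c d zero = c.
Proof. by apply/funext => i; rewrite /seg itv_val0 subr0 scale1r scale0r addr0. Qed.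
Lemma seg1 c d : seg c d one = d.
Proof. by apply/funext => i; rewrite /seg itv_val1 subrr scale1r scale0r add0r. Qed.

Lemma seg_path_ex (x y : UC) c d : confs x c -> confs y d ->
  (forall i j : 'I_n, (i < j)%N -> nap (c j - c i) (d j - d i)) ->
  {p : {path I from x to y} | lifts (seg c d) p}.
Proof.
move=> xc yd h; apply: path_of_lift; rewrite ?seg0 ?seg1 //.
  move=> i; apply: (@comb_continuous I (@itv_val R) (fun=> c i) (fun=> d i)).
  - exact: itv_val_continuous.
  - exact: cst_continuous.
  - exact: cst_continuous.
move=> t; apply: straight_valid => //; first exact: itv_01.
  exact: confs_valid xc.
exact: confs_valid yd.
Qed.

Lemma lexlt_nap (c : pts) x (i j : 'I_n) : confs x c -> lexlt (c i) (c j) -> (i < j)%N ->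
  nap (c j - c i) (base j - base i).
Proof.
move=> xc cij ij.
have h : 0 < (base j - base i).1 by rewrite /= subr_gt0 xr_lt.
case/orP: cij => [h1|/andP[_ h2]]; first by apply: nap_re => //=; rewrite subr_gt0.
apply: nap_im; rewrite /= ?subrr ?subr_gt0 //.
by apply: contraTneq h => ->; rewrite /= ltxx.
Qed.

Lemma lexp_ex x : {p : {path I from x to b0} | lifts (seg (lexc x) base) p}.
Proof.
apply: seg_path_ex; first exact: confs_lexc.
  suff <- : base \o (1%g : 'S_n) = base by exact: confs_b0.
  by apply/funext => i /=; rewrite perm1.
move=> i j ij; have cij : lexlt (lexc x i) (lexc x j) by rewrite -lexcP.
exact: (lexlt_nap (confs_lexc x) cij ij).
Qed.

(** A path from [x] to the base configuration: the points move straight to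
    the base points, in lexicographic order, which prevents collisions. *)
Definition lexp x := sval (lexp_ex x).
Lemma lexpP x : lifts (seg (lexc x) base) (lexp x).
Proof. exact: svalP (lexp_ex x). Qed.

(** The loop at the base configuration obtained from a path [q] from [x] to
    [y] by adding the paths [lexp] at both ends. It is multiplicative in [q],
    which reduces the study of long loops to that of short paths. *)
Definition base_loop (x y : UC) (q : {path I from x to y}) : braid_group b0 :=
  pi1_class (concat (reverse (lexp x)) (concat q (lexp y))).

Lemma base_loop_homotopic (x y : UC) (q r : {path I from x to y}) :
  homotopic q r -> base_loop q = base_loop r.
Proof.
move=> qr; apply/pi1_classP; apply: concat_homotopic (homotopic_refl _) _.
exact: concat_homotopic qr (homotopic_refl _).
Qed.

Lemma concatpV_homotopic (x y : UC) (p : {path I from x to y}) :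
  homotopic (concat p (reverse p)) (const_path R x).
Proof. by rewrite -{1}(reverseK p); exact: concatVp_homotopic. Qed.

Lemma base_loop_concat (x y z : UC) (q : {path I from x to y}) (r : {path I from y to z}) :
  base_loop (concat q r) = (base_loop q * base_loop r)%g.
Proof.
rewrite /base_loop [RHS]pi1_classM; apply/esym/pi1_classP.
apply: homotopic_trans (homotopic_sym (concatA_homotopic _ _ _)) _.
apply: concat_homotopic; first exact: homotopic_refl.
apply: homotopic_trans (homotopic_sym (concatA_homotopic _ _ _)) _.
apply: homotopic_trans (concatA_homotopic _ _ _).
apply: concat_homotopic; first exact: homotopic_refl.
apply: homotopic_trans (concatA_homotopic _ _ _) _.
apply: homotopic_trans (concat1_homotopic _).
apply: concat_homotopic; last exact: homotopic_refl.
exact: concatpV_homotopic.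
Qed.

Lemma base_loop_const x : base_loop (const_path R x) = 1%g.
Proof.
apply/pi1_classP.
apply: homotopic_trans (concatVp_homotopic (lexp x)).
apply: concat_homotopic; [exact: homotopic_refl|exact: concat1_homotopic].
Qed.

Lemma base_loop_reverse (x y : UC) (q : {path I from x to y}) : base_loop (reverse q) = (base_loop q)^-1%g.
Proof.
apply: (mulgI (base_loop q)); rewrite mulgV -base_loop_concat -(base_loop_const x).
exact/base_loop_homotopic/concatpV_homotopic.
Qed.

Lemma lexc_b0 : lexc b0 = base.
Proof.
have [w wE] := confs_uniq (confs_b0 R 1%g) (confs_lexc b0).
have w1 : w = 1%g.
  apply: perm_mono1 => i j; rewrite (lexcP b0) wE /= !perm1 /lexlt /= ltxx andbF orbF.
  by rewrite xr_lt.
by rewrite wE w1; apply/funext => i /=; rewrite !perm1.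
Qed.

Lemma lexp_b0 : homotopic (lexp b0) (const_path R b0).
Proof.
apply: (@homotopic_straight R n _ _ _ _ _ _ (lexpP b0) (lifts_const (confs_lexc b0))).
- by rewrite seg0.
- by rewrite seg1 lexc_b0.
move=> t i j ij; rewrite lexc_b0 /seg -!scalerDl subrK !scale1r; apply: nap_refl.
by apply/eqP => /(congr1 fst) /=; apply/eqP; rewrite subr_eq0 gt_eqF // xr_lt.
Qed.

Lemma base_loop_loop (q : {path I from b0 to b0}) : base_loop q = pi1_class q.
Proof.
apply/pi1_classP.
have h := lexp_b0; have h' := reverse_homotopic h.
apply: homotopic_trans (concat1_homotopic _).
apply: concat_homotopic.
  apply: homotopic_trans h' _.
  by apply: homotopic_eq => t; rewrite /= /mk_path /reverse_fun.
apply: homotopic_trans (concatp1_homotopic q).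
by apply: concat_homotopic => //; exact: homotopic_refl.
Qed.

End LexPath.

(** * Loops close to a configuration *)

Section NearbyLoops.
Variables (R : realType) (n : nat).
Local Notation UC := (unordered_conf n (disk R)).
Local Notation I := (unit_itv R).
Local Notation b0 := (b0 R n).
Local Notation base := (@base_pts R n).
Local Notation pts := (pts R n).
Local Notation lexc := (@lexc R n).

Lemma concat_fun0 (T : topologicalType) (f g : I -> T) : concat_fun f g zero = f zero.
Proof. by rewrite /concat_fun itv_val0 invr_ge0 ler0n mulr0 clamp_le0. Qed.

Lemma concat_fun1 (T : topologicalType) (f g : I -> T) : concat_fun f g one = g one.
Proof.
rewrite /concat_fun itv_val1 ifF ?clamp_ge1 //; first lra.
by apply/negbTE; rewrite -ltNge; lra.
Qed.

Lemma concat_diff (P : R * R -> Prop) (f f' g g' : I -> R * R) :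
  (forall t, P (f t - f' t)) -> (forall t, P (g t - g' t)) ->
  forall t, P (concat_fun f g t - concat_fun f' g' t).
Proof. by move=> fP gP t; rewrite /concat_fun; case: ifP. Qed.

Lemma seg_diff (c d : pts) t i j :
  seg c d t j - seg c d t i = (1 - itv_val t) *: (c j - c i) + itv_val t *: (d j - d i).
Proof. by rewrite /seg !scalerBr opprD addrACA. Qed.

Lemma comb_gt0 (t a b : R) : 0 <= t <= 1 -> 0 < a -> 0 < b -> 0 < (1 - t) * a + t * b.
Proof.
case/andP => t0 t1 a0 b0; have [t2|t2] := leP t 2^-1.
  by apply: ltr_wpDr; [apply: mulr_ge0 => //; exact: ltW|apply: mulr_gt0; lra].
by apply: ltr_wpDl; [apply: mulr_ge0; [lra|exact: ltW]|apply: mulr_gt0; lra].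
Qed.

Lemma comb_ge0 (t a b : R) : 0 <= t <= 1 -> 0 <= a -> 0 <= b -> 0 <= (1 - t) * a + t * b.
Proof. by case/andP => t0 t1 a0 b0; apply: addr_ge0; apply: mulr_ge0 => //; lra. Qed.

Lemma finite_gap (F : 'I_n -> 'I_n -> R) : (forall i j, 0 < F i j) ->
  exists2 r, 0 < r & forall i j, r <= F i j.
Proof.
move=> F0; exists (\big[Num.min/1]_(p : 'I_n * 'I_n) F p.1 p.2).
  by elim/big_ind: _ => // x y x0 y0; rewrite lt_min x0.
by move=> i j; apply: (bigmin_le_cond 1 (fun p : 'I_n * 'I_n => F p.1 p.2) (j := (i, j))).
Qed.

(** The condition on the difference of the i-th and j-th points (for [i < j])
    that holds near the lexicographic listing [c0]: positive first coordinate
    if the abscissas in [c0] differ, and positive second coordinate if they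
    coincide. Both conditions define convex cones without antipodal vectors,
    and the first coordinate may change sign in the second case. *)
Definition good (c0 : pts) (i j : 'I_n) (d : R * R) : Prop :=
  if (c0 i).1 < (c0 j).1 then 0 < d.1 else 0 < d.2.

Lemma good_comb c0 i j (t : I) d e : good c0 i j d -> good c0 i j e ->
  good c0 i j ((1 - itv_val t) *: d + itv_val t *: e).
Proof. by rewrite /good; case: ifP => _ ? ?; apply: comb_gt0 => //; exact: itv_01. Qed.

Lemma good_nap c0 i j d e : good c0 i j d -> good c0 i j e -> nap d e.
Proof.
rewrite /good; case: ifP => _ d0 e0; first exact: nap_re.
apply: nap_im => //; first exact: ltW.
by apply: contraTneq e0 => ->; rewrite ltxx.
Qed.

Section Local.
Variable x0 : UC.
Local Notation c0 := (lexc x0).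

Lemma lexc_good (i j : 'I_n) : (i < j)%N -> good c0 i j (c0 j - c0 i).
Proof.
rewrite (lexcP x0) /good => /orP[|/andP[/eqP -> h]].
  by move=> h; rewrite h /= subr_gt0.
by rewrite ltxx /= subr_gt0.
Qed.

Definition all_good (c : pts) := forall i j : 'I_n, (i < j)%N -> good c0 i j (c j - c i).

(** A configuration close to [x0] is joined to [x0] by a straight path. *)
Lemma star_ex x c : confs x c -> all_good c ->
  {p : {path I from x0 to x} | lifts (seg c0 c) p}.
Proof.
move=> xc cg; apply: seg_path_ex => //; first exact: confs_lexc.
by move=> i j ij; apply: good_nap (cg _ _ ij); exact: lexc_good.
Qed.

(** Closing up the straight path from [x0] to a nearby configuration gives a
    permutation braid: the loop from the base through [x0] and the nearby
    configuration back to the base is straight-line homotopic to a swing.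
    Points with distinct abscissas in [x0] never change order, and points on
    a common vertical line of [x0] never have the higher one pass below the
    lower one. *)
Lemma base_loop_star x c (p : {path I from x0 to x}) : lifts (seg c0 c) p -> all_good c ->
  exists w : 'S_n, base_loop p = perm_braid R w.
Proof.
move=> pl cg.
have xc : confs x c.
  by case: pl => _ /(_ one); rewrite path_one seg1.
have [w wE] := confs_uniq (confs_lexc x) xc.
exists w; apply/pi1_classP.
have h1 := lifts_concat pl (lifts_perm w (lexpP x)).
have h2 := lifts_concat (lifts_reverse (lexpP x0)) (h1 _).
have e1 : seg c0 c one = seg (lexc x) base zero \o w by rewrite seg0 seg1.
have {h1}h1 := h1 e1; have {h2}h2 := h2 e1.
have e2 : seg c0 base (clamp (1 - itv_val (one : I))) =
  (fun i => concat_fun (seg c0 c ^~ i) ((fun t => seg (lexc x) base t \o w) ^~ i) zero).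
  by apply/funext => i; rewrite concat_fun0 itv_val1 subrr clamp_le0 // !seg0.
have {h2}h2 := h2 e2.
apply: (@homotopic_straight R n _ _ _ _ _ _ h2 (swing_pathP R _ _ _)).
- apply/funext => i; rewrite concat_fun0 itv_val0 subr0 clamp_ge1 // seg1 swing0.
  by rewrite /= perm1.
- apply/funext => i; rewrite concat_fun1 concat_fun1 seg1.
  by rewrite itv_val1 swing1.
move=> t i j ij.
have ij' : i != j by rewrite -(inj_eq val_inj) ltn_eqF.
(* Either the pair has distinct abscissas in [x0] and keeps a positive first
   coordinate, or it is on a vertical line of [x0] and the second coordinate
   of its difference stays nonnegative. *)
have [re|im] := boolP ((c0 i).1 < (c0 j).1).
  have reg d : good c0 i j d = (0 < d.1 : Prop) by rewrite /good re.
  have wij : (w i < w j)%N.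
    rewrite (lexcP x); move: (cg i j ij); rewrite reg wE /= subr_gt0 => h.
    by rewrite /lexlt h.
  apply: nap_re; last first.
    by rewrite swing_diff /=; apply: xr_comb_gt0; rewrite ?itv_01 ?perm1.
  have bij : 0 < (base j - base i).1 by rewrite /= subr_gt0 xr_lt.
  have cij : 0 < (c j - c i).1 by have := cg i j ij; rewrite reg.
  have c0ij : 0 < (c0 j - c0 i).1 by have := lexc_good ij; rewrite reg.
  apply: (concat_diff (P := fun d => 0 < d.1)) => {}t; cbv beta.
    by rewrite seg_diff; apply: comb_gt0 => //; exact: itv_01.
  apply: (concat_diff (P := fun d => 0 < d.1)) => {}t; cbv beta.
    by rewrite seg_diff; apply: comb_gt0 => //; exact: itv_01.
  rewrite [X in 0 < X.1](seg_diff (lexc x) base t (w i) (w j)); apply: comb_gt0; first exact: itv_01.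
    by move: cij; rewrite wE.
  by rewrite /= subr_gt0 xr_lt.
have img d : good c0 i j d = (0 < d.2 : Prop) by rewrite /good (negbTE im).
have cij : 0 < (c j - c i).2 by have := cg i j ij; rewrite img.
have c0ij : 0 < (c0 j - c0 i).2 by have := lexc_good ij; rewrite img.
have ge0 : 0 <= (concat_fun
    (fun t2 : I => seg c0 base (clamp (1 - itv_val t2)) j)
    (fun t2 : I => concat_fun (fun t3 : I => seg c0 c t3 j)
       (fun t3 : I => (seg (lexc x) base t3 \o w) j) t2) t -
  concat_fun
    (fun t2 : I => seg c0 base (clamp (1 - itv_val t2)) i)
    (fun t2 : I => concat_fun (fun t3 : I => seg c0 c t3 i)
       (fun t3 : I => (seg (lexc x) base t3 \o w) i) t2) t).2.
  apply: (concat_diff (P := fun d => 0 <= d.2)) => {}t; cbv beta.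
    rewrite seg_diff; apply: comb_ge0; rewrite ?itv_01 ?(ltW c0ij) //.
    by rewrite /= subrr.
  apply: (concat_diff (P := fun d => 0 <= d.2)) => {}t; cbv beta.
    rewrite seg_diff; apply: comb_ge0; rewrite ?itv_01 ?(ltW c0ij) //.
    exact: ltW.
  rewrite [X in 0 <= X.2](seg_diff (lexc x) base t (w i) (w j)); apply: comb_ge0; first exact: itv_01.
    by move: (ltW cij); rewrite wE.
  by rewrite /= subrr.
have [tE|t0] := eqVneq t zero.
  rewrite tE !concat_fun0 itv_val0 subr0 clamp_ge1 // seg1 swing0 /= !perm1.
  by apply: nap_refl; apply/eqP => /(congr1 fst) /=; apply/eqP; rewrite subr_eq0 gt_eqF // xr_lt.
have [tE|t1] := eqVneq t one.
  rewrite tE !concat_fun1 itv_val1 seg1 swing1 /=.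
  by apply: nap_refl; have := @swing_neq R n w w w 0 _ _ ij'; rewrite swing0.
apply: nap_sym; apply: nap_im => //.
  rewrite swing_diff /= !perm1 mulr_gt0 ?subr_gt0 ?xr_lt //.
  apply: mulr_gt0.
    rewrite lt_neqAle itv_val_ge0 andbT eq_sym; apply: contraNneq t0 => e.
    by apply/eqP/itv_val_inj; rewrite itv_val0.
  rewrite subr_gt0 lt_neqAle itv_val_le1 andbT; apply: contraNneq t1 => e.
  by apply/eqP/itv_val_inj; rewrite itv_val1.
have [_ inj] := confs_valid (h2.2 t).
apply/eqP => /eqP; rewrite subr_eq0 => /eqP /inj e.
by move: ij'; rewrite e eqxx.
Qed.

End Local.
End NearbyLoops.

(** * Permutation braids generate the braid group *)

Section BraidGeneration.
Variables (R : realType) (n : nat).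
Local Notation UC := (unordered_conf n (disk R)).
Local Notation I := (unit_itv R).
Local Notation b0 := (b0 R n).
Local Notation pts := (pts R n).
Local Notation lexc := (@lexc R n).

(** [r] separates the lexicographic listing [c0]: each pair of points differs
    by at least [4 r] in the coordinate that decides its order. *)
Definition sep (c0 : pts) (r : R) := forall i j : 'I_n, (i < j)%N ->
  if (c0 i).1 < (c0 j).1 then 4 * r <= (c0 j).1 - (c0 i).1
  else 4 * r <= (c0 j).2 - (c0 i).2.

Lemma sep_ex x0 : exists2 r, 0 < r & sep (lexc x0) r.
Proof.
pose F (i j : 'I_n) : R := if (i < j)%N then
  (if (lexc x0 i).1 < (lexc x0 j).1 then ((lexc x0 j).1 - (lexc x0 i).1) / 4 else ((lexc x0 j).2 - (lexc x0 i).2) / 4) else 1.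
have [|r r0 rF] := @finite_gap R n F.
  move=> i j; rewrite /F; case: ifP => // /(lexc_good x0); rewrite /good.
  by case: ifP => _ h; exact: divr_gt0.
exists r => // i j ij; have := rF i j; rewrite /F ij.
by case: ifP => _ h; lra.
Qed.

Lemma close_good x0 r (d : pts) (i j : 'I_n) : sep (lexc x0) r -> (i < j)%N ->
  within_box (2 * r) (lexc x0 i) (d i) -> within_box (2 * r) (lexc x0 j) (d j) ->
  good (lexc x0) i j (d j - d i).
Proof.
move=> /(_ i j) h /h {h}; rewrite /good /within_box => h [].
rewrite !ltr_norml => /andP[a1 a2] /andP[a3 a4] [/andP[b1 b2] /andP[b3 b4]].
by move: h; case: ifP => _ h /=; lra.
Qed.

Lemma close_sep x0 r (d : pts) (i j : 'I_n) : sep (lexc x0) r ->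
  within_box (2 * r) (lexc x0 i) (d j) -> within_box (2 * r) (lexc x0 j) (d j) -> i = j.
Proof.
move=> h; rewrite /within_box => -[].
rewrite !ltr_norml => /andP[a1 a2] /andP[a3 a4] [/andP[b1 b2] /andP[b3 b4]].
by have [/h|/h|/val_inj//] := ltngtP i j; case: ifP => _ {}h; exfalso; lra.
Qed.

(** A configuration has at most one listing close to a separated family;
    hence the listing close to [c0] varies continuously. *)
Lemma close_uniq x0 r y (d e : pts) : sep (lexc x0) r -> confs y d -> confs y e ->
  (forall i, within_box (2 * r) (lexc x0 i) (d i)) -> (forall i, within_box (2 * r) (lexc x0 i) (e i)) ->
  d = e.
Proof.
move=> hs yd ye dc ec; have [s sE] := confs_uniq yd ye.
rewrite sE; apply/funext => i /=; congr d.
have ei := ec i; rewrite sE /= in ei.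
exact: (close_sep hs ei (dc (s i))).
Qed.

Variable Gen : braid_group b0 -> Prop.
Hypothesis Gen1 : Gen 1%g.
Hypothesis GenM : forall x y, Gen x -> Gen y -> Gen (x * y)%g.
Hypothesis GenV : forall x, Gen x -> Gen (x^-1)%g.
Hypothesis Gen_braid : forall w, Gen (perm_braid R w).

(** A path that stays close to [x0] is homotopic to the straight path to [x0]
    followed by the straight path to its end, so its closure is a product of
    a permutation braid and the inverse of one. *)
Lemma local_Gen (x0 x y : UC) (q : {path I from x to y}) r : 0 < r ->
  sep (lexc x0) r -> (forall t, conf_box (lexc x0) r (q t)) -> Gen (base_loop q).
Proof.
move=> r0 hs qV.
have /choice[C CE] : forall t, exists d, confs (q t) d /\ forall i, within_box r (lexc x0 i) (d i).
  by move=> t; have [d] := qV t; exists d.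
have Cq : lifts C q.
  split; last by move=> t; exact: (CE t).1.
  move=> i.
  (* Near [t0] there is a listing close to [C t0]; it is also close to the
     sorted points, so it is [C t]. *)
  have key (t0 : I) (e : R) : 0 < e -> \forall t \near t0, within_box e (C t0 i) (C t i).
    move=> e0; pose e' := Num.min e r.
    have e'0 : 0 < e' by rewrite /e' lt_min e0.
    have nb := conf_box_nbhs (CE t0).1 e'0.
    have qc : continuous q by exact: cts_fun.
    near=> t.
    have [d qd dc] : conf_box (C t0) e' (q t) by near: t; exact: (qc t0).
    have -> : C t = d.
      apply: (close_uniq hs (CE t).1 qd) => j.
        by have [] := (CE t).2 j; rewrite /within_box => h1 h2; split; lra.
      have [h1 h2] := (CE t0).2 j; have [h3 h4] := dc j.
      have e'r : e' <= r by rewrite /e' ge_min lexx orbT.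
      split.
        rewrite (_ : _ - _ = ((lexc x0 j).1 - (C t0 j).1) + ((C t0 j).1 - (d j).1)); last by ring.
        by apply: le_lt_trans (ler_normD _ _) _; lra.
      rewrite (_ : _ - _ = ((lexc x0 j).2 - (C t0 j).2) + ((C t0 j).2 - (d j).2)); last by ring.
      by apply: le_lt_trans (ler_normD _ _) _; lra.
    have [h3 h4] := dc i.
    have e'e : e' <= e by rewrite /e' ge_min lexx.
    by split; lra.
  rewrite (_ : C ^~ i = fun t => ((C t i).1, (C t i).2)); last first.
    by apply/funext => t; rewrite -surjective_pairing.
  apply: (@comp_pair_continuous I (R * R)%type R R id).
  - by move=> z; exact: cvg_id.
  - by move=> t0; apply/(@cvgrPdist_lt _ _ I (nbhs t0) (nbhs_filter t0)) => e /(key t0); apply: filterS => t [].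
  - by move=> t0; apply/(@cvgrPdist_lt _ _ I (nbhs t0) (nbhs_filter t0)) => e /(key t0); apply: filterS => t [].
have Cg t : all_good x0 (C t).
  move=> i j ij; apply: (close_good hs ij);
    by have [h1 h2] := (CE t).2 i; have [h3 h4] := (CE t).2 j; split; lra.
have x_C : confs x (C zero) by have := (CE zero).1; rewrite path_zero.
have y_C : confs y (C one) by have := (CE one).1; rewrite path_one.
have [p pl] := star_ex x_C (Cg zero).
have [p' pl'] := star_ex y_C (Cg one).
have [w wE] := base_loop_star pl (Cg zero).
have [w' wE'] := base_loop_star pl' (Cg one).
have -> : base_loop q = base_loop (concat (reverse p) p').
  apply: base_loop_homotopic.
  have h := lifts_concat (lifts_reverse pl) pl'.
  have e : seg (lexc x0) (C zero) (clamp (1 - itv_val (one : I))) = seg (lexc x0) (C one) zero.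
    by rewrite itv_val1 subrr clamp_le0 // !seg0.
  apply: (@homotopic_straight R n _ _ _ _ _ _ Cq (h e)).
  - by apply/funext => i; rewrite concat_fun0 itv_val0 subr0 clamp_ge1 // seg1.
  - by apply/funext => i; rewrite concat_fun1 seg1.
  move=> t i j ij; apply: good_nap (Cg t _ _ ij) _.
  apply: (concat_diff (P := good (lexc x0) i j)) => {}t; cbv beta; rewrite seg_diff;
    by apply: good_comb; [exact: lexc_good|exact: Cg].
rewrite base_loop_concat base_loop_reverse wE wE'.
by apply: GenM; [apply: GenV|].
Unshelve. all: by end_near.
Qed.

(** Every loop is a product of paths each of which stays close to some
    configuration. *)
Lemma Gen_all (x : braid_group b0) : Gen x.
Proof.
rewrite -(pi1_reprK x); move: (pi1_repr x) => {x} g.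
rewrite -base_loop_loop.
have gc : continuous g by exact: cts_fun.
pose Q (a b : R) := forall x y (q : {path I from x to y}),
  (forall t, q t = g (clamp (a + (b - a) * itv_val t))) -> Gen (base_loop q).
suff : Q 0 1.
  by apply => t; rewrite subr0 mul1r add0r clampK.
apply: segment_induction.
- move=> t0 t01; pose x0 := g (clamp t0).
  have [r r0 hs] := sep_ex x0.
  have nb : nbhs t0 ((g \o (@clamp R)) @^-1` conf_box (lexc x0) r).
    have cc : {for t0, continuous (g \o (@clamp R))}.
      by apply: continuous_comp; [exact: clamp_continuous|exact: gc].
    by apply: cc; exact: conf_box_nbhs (confs_lexc _) r0.
  have /nbhs_ballP[e /= e0 eV] := nb.
  exists e => // a b a0 ab b1 ta bt x y q qE.
  apply: (local_Gen r0 hs) => t; rewrite qE.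
  apply: (eV (a + (b - a) * itv_val t)).
  have /andP[s0 s1] := itv_01 t.
  have h : a <= a + (b - a) * itv_val t <= b.
    apply/andP; split; first by rewrite lerDl mulr_ge0 // subr_ge0.
    by rewrite -lerBrDl ler_piMr // subr_ge0.
  move: h => /andP[h1 h2]; rewrite /ball /= ltr_norml; apply/andP; split; lra.
- move=> a b c a0 ab bc c1 Qab Qbc x z q qE.
  have mid (u v : R) : continuous (fun t : I => g (clamp (u + (v - u) * itv_val t))).
    apply: clamp_comp_continuous => //; apply: continuous_add; first exact: continuous_cst.
    by apply: continuous_mul; [exact: continuous_cst|exact: itv_val_continuous].
  have e0 : g (clamp (a + (b - a) * itv_val (zero : I))) = x.
    by rewrite -(path_zero (s := q)) qE !itv_val0 !mulr0.
  have e1 : g (clamp (a + (b - a) * itv_val (one : I))) = g (clamp b).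
    by rewrite itv_val1 mulr1 subrKC.
  have e2 : g (clamp (b + (c - b) * itv_val (zero : I))) = g (clamp b).
    by rewrite itv_val0 mulr0 addr0.
  have e3 : g (clamp (b + (c - b) * itv_val (one : I))) = z.
    by rewrite -(path_one (s := q)) qE !itv_val1 !mulr1 !subrKC.
  pose q1 : {path I from x to (g (clamp b))} := mk_path (mid a b) e0 e1.
  pose q2 : {path I from (g (clamp b)) to z} := mk_path (mid b c) e2 e3.
  have -> : base_loop q = base_loop (concat q1 q2).
    apply: base_loop_homotopic.
    apply: (@reparam_homotopic _ _ _ _ g (fun t => a + (c - a) * itv_val t)
      (fun t => a + (b - a) * Num.min 1 (2 * itv_val t) + (c - b) * Num.max 0 (2 * itv_val t - 1))) => //.
    + apply: continuous_add; first exact: continuous_cst.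
      by apply: continuous_mul; [exact: continuous_cst|exact: itv_val_continuous].
    + have c2 : continuous (fun t : I => 2 * itv_val t).
        by apply: continuous_mul; [exact: continuous_cst|exact: itv_val_continuous].
      apply: continuous_add; first (apply: continuous_add; first exact: continuous_cst);
      apply: continuous_mul; try exact: continuous_cst.
        by apply: min_fun_continuous => //; exact: continuous_cst.
      apply: max_fun_continuous; first exact: continuous_cst.
      by apply: continuous_sub => //; exact: continuous_cst.
    + rewrite itv_val0 !mulr0 (min_idPr _) ?ler01 // (max_idPl _); last by lra.
      by rewrite !mulr0 !addr0.
    + rewrite itv_val1 (min_idPl _); last by lra.
      rewrite (max_idPr _); last by lra.
      lra.
    + move=> t; rewrite /= /mk_path /concat_fun /=; case: leP => t2.
        rewrite (min_idPr _); last by lra.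
        rewrite (max_idPl _); last by lra.
        by rewrite mulr0 addr0 /q1 /= /mk_path itv_val_clamp //; have := itv_val_ge0 t; lra.
      rewrite (min_idPl _); last by lra.
      rewrite (max_idPr _); last by lra.
      rewrite /q2 /= /mk_path itv_val_clamp; last by have := itv_val_le1 t; lra.
      by congr (g (clamp _)); ring.
  by rewrite base_loop_concat; apply: GenM; [exact: Qab|exact: Qbc].
Qed.

End BraidGeneration.

(** The permutation braids generate, stated as an induction principle. *)
Lemma braid_gen (R : realType) (n : nat) (S : braid_group (b0 R n) -> Prop) :
  S 1%g -> (forall x w, S x -> S (x * perm_braid R w)%g) ->
  (forall x w, S x -> S (x * (perm_braid R w)^-1)%g) -> forall x, S x.
Proof.
move=> S1 SM SV.
pose closed (T : braid_group (b0 R n) -> Prop) := [/\ T 1%g, (forall x w, T x -> T (x * perm_braid R w)%g) &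
  (forall x w, T x -> T (x * (perm_braid R w)^-1)%g)].
pose Gen x := forall T, closed T -> T x.
suff h x : Gen x by move=> x; apply: (h x).
have G1 : Gen 1%g by move=> T [].
have GB w : Gen (perm_braid R w) by move=> T [T1 TM _]; have := TM 1%g w T1; rewrite mul1g.
have GBV w : Gen ((perm_braid R w)^-1)%g by move=> T [T1 _ TV]; have := TV 1%g w T1; rewrite mul1g.
have GM y z : Gen y -> Gen z -> Gen (y * z)%g.
  move=> Gy Gz; apply: (Gz (fun z => Gen (y * z)%g)); split; first by rewrite mulg1.
    by move=> u w Gu T cT; case: (cT) => _ TM _; rewrite mulgA; apply: TM; exact: Gu.
  by move=> u w Gu T cT; case: (cT) => _ _ TV; rewrite mulgA; apply: TV; exact: Gu.
apply: Gen_all => // y Gy; apply: (Gy (fun y => Gen (y^-1)%g)); split.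
- by rewrite invg1.
- by move=> u w Gu; rewrite invgM; apply: GM.
- by move=> u w Gu; rewrite invgM invgK; apply: GM.
Qed.

(** * Monodromy of a local cocycle *)

Section Monodromy.
Variables (R : realType) (X : topologicalType) (A : groupType) (f : X -> X -> A).
Local Notation I := (unit_itv R).
Local Open Scope group_scope.
Hypothesis f_loc : forall x : X, exists tau : X -> A, exists2 V : set X, nbhs x V &
  forall y z, V y -> V z -> f y z = (tau y)^-1 * tau z.

Lemma floc_refl x : f x x = 1.
Proof.
have [tau [V xV h]] := f_loc x; rewrite (h x x) ?mulVg //; exact: nbhs_singleton.
Qed.

(** [F] is a primitive of the cocycle [f] along [g] on the interval from [a]
    to [b]. *)
Definition prim (g : R -> X) (a b : R) (F : R -> A) : Prop :=
  forall t0, (a <= t0 <= b)%R -> exists2 e : R, (0 < e)%R & forall t,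
    (a <= t <= b)%R -> (`|t - t0| < e)%R -> F t = F t0 * f (g t0) (g t).

Lemma prim_mull g a b F c : prim g a b F -> prim g a b (fun t => c * F t).
Proof. by move=> h t0 /h[e e0 he]; exists e => // t tab te; rewrite (he t) // mulgA. Qed.

Lemma prim_ext g g' a b F F' : prim g a b F ->
  (forall t, (a <= t <= b)%R -> g t = g' t) ->
  (forall t, (a <= t <= b)%R -> F t = F' t) -> prim g' a b F'.
Proof.
move=> h gg' FF' t0 t0ab; have [e e0 he] := h t0 t0ab; exists e => // t tab te.
by rewrite -!FF' // -!gg' // (he t).
Qed.

Lemma prim_glue g a b c F G : prim g a b F -> prim g b c G -> F b = G b ->
  prim g a c (fun t => if (t <= b)%R then F t else G t).
Proof.
move=> hF hG FG t0 /andP[at0 t0c]; case: (ltgtP t0 b) => t0b.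
- have [|e e0 he] := hF t0; first by rewrite at0 ltW.
  exists (Num.min e (b - t0)); first by rewrite lt_min e0 subr_gt0.
  move=> t /andP[a_t tc]; rewrite lt_min ltr_norml (ltr_norml (t - t0)%R (b - t0)%R).
  move=> /andP[/andP[h1 h2] /andP[h3 h4]].
  have tb : (t <= b)%R by lra.
  by rewrite tb; apply: he; rewrite ?a_t // ltr_norml h1.
- have [|e e0 he] := hG t0; first by rewrite t0c ltW.
  exists (Num.min e (t0 - b)); first by rewrite lt_min e0 subr_gt0.
  move=> t /andP[a_t tc]; rewrite lt_min ltr_norml (ltr_norml (t - t0)%R (t0 - b)%R).
  move=> /andP[/andP[h1 h2] /andP[h3 h4]].
  rewrite leNgt (_ : (b < t)%R) /=; last by lra.
  by apply: he; [apply/andP; split; lra|rewrite ltr_norml h1].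
- subst b.
  have [|e e0 he] := hF t0; first by rewrite at0 lexx.
  have [|e' e'0 he'] := hG t0; first by rewrite t0c lexx.
  exists (Num.min e e'); first by rewrite lt_min e0.
  move=> t /andP[a_t tc]; rewrite lt_min => /andP[h1 h2].
  case: (leP t t0) => tt0; first by apply: he => //; rewrite a_t.
  by rewrite FG; apply: he' => //; rewrite tc ltW.
Qed.

Lemma cont_dist (g : R -> X) (t0 : R) V : continuous g -> nbhs (g t0) V ->
  exists2 e, (0 < e)%R & forall t, (`|t - t0| < e)%R -> V (g t).
Proof.
move=> gc /gc /nbhs_ballP[e /= e0 eV]; exists e => // t te; apply: eV.
by rewrite /ball /= distrC.
Qed.

Lemma prim_ex (g : R -> X) : continuous g ->
  exists F, prim g 0%R 1%R F /\ F 0%R = 1.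
Proof.
move=> gc; suff [F hF] : exists F, prim g 0%R 1%R F.
  by exists (fun t => (F 0%R)^-1 * F t); rewrite mulVg; split => //; exact: prim_mull.
apply: (@segment_induction R (fun a b => exists F, prim g a b F)).
- move=> x x01; have [tau [V xV h]] := f_loc (g x).
  have [e e0 eV] := cont_dist gc xV.
  exists e => // a b a0 ab b1 xa bx; exists (tau \o g) => t0 /andP[at0 t0b].
  exists 1%R => // t /andP[a_t tb] _ /=.
  have nV u : (a <= u)%R -> (u <= b)%R -> V (g u).
    by move=> ? ?; apply: eV; rewrite ltr_norml; apply/andP; split; lra.
  by rewrite h ?mulKVg //; apply: nV.
- move=> a b c a0 ab bc c1 [F hF] [G hG].
  have hG' := prim_mull (F b * (G b)^-1) hG.
  by eexists; apply: (prim_glue hF hG'); rewrite mulgVK.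
Qed.

Lemma prim_uniq g F G : prim g 0%R 1%R F -> prim g 0%R 1%R G -> F 0%R = G 0%R ->
  F 1%R = G 1%R.
Proof.
move=> hF hG FG0.
suff : F 0%R * (G 0%R)^-1 = F 1%R * (G 1%R)^-1.
  rewrite FG0 mulgV => e; apply: (mulIg (G 1%R)^-1); by rewrite -e mulgV.
apply: (@segment_induction R (fun a b => F a * (G a)^-1 = F b * (G b)^-1)).
  move=> x x01; have [e e0 he] := hF x x01; have [e' e'0 he'] := hG x x01.
  exists (Num.min e e'); first by rewrite lt_min e0.
  move=> a b a0 ab b1 xa bx.
  have key t : (a <= t)%R -> (t <= b)%R -> F t * (G t)^-1 = F x * (G x)^-1.
    move=> a_t tb.
    have t01 : (0 <= t <= 1)%R by rewrite (le_trans a0 a_t) (le_trans tb b1).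
    have : (`|t - x| < Num.min e e')%R by rewrite ltr_norml; apply/andP; split; lra.
    rewrite lt_min => /andP[te te'].
    by rewrite (he t) // (he' t) // invgM mulgA mulgK.
  by rewrite (key a) // (key b).
move=> a b c _ _ _ _ e1 e2; exact: (etrans e1 e2).
Qed.

Lemma path_clamp_continuous (x y : X) (p : {path I from x to y}) :
  continuous (fun t : R => p (clamp t)).
Proof.
apply: (@clamp_comp_continuous R X R p id); first exact: cts_fun.
by move=> t; exact: cvg_id.
Qed.

(** The value at 1 of the primitive along [p] that starts at the neutral
    element. *)
Definition monodromy (x y : X) (p : {path I from x to y}) : A :=
  sval (cid (prim_ex (@path_clamp_continuous x y p))) 1%R.

Lemma monodromyE (x y : X) (p : {path I from x to y}) F :
  prim (fun t => p (clamp t)) 0%R 1%R F -> F 0%R = 1 -> monodromy p = F 1%R.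
Proof.
move=> hF F0; rewrite /monodromy; case: cid => G /= [hG G0].
by apply: (prim_uniq hG hF); rewrite G0.
Qed.

Lemma monodromyP (x y : X) (p : {path I from x to y}) : exists F,
  [/\ prim (fun t => p (clamp t)) 0%R 1%R F, F 0%R = 1 & F 1%R = monodromy p].
Proof.
rewrite /monodromy; case: cid => F /= [hF F0]; by exists F.
Qed.

Lemma prim_affine g a b F (u v : R) : (0 < u)%R -> prim g (u * a + v)%R (u * b + v)%R F ->
  prim (fun t => g (u * t + v)%R) a b (fun t => F (u * t + v)%R).
Proof.
move=> u0 h t0 /andP[at0 t0b].
have uab t : (a <= t)%R -> (t <= b)%R -> (u * a + v <= u * t + v <= u * b + v)%R.
  by move=> ? ?; rewrite !lerD2r !ler_pM2l // ; apply/andP; split.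
have [e e0 he] := h _ (uab _ at0 t0b).
exists (e / u)%R; first exact: divr_gt0.
move=> t /andP[a_t tb]; rewrite ltr_pdivlMr // => te.
apply: he; first exact: uab.
by rewrite (_ : _ - _ = (t - t0) * u)%R; [rewrite normrM (gtr0_norm u0)|ring].
Qed.

Lemma monodromy_concat (x y z : X) (p : {path I from x to y}) (q : {path I from y to z}) :
  monodromy (concat p q) = monodromy p * monodromy q.
Proof.
have [F [hF F0 <-]] := monodromyP p; have [G [hG G0 <-]] := monodromyP q.
pose F' t := F (2 * t + 0)%R; pose G' t := F 1%R * G (2 * t + -1)%R.
have hF' : prim (fun t => concat p q (clamp t)) 0%R (2^-1)%R F'.
  have e1 : (2 * 0 + 0 = 0 :> R)%R by lra.
  have e2 : (2 * 2^-1 + 0 = 1 :> R)%R by lra.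
  apply: prim_ext (@prim_affine _ 0%R (2^-1)%R F 2%R 0%R _ _) _ _ => //.
  - by rewrite e1 e2; exact: hF.
  - move=> t /andP[t0 t1]; rewrite /= /mk_path /concat_fun itv_val_clamp; last by lra.
    by rewrite t1 addr0.
have hG' : prim (fun t => concat p q (clamp t)) (2^-1)%R 1%R G'.
  have e1 : (2 * 2^-1 + -1 = 0 :> R)%R by lra.
  have e2 : (2 * 1 + -1 = 1 :> R)%R by lra.
  apply: prim_mull.
  apply: prim_ext (@prim_affine _ (2^-1)%R 1%R G 2%R (-1)%R _ _) _ _ => //.
  - by rewrite e1 e2; exact: hG.
  - move=> t /andP[t0 t1]; rewrite /= /mk_path /concat_fun itv_val_clamp; last by lra.
    case: ltgtP t0 => // tE _.
    by rewrite -tE divff ?pnatr_eq0 // subrr (@clamp_ge1 _ 1%R) // (@clamp_le0 _ 0%R) // path_one path_zero.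
have -> := monodromyE (prim_glue hF' hG' _).
- rewrite lt_geF ?/G'; last by lra.
  by congr (_ * G _); lra.
- rewrite /F' /G' addr0 divff ?pnatr_eq0 // subrr G0 mulg1 //.
- by rewrite invr_ge0 ler0n /F' mulr0 addr0.
Qed.

(** The monodromy of the paths of a homotopy is locally constant. If [F] is a
    primitive along the path of parameter [s0], then
    [F t * f (h s0 t) (h s t)] is a primitive along the path of a nearby
    parameter [s], by the cocycle identity on small squares; compactness of
    the interval makes the choice of [s] uniform in [t]. *)
Lemma monodromy_homotopic (x y : X) (p q : {path I from x to y}) :
  homotopic p q -> monodromy p = monodromy q.
Proof.
move=> [H [Hc H0 H1 He]].
pose h (s t : R) : X := H (clamp s, clamp t).
have hc : continuous (fun z : R * R => h z.1 z.2).
  apply: comp_pair_continuous => //; apply: clamp_fun_continuous => z;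
    [exact: cvg_fst|exact: cvg_snd].
have hsc s : continuous (h s).
  apply: (@comp_pair_continuous R X I I H (fun=> clamp s) (@clamp R)) => //.
    exact: cst_continuous.
  exact: clamp_continuous.
pose m s := sval (cid (prim_ex (hsc s))) 1%R.
have mE s F : prim (h s) 0%R 1%R F -> F 0%R = 1 -> m s = F 1%R.
  move=> hF F0; rewrite /m; case: cid => G /= [hG G0].
  by apply: (prim_uniq hG hF); rewrite G0.
have mp : m 0%R = monodromy p.
  have [F [hF F0 <-]] := monodromyP p; apply: (mE _ _ _ F0).
  by apply: prim_ext hF _ _ => // t _; rewrite /h (@clamp_le0 _ 0%R) // H0.
have mq : m 1%R = monodromy q.
  have [F [hF F0 <-]] := monodromyP q; apply: (mE _ _ _ F0).
  by apply: prim_ext hF _ _ => // t _; rewrite /h (@clamp_ge1 _ 1%R) // H1.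
rewrite -mp -mq; apply: (@segment_induction R (fun a b => m a = m b)); last first.
  by move=> a b c _ _ _ _ e1 e2; exact: (etrans e1 e2).
move=> s0 s01.
pose P (s t0 : R) := exists2 e, (0 < e)%R & forall t, (`|t - t0| < e)%R ->
  f (h s0 t0) (h s t0) * f (h s t0) (h s t) = f (h s0 t0) (h s0 t) * f (h s0 t) (h s t).
have cP : \forall s \near s0, [set t | (0 <= t <= 1)%R] `<=` P s.
  have cpt : compact [set t : R | (0 <= t <= 1)%R].
    by rewrite (_ : [set _ | _] = `[0%R, 1%R]%classic) //; exact: segment_compact.
  have /compact_near_coveringP cov := cpt.
  apply: (cov R (nbhs s0) P) => t0 t01.
  have [tau [V xV hV]] := f_loc (h s0 t0).
  have := hc (s0, t0) _ xV => /nbhs_ballP[e /= e0 eV].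
  have e20 : (0 < e / 2)%R by lra.
  have hsV s t : (`|s0 - s| < e)%R -> (`|t0 - t| < e)%R -> V (h s t).
    by move=> h1 h2; apply: (eV (s, t)); split; rewrite /ball /=.
  have nn : (`|s0 - s0| < e)%R by rewrite subrr normr0.
  exists (ball t0 (e / 2)%R, ball s0 e) => /=.
    by split; exact: nbhsx_ballx.
  move=> [t s] [/= ht hs]; exists (e / 2)%R => // t'.
  move: ht; rewrite /ball /= !ltr_norml => /andP[a1 a2] /andP[b1 b2].
  have ht : (`|t0 - t| < e)%R by rewrite ltr_norml; apply/andP; split; lra.
  have ht' : (`|t0 - t'| < e)%R by rewrite ltr_norml; apply/andP; split; lra.
  have v1 := hsV _ _ nn ht; have v2 := hsV _ _ nn ht'.
  have v3 := hsV _ _ hs ht; have v4 := hsV _ _ hs ht'.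
  by rewrite !hV // -!mulgA !mulKVg.
have [e /= e0 eP] := (nbhs_ballP _ _).1 cP.
have key s : (`|s - s0| < e)%R -> m s = m s0.
  move=> se; have sP : [set t | (0 <= t <= 1)%R] `<=` P s.
    by apply: eP; rewrite /ball /= distrC.
  rewrite {2}/m; case: cid => F /= [hF F0].
  rewrite (mE s (fun t => F t * f (h s0 t) (h s t))).
  - by rewrite /h (@clamp_ge1 _ 1%R) // !(He _).2 floc_refl mulg1.
  - move=> t0 t01; have [e1 e10 he1] := hF t0 t01; have [e2 e20 he2] := sP t0 t01.
    exists (Num.min e1 e2); first by rewrite lt_min e10.
    move=> t tt; rewrite lt_min => /andP[h1 h2].
    by rewrite (he1 t) // -!mulgA he2.
  - by rewrite /h (@clamp_le0 _ 0%R) // !(He _).1 floc_refl mulg1.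
exists e => // a b a0 ab b1 sa bs.
by rewrite !key // ltr_norml; apply/andP; split; lra.
Qed.

End Monodromy.

(** * The crossing cocycle *)

Section CrossingGroup.
Variable n : nat.

(** The semidirect product of the permutations with the integer families
    indexed by pairs of strands, on which they act by relabelling. *)
Definition crossing_group : Type := ('S_n * {ffun 'I_n * 'I_n -> int})%type.
HB.instance Definition _ := Choice.on crossing_group.
Implicit Types a b c : crossing_group.

Definition cg_mul a b : crossing_group :=
  ((a.1 * b.1)%g, [ffun p => a.2 p + b.2 (a.1 p.1, a.1 p.2)]).
Definition cg_one : crossing_group := (1%g, [ffun=> 0]).
Definition cg_inv a : crossing_group :=
  ((a.1^-1)%g, [ffun p => - a.2 ((a.1^-1)%g p.1, (a.1^-1)%g p.2)]).

Lemma cg_mulA : associative cg_mul.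
Proof.
move=> a b c; congr (_, _); rewrite /= ?mulgA //.
by apply/ffunP => p; rewrite !ffunE /= !permM addrA.
Qed.
Lemma cg_mul1 : left_id cg_one cg_mul.
Proof.
case=> u a; congr (_, _); rewrite /= ?mul1g //.
by apply/ffunP => -[i j]; rewrite !ffunE /= !perm1 add0r.
Qed.
Lemma cg_mulr1 : right_id cg_one cg_mul.
Proof.
case=> u a; congr (_, _); rewrite /= ?mulg1 //.
by apply/ffunP => -[i j]; rewrite !ffunE /= addr0.
Qed.
Lemma cg_mulV : left_inverse cg_one cg_inv cg_mul.
Proof.
case=> u a; congr (_, _); rewrite /= ?mulVg //.
by apply/ffunP => -[i j]; rewrite !ffunE /= addNr.
Qed.
Lemma cg_mulrV : right_inverse cg_one cg_inv cg_mul.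
Proof.
case=> u a; congr (_, _); rewrite /= ?mulgV //.
by apply/ffunP => -[i j]; rewrite !ffunE /= !permK subrr.
Qed.
HB.instance Definition _ :=
  isGroup.Build crossing_group cg_mulA cg_mul1 cg_mulr1 cg_mulV cg_mulrV.
End CrossingGroup.

Section HalfTurn.
Variable R : realType.
Implicit Types d e : R * R.

(** [d] is lexicographically positive: half of the nonzero vectors of the
    plane, the other half being their opposites. *)
Definition lexpos d := (0 < d.1) || ((d.1 == 0) && (0 < d.2)).
(** The signed number of times that the segment from [d] to [e] crosses the
    line separating lexicographically positive vectors from negative ones;
    for a segment that avoids the origin, a counterclockwise crossing counts
    1 and a clockwise one -1, whether it enters or leaves the positive
    vectors, so that a full turn counts 2. *)
Definition half_turn d e : int :=
  if lexpos d == lexpos e then 0 else if 0 < d.1 * e.2 - d.2 * e.1 then 1 else -1.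

Lemma lexposN d : d != 0 -> lexpos (- d) = ~~ lexpos d.
Proof.
case: d => x y; rewrite /lexpos /= !oppr_gt0 oppr_eq0 => d0.
case: (ltgtP x 0) => //= xE; subst x; case: (ltgtP y 0) => //= yE.
by move: d0; rewrite yE eqxx.
Qed.

Lemma half_turnN d e : d != 0 -> e != 0 -> half_turn (- d) (- e) = half_turn d e.
Proof.
move=> d0 e0; rewrite /half_turn !lexposN // (inj_eq negb_inj).
by rewrite /= !mulrNN.
Qed.

Lemma half_turn_re d e : 0 < d.1 -> 0 < e.1 -> half_turn d e = 0.
Proof. by move=> d0 e0; rewrite /half_turn /lexpos d0 e0. Qed.

Lemma half_turn_re_neg d e : d.1 < 0 -> e.1 < 0 -> half_turn d e = 0.
Proof.
move=> d0 e0; rewrite /half_turn /lexpos.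
by rewrite (lt_gtF d0) (lt_gtF e0) (lt_eqF d0) (lt_eqF e0).
Qed.

(** In the upper half plane the half turns are the variation of the indicator
    of the positive vectors. *)
Lemma half_turn_im d e : 0 < d.2 -> 0 < e.2 ->
  half_turn d e = (lexpos d)%:Z - (lexpos e)%:Z.
Proof.
case: d e => [a b] [c d]; rewrite /half_turn /lexpos /= => b0 d0.
rewrite b0 d0 !andbT ![_ || (_ == _)]orbC ![_ == 0]eq_sym -!le_eqVlt.
case: (leP 0 a) => a0; case: (leP 0 c) => c0 //=.
  rewrite ifT // subr_gt0; apply: (@lt_le_trans _ _ 0).
    by rewrite pmulr_rlt0.
  by apply: mulr_ge0 => //; exact: ltW.
rewrite ifF // subr_gt0; apply/negbTE; rewrite -leNgt; apply: (@le_trans _ _ 0).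
  by rewrite nmulr_rle0 // ltW.
by apply: mulr_ge0 => //; exact: ltW.
Qed.
End HalfTurn.

Section Cocycle.
Variables (R : realType) (n : nat).
Local Notation UC := (unordered_conf n (disk R)).
Local Notation pts := (pts R n).
Local Notation lexc := (@lexc R n).
Local Notation A := (crossing_group n).

Definition dist (a b : R * R) : R := Num.max `|a.1 - b.1| `|a.2 - b.2|.

(** [s] matches each point of [c] with its strictly nearest point in [d]. *)
Definition nearest (c d : pts) (s : 'S_n) : Prop :=
  forall i j : 'I_n, j != s i -> dist (c i) (d (s i)) < dist (c i) (d j).

Lemma nearest_uniq c d s t : nearest c d s -> nearest c d t -> s = t.
Proof.
move=> hs ht; apply/permP => i; apply/eqP; apply: contraT => st.
have := hs i (t i); rewrite eq_sym st => /(_ isT) h1.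
by have := ht i (s i) st; rewrite ltNge ltW.
Qed.

(** The cocycle, significant for nearby configurations, both listed
    lexicographically: the matching of nearest points, and the half turns of
    the difference vectors of matched pairs. The value is 1 when there is no
    such matching. *)
Definition crossings (x y : UC) : A :=
  match pselect (exists s, nearest (lexc x) (lexc y) s) with
  | left ex => let s := sval (cid ex) in
     (s, [ffun p => half_turn (lexc x p.2 - lexc x p.1) (lexc y (s p.2) - lexc y (s p.1))])
  | right _ => 1%g
  end.

Lemma crossingsE x y s : nearest (lexc x) (lexc y) s -> crossings x y =
  (s, [ffun p => half_turn (lexc x p.2 - lexc x p.1) (lexc y (s p.2) - lexc y (s p.1))]).
Proof.
move=> hs; rewrite /crossings; case: pselect => [ex|]; last by case; exists s.
by case: cid => s' /= hs'; rewrite (nearest_uniq hs' hs).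
Qed.

(** The value of the cocycle read on arbitrary listings [c] and [d] matched
    index by index. *)
Lemma crossings_labelled (x y : UC) (c d : pts) (u v : 'S_n) :
  (forall i, c i = lexc x (u i)) -> (forall i, d i = lexc y (v i)) ->
  (forall i j : 'I_n, j != i -> dist (c i) (d i) < dist (c i) (d j)) ->
  crossings x y = ((u^-1 * v)%g, [ffun p =>
    half_turn (c ((u^-1)%g p.2) - c ((u^-1)%g p.1)) (d ((u^-1)%g p.2) - d ((u^-1)%g p.1))]).
Proof.
move=> cE dE h.
have ns : nearest (lexc x) (lexc y) (u^-1 * v)%g.
  move=> i j; rewrite permM => jn.
  have := h ((u^-1)%g i) ((v^-1)%g j).
  rewrite cE !dE !permKV; apply.
  by apply: contraNneq jn => <-; rewrite permKV.
rewrite (crossingsE ns); congr (_, _); apply/ffunP => p; rewrite !ffunE.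
by rewrite !cE !dE !permM !permKV.
Qed.

Lemma dist_lt a b (r : R) : (dist a b < r) <-> within_box r a b.
Proof. by rewrite /dist gt_max; split => [/andP//|[-> ->]]. Qed.

Lemma within_box_tri a b c (r s : R) : within_box r a b -> within_box s b c ->
  within_box (r + s) a c.
Proof.
rewrite /within_box !ltr_norml => -[/andP[a1 a2] /andP[a3 a4]] [/andP[b1 b2] /andP[b3 b4]].
by split; apply/andP; split; lra.
Qed.
Lemma within_box_sym a b (r : R) : within_box r a b -> within_box r b a.
Proof. by rewrite /within_box distrC [`|a.2 - _|]distrC. Qed.

Lemma nearest_ball x0 r (c d : pts) : 0 < r -> sep (lexc x0) r ->
  (forall i, within_box r (lexc x0 i) (c i)) -> (forall i, within_box r (lexc x0 i) (d i)) ->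
  forall i j : 'I_n, j != i -> dist (c i) (d i) < dist (c i) (d j).
Proof.
move=> r0 hs hc hd i j ji.
have h1 : dist (c i) (d i) < 2 * r.
  by apply/dist_lt; rewrite mulr_natl; apply: within_box_tri (hd i); apply: within_box_sym.
apply: lt_le_trans h1 _; rewrite leNgt; apply/negP => /dist_lt h2.
have := within_box_tri (within_box_tri (hc i) h2) (within_box_sym (hd j)).
rewrite /within_box !ltr_norml => -[/andP[a1 a2] /andP[a3 a4]].
have [ij|ij|/val_inj ij] := ltngtP i j.
- by have := hs _ _ ij; case: ifP => _ h; lra.
- by have := hs _ _ ij; case: ifP => _ h; lra.
- by move: ji; rewrite ij eqxx.
Qed.

(** Close to [x0] the cocycle is a coboundary: list the nearby configurations
    as their closest listing, and record for each pair [i < j] whether the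
    difference vector is lexicographically positive. All difference vectors
    of the pair lie in a half plane where this determines the half turns. *)
Lemma crossings_loc (x0 : UC) : exists tau : UC -> A, exists2 V : set UC, nbhs x0 V &
  forall y z, V y -> V z -> crossings y z = ((tau y)^-1 * tau z)%g.
Proof.
have [r r0 hs] := sep_ex x0.
pose V := conf_box (lexc x0) r.
have /choice[xi xiP] : forall y, exists s : 'S_n, V y ->
    forall i, within_box r (lexc x0 i) (lexc y (s i)).
  move=> y; have [[d yd hd]|nV] := pselect (V y); last by exists 1%g.
  have [s sE] := confs_uniq (confs_lexc y) yd; exists s => _ i.
  by have := hd i; rewrite sE.
pose pr (y : UC) (i j : 'I_n) := lexc y (xi y j) - lexc y (xi y i).
pose tau y : A := (xi y, [ffun p : 'I_n * 'I_n =>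
  if (p.1 < p.2)%N then - (lexpos (pr y p.1 p.2))%:Z
  else if (p.2 < p.1)%N then - (lexpos (pr y p.2 p.1))%:Z else 0]).
exists tau; exists V; first exact: conf_box_nbhs (confs_lexc x0) r0.
move=> y z Vy Vz.
rewrite (@crossings_labelled y z (lexc y \o xi y) (lexc z \o xi z) (xi y) (xi z)) //; last first.
  by apply: nearest_ball r0 hs _ _ => i; exact: xiP.
rewrite /tau; congr (_, _); apply/ffunP => p; rewrite !ffunE /=.
set i := ((xi y)^-1)%g p.1; set j := ((xi y)^-1)%g p.2.
have key (k l : 'I_n) : (k < l)%N -> half_turn (pr y k l) (pr z k l) =
    (lexpos (pr y k l))%:Z - (lexpos (pr z k l))%:Z.
  move=> kl.
  have gd w : V w -> good (lexc x0) k l (pr w k l).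
    move=> Vw; apply: (@close_good _ _ _ _ (lexc w \o xi w) _ _ hs kl);
      by have [h1 h2] := xiP w Vw k; have [h3 h4] := xiP w Vw l; split => /=; lra.
  have := gd y Vy; have := gd z Vz; rewrite /good; case: ifP => _ hz hy.
    by rewrite half_turn_re // /lexpos hy hz subrr.
  by rewrite half_turn_im.
have pr0 w (k l : 'I_n) : k != l -> pr w k l != 0.
  move=> kl; rewrite subr_eq0; apply: contraNneq kl.
  by have [_ inj] := confs_valid (confs_lexc w) => /inj/perm_inj ->.
case: ltngtP => ij.
- by rewrite (key _ _ ij) opprK.
- have ij' : j != i by rewrite -(inj_eq val_inj) ltn_eqF.
  rewrite -(opprB (lexc y _)) -(opprB (lexc z _)) half_turnN; try exact: pr0.
  by rewrite (key _ _ ij) opprK.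
- rewrite (val_inj ij) !subrr. by rewrite /half_turn eqxx.
Qed.

End Cocycle.

(** * Crossings of a permutation braid *)

Section SwingCrossings.
Variables (R : realType) (n : nat).
Local Notation b0 := (b0 R n).
Local Notation base := (@base_pts R n).
Local Notation pts := (pts R n).
Local Notation lexc := (@lexc R n).
Local Notation A := (crossing_group n).

Lemma base_inj : injective base.
Proof. by have [_] := base_valid R n. Qed.

Lemma continuous_fst (Y : topologicalType) (u : Y -> R * R) :
  continuous u -> continuous (fun y => (u y).1).
Proof. by move=> uc y; apply: (@continuous_comp _ _ _ u fst); [exact: uc|exact: cvg_fst]. Qed.

Lemma continuous_snd (Y : topologicalType) (u : Y -> R * R) :
  continuous u -> continuous (fun y => (u y).2).
Proof. by move=> uc y; apply: (@continuous_comp _ _ _ u snd); [exact: uc|exact: cvg_snd]. Qed.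

Lemma near_gt0 (u : R -> R) t0 : continuous u -> 0 < u t0 -> \forall t \near t0, 0 < u t.
Proof. by move=> uc u0; apply: (uc t0 [set x | 0 < x]); apply: open_nbhs_nbhs; split => //; exact: open_gt. Qed.

(** Along a permutation braid the pair [i < j] makes one half turn if it is
    inverted and none otherwise. The primitive counts, for each pair, whether
    the difference vector has become negative. *)
Lemma crossings_swing (w : 'S_n) :
  monodromy (@crossings_loc R n) (swing_path R 1 w 1) =
  (w, [ffun p : 'I_n * 'I_n => (((p.1 < p.2) && (w p.2 < w p.1) ||
     (p.2 < p.1) && (w p.1 < w p.2))%N : nat)%:Z]).
Proof.
set p := swing_path R 1 w 1.
have [pc pC] := swing_pathP R (1%g : 'S_n) w 1%g.
rewrite -/p in pC.
pose C (t : R) : pts := swing 1 w 1 (itv_val (clamp t)).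
have pCt t : confs (p (clamp t)) (C t) by exact: pC.
have Cc i : continuous (fun t : R => C t i).
  by move=> t; apply: (@continuous_comp _ _ _ (@clamp R) (fun s => swing 1 w 1 (itv_val s) i));
    [exact: clamp_continuous|exact: pc].
have /choice[xi xiE] t : exists s : 'S_n, C t = lexc (p (clamp t)) \o s.
  exact: confs_uniq (confs_lexc _) (pCt t).
pose dC t (i j : 'I_n) := C t j - C t i.
have d1c i j : continuous (fun t => (dC t i j).1).
  by apply: continuous_sub; exact: continuous_fst.
have d2c i j : continuous (fun t => (dC t i j).2).
  by apply: continuous_sub; exact: continuous_snd.
pose N t (i j : 'I_n) : int := (~~ lexpos (dC t i j) : nat)%:Z.
pose F t : A := (xi t, [ffun q : 'I_n * 'I_n => if (q.1 < q.2)%N then N t q.1 q.2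
  else if (q.2 < q.1)%N then N t q.2 q.1 else 0]).
have b0E t : (p (clamp t) = b0) -> lexc (p (clamp t)) = base by move=> ->; exact: lexc_b0.
have C0 : C 0 = base by apply/funext => i; rewrite /C itv_val_clamp ?lexx ?ler01 // swing0 /= perm1.
have C1 : C 1 = base \o w by rewrite /C itv_val_clamp ?lexx ?ler01 // swing1.
have xi0 : xi 0 = 1%g.
  apply/permP => i; apply: base_inj; have := congr1 (@^~ i) (xiE 0).
  by rewrite b0E ?C0 /= ?perm1 // (@clamp_le0 _ 0) // path_zero.
have xi1 : xi 1 = w.
  apply/permP => i; apply: base_inj; have := congr1 (@^~ i) (xiE 1).
  by rewrite b0E ?C1 //= (@clamp_ge1 _ 1) // path_one.
have lexpos_base (i j : 'I_n) : lexpos (base j - base i) = (i < j)%N.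
  by rewrite /lexpos /= subrr ltxx andbF orbF subr_gt0 xr_lt.
have F0 : F 0 = 1%g.
  rewrite /F xi0; congr (_, _); apply/ffunP => q; rewrite !ffunE /N /dC C0.
  by rewrite !lexpos_base; case: ltngtP.
have -> := @monodromyE _ _ _ _ (@crossings_loc R n) _ _ p F _ F0.
  rewrite /F xi1; congr (_, _); apply/ffunP => q; rewrite !ffunE /N /dC C1 /=.
  rewrite !lexpos_base -!leqNgt.
  have [qn|qq|/val_inj qq] := ltngtP q.1 q.2 => //=.
  - by rewrite leq_eqVlt (inj_eq val_inj) (inj_eq perm_inj) -(inj_eq val_inj) gtn_eqF ?orbF.
  - by rewrite leq_eqVlt (inj_eq val_inj) (inj_eq perm_inj) -(inj_eq val_inj) gtn_eqF.
move=> t0 t01.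
have [r r0 hs] := sep_ex (p (clamp t0)).
have near_box : \forall t \near t0, forall i, within_box r (C t0 i) (C t i).
  apply: (@filter_forall _ _ (fun i => [set t : R | within_box r (C t0 i) (C t i)]) (nbhs t0) (nbhs_filter t0)) => i; apply: (Cc i t0 [set b | within_box r (C t0 i) b]).
  apply: open_nbhs_nbhs; split; first exact: within_box_open.
  by rewrite /= /within_box !subrr normr0.
have near_pair : \forall t \near t0, forall q : 'I_n * 'I_n, (q.1 < q.2)%N ->
    half_turn (dC t0 q.1 q.2) (dC t q.1 q.2) = N t q.1 q.2 - N t0 q.1 q.2.
  apply: (@filter_forall _ _ (fun q : 'I_n * 'I_n => [set t : R | (q.1 < q.2)%N ->
    half_turn (dC t0 q.1 q.2) (dC t q.1 q.2) = N t q.1 q.2 - N t0 q.1 q.2])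
    (nbhs t0) (nbhs_filter t0)) => -[i j] /=.
  have [ij|_] := boolP (i < j)%N; last by near=> t.
  have dE : dC t0 i j = ((1 - t0) * (xr R n j - xr R n i) + t0 * (xr R n (w j) - xr R n (w i)),
      t0 * (1 - t0) * (xr R n j - xr R n i)).
    by rewrite /dC /C itv_val_clamp // swing_diff !perm1.
  have Nd t : lexpos (dC t i j) = lexpos (dC t0 i j) -> N t i j - N t0 i j = 0.
    by rewrite /N => ->; rewrite subrr.
  have [h|h|h] := ltgtP (dC t0 i j).1 0.
  - have : \forall t \near t0, 0 < - (dC t i j).1.
      by apply: (@near_gt0 (fun t => - (dC t i j).1)); [move=> t; apply: cvgN; exact: d1c|rewrite oppr_gt0].
    apply: filterS => t; rewrite oppr_gt0 => ht _.
    by rewrite half_turn_re_neg // Nd // /lexpos (lt_gtF h) (lt_gtF ht) (lt_eqF h) (lt_eqF ht).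
  - have : \forall t \near t0, 0 < (dC t i j).1 by apply: near_gt0.
    apply: filterS => t ht _.
    by rewrite half_turn_re // Nd // /lexpos h ht.
  (* When the two points are on a vertical line, the one of larger index is
     above. *)
  - have h2 : 0 < (dC t0 i j).2.
      rewrite dE /= mulr_gt0 ?subr_gt0 ?xr_lt //.
      case/andP: t01 => t00 t01.
      have n0 : t0 != 0.
        apply: contra_eq_neq h => e; rewrite dE /= e subr0 mul1r mul0r addr0 gt_eqF //.
        by rewrite subr_gt0 xr_lt.
      have n1 : t0 != 1.
        apply: contra_eq_neq h => t1; rewrite dE /= t1 subrr mul0r mul1r add0r.
        rewrite subr_eq0; apply: contraTneq ij => e.
        by rewrite (perm_inj (base_inj (congr1 (fun z => (z, 0)) e))) ltnn.
      apply: mulr_gt0; first by rewrite lt_neqAle eq_sym n0.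
      by rewrite subr_gt0 lt_neqAle n1.
    have : \forall t \near t0, 0 < (dC t i j).2 by apply: near_gt0.
    apply: filterS => t ht _; rewrite half_turn_im // /N.
    by case: (lexpos _); case: (lexpos _).
have [e /= e0 eP] := (nbhs_ballP _ _).1 (filterI near_box near_pair).
exists e => // t tt te.
have [bx pr] : (forall i, within_box r (C t0 i) (C t i)) /\ (forall q : 'I_n * 'I_n, (q.1 < q.2)%N ->
    half_turn (dC t0 q.1 q.2) (dC t q.1 q.2) = N t q.1 q.2 - N t0 q.1 q.2).
  by apply: eP; rewrite /ball /= distrC.
rewrite (@crossings_labelled R n _ _ (C t0) (C t) (xi t0) (xi t)).
- rewrite /F; congr (_, _); first by rewrite /= mulKVg.
  apply/ffunP => q; rewrite !ffunE /= !permK.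
  case: q => i j /=; have [ij|ij|/val_inj ij] := ltngtP i j.
  + by have := pr (i, j) ij; rewrite /dC /= => ->; rewrite addrC subrK.
  + have ij' : j != i by rewrite -(inj_eq val_inj) ltn_eqF.
    rewrite -(opprB (C t0 i)) -(opprB (C t i)) half_turnN.
    * by have := pr (j, i) ij; rewrite /dC /= => ->; rewrite addrC subrK.
    * rewrite subr_eq0; apply: contraNneq ij'.
      by have [_ inj] := confs_valid (pCt t0) => /inj ->.
    * rewrite subr_eq0; apply: contraNneq ij'.
      by have [_ inj] := confs_valid (pCt t) => /inj ->.
  + by rewrite ij !subrr /half_turn eqxx addr0.
- by move=> i; rewrite xiE.
- by move=> i; rewrite xiE.
- move=> i j ji.
  have := @nearest_ball _ _ _ _ (lexc (p (clamp t0))) (C t \o (xi t0)^-1%g) r0 hs _ _ (xi t0 i) (xi t0 j).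
  rewrite /= !permK (inj_eq perm_inj); have := congr1 (@^~ i) (xiE t0) => /= <-; apply => // k.
    by rewrite /within_box !subrr normr0.
  by have := bx ((xi t0)^-1%g k); have := congr1 (@^~ ((xi t0)^-1%g k)) (xiE t0); rewrite /= permKV => ->.
Unshelve. all: by end_near.
Qed.

End SwingCrossings.

(** * Braid data *)

Section BraidData.
Local Open Scope group_scope.

(** What is used of the braid group of the disk on [n] strings. [bpi] is the
    permutation of the end points: the strand starting at the i-th base point
    ends at the one of index [bpi g i]. [blk g i j] is the signed number of
    crossings of the strands starting at [i] and [j]; it is a crossed
    homomorphism, and on pure braids it is twice the linking number. [bet w]
    is the positive braid in which each pair of strands crosses once if [w]
    inverts it and never otherwise; these braids generate, and they multiply
    as permutations when no pair crosses twice. Permutations compose from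
    left to right. *)
Record braid_data (n : nat) (G : groupType) := BraidData {
  bpi : G -> 'S_n;
  blk : G -> 'I_n -> 'I_n -> int;
  bet : 'S_n -> G;
  bpiM : forall x y, bpi (x * y) = bpi x * bpi y;
  blkM : forall x y i j, blk (x * y) i j = (blk x i j + blk y (bpi x i) (bpi x j))%R;
  bpi_bet : forall w, bpi (bet w) = w;
  blk_bet : forall w (i j : 'I_n), blk (bet w) i j =
    (((i < j) && (w j < w i) || (j < i) && (w i < w j))%N : nat)%:Z;
  betM : forall u v : 'S_n, (forall i j : 'I_n, (i < j)%N -> (u j < u i)%N -> (v (u j) < v (u i))%N) ->
    bet u * bet v = bet (u * v);
  bet_gen : forall S : G -> Prop, S 1 -> (forall x w, S x -> S (x * bet w)) ->
    (forall x w, S x -> S (x * (bet w)^-1)) -> forall x, S x }.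

End BraidData.

Section Interface.
Variables (R : realType) (n : nat).
Local Notation UC := (unordered_conf n (disk R)).
Local Notation I := (unit_itv R).
Local Notation b0 := (b0 R n).
Local Notation A := (crossing_group n).

(** The permutation and the crossing numbers of a braid. *)
Definition mono (g : braid_group b0) : A := monodromy (@crossings_loc R n) (pi1_repr g).

Lemma mono_class (p : {path I from b0 to b0}) :
  mono (pi1_class p) = monodromy (@crossings_loc R n) p.
Proof. by apply: monodromy_homotopic; apply/pi1_classP; rewrite pi1_reprK. Qed.

Lemma monoM (g h : braid_group b0) : mono (g * h)%g = (mono g * mono h)%g.
Proof.
rewrite /mono -monodromy_concat; apply: monodromy_homotopic; apply/pi1_classP.
by rewrite pi1_reprK.
Qed.

Definition braid_data_b0 : braid_data n (braid_group b0).
Proof.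
refine (@BraidData n (braid_group b0) (fun g => (mono g).1) (fun g i j => (mono g).2 (i, j)) (@perm_braid R n) _ _ _ _ _ _).
- by move=> x y; rewrite monoM.
- by move=> x y i j; rewrite monoM ffunE.
- by move=> w; rewrite /perm_braid mono_class crossings_swing.
- by move=> w i j; rewrite /perm_braid mono_class crossings_swing ffunE.
- exact: perm_braidM.
- exact: braid_gen.
Defined.

Variable b : UC.
Local Notation L := (lexp b).

(** The isomorphism from the braid group at [b] to the one at the base
    configuration given by the path [lexp b]. Its inverse is [unbase]. *)
Definition rebase (g : braid_group b) : braid_group b0 := base_loop (pi1_repr g).

Lemma rebase_class (p : {path I from b to b}) : rebase (pi1_class p) = base_loop p.
Proof. by apply: base_loop_homotopic; apply/pi1_classP; rewrite pi1_reprK. Qed.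

Lemma rebaseM (g h : braid_group b) : rebase (g * h)%g = (rebase g * rebase h)%g.
Proof.
by rewrite /rebase -base_loop_concat; apply: base_loop_homotopic; apply/pi1_classP; rewrite pi1_reprK.
Qed.

Definition unbase (g : braid_group b0) : braid_group b :=
  pi1_class (concat L (concat (pi1_repr g) (reverse L))).

Lemma base_loop_lexp : base_loop L = 1%g.
Proof.
apply/pi1_classP.
apply: homotopic_trans (concatA_homotopic _ _ _) _.
apply: homotopic_trans (concat_homotopic (concatVp_homotopic L) (homotopic_refl _)) _.
apply: homotopic_trans (concat1_homotopic _) _.
exact: lexp_b0.
Qed.

Lemma unbaseK g : rebase (unbase g) = g.
Proof.
rewrite rebase_class !base_loop_concat base_loop_reverse base_loop_lexp mul1g invg1 mulg1 base_loop_loop.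
exact: pi1_reprK.
Qed.

Lemma rebase_inj : injective rebase.
Proof.
suff h g : rebase g = 1%g -> g = 1%g.
  move=> g h' e; apply: (mulgI g^-1%g); rewrite mulVg; apply/esym/h.
  by apply: (mulgI (rebase g)); rewrite -rebaseM mulKVg e mulg1.
move=> e; rewrite -(pi1_reprK g); apply/pi1_classP.
move: e; rewrite /rebase; move: (pi1_repr g) => q /pi1_classP h.
have h2 := concat_homotopic (homotopic_refl L) (concat_homotopic h (homotopic_refl (reverse L))).
have h3 : homotopic (concat L (concat (const_path R b0) (reverse L))) (const_path R b).
  apply: homotopic_trans (concatpV_homotopic L).
  by apply: concat_homotopic; [exact: homotopic_refl|exact: concat1_homotopic].
apply: homotopic_trans (homotopic_trans _ h2) h3.
apply: homotopic_sym.
apply: homotopic_trans (concatA_homotopic _ _ _) _.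
apply: homotopic_trans (concat_homotopic (concatA_homotopic _ _ _) (homotopic_refl _)) _.
apply: homotopic_trans (concat_homotopic (concat_homotopic (concatpV_homotopic L) (homotopic_refl _)) (homotopic_refl _)) _.
apply: homotopic_trans (concat_homotopic (concat1_homotopic _) (homotopic_refl _)) _.
apply: homotopic_trans (homotopic_sym (concatA_homotopic _ _ _)) _.
apply: homotopic_trans (concat_homotopic (homotopic_refl _) (concatpV_homotopic L)) _.
exact: concatp1_homotopic.
Qed.

Definition braid_data_disk : braid_data n (braid_group b).
Proof.
have D := braid_data_b0.
refine (@BraidData n (braid_group b) (bpi D \o rebase) (fun g => blk D (rebase g)) (unbase \o bet D) _ _ _ _ _ _).
- by move=> x y; rewrite /= rebaseM bpiM.
- by move=> x y i j; rewrite /= rebaseM blkM.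
- by move=> w; rewrite /= unbaseK bpi_bet.
- by move=> w i j; rewrite /= unbaseK blk_bet.
- move=> u v h; apply: rebase_inj; rewrite rebaseM /= !unbaseK; exact: betM.
- move=> S S1 SM SV x.
  suff : forall y, S (unbase y) by move=> /(_ (rebase x)); rewrite (rebase_inj (unbaseK (rebase x))).
  apply: (bet_gen (b := D)).
  + suff -> : unbase 1%g = 1%g by [].
    apply: rebase_inj; rewrite unbaseK; apply: (mulgI (rebase 1%g)).
    by rewrite -rebaseM !mulg1.
  + move=> y w Sy; suff -> : unbase (y * bet D w)%g = (unbase y * unbase (bet D w))%g by apply: SM.
    by apply: rebase_inj; rewrite rebaseM !unbaseK.
  + move=> y w Sy; suff -> : unbase (y * (bet D w)^-1)%g = (unbase y * (unbase (bet D w))^-1)%g by apply: SV.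
    apply: rebase_inj; rewrite unbaseK; apply: (mulIg (bet D w)); rewrite mulgVK.
    by rewrite -{2}(unbaseK (bet D w)) -rebaseM mulgVK unbaseK.
Qed.

End Interface.

Local Close Scope classical_set_scope.
Local Close Scope quotient_scope.
Local Open Scope group_scope.

(** * Formal consequences of braid data *)

Lemma mulg_hom1 (G H : groupType) (f : G -> H) :
  (forall x y, f (x * y) = f x * f y) -> f 1 = 1.
Proof. by move=> fM; apply: (mulgI (f 1)); rewrite -fM !mulg1. Qed.

Lemma mulg_homV (G H : groupType) (f : G -> H) :
  (forall x y, f (x * y) = f x * f y) -> forall x, f x^-1 = (f x)^-1.
Proof.
by move=> fM x; apply: (mulgI (f x)); rewrite -fM !mulgV (mulg_hom1 fM).
Qed.

Section Basics.
Variables (n : nat) (G : groupType) (D : braid_data n G).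
Local Notation pi := (bpi D).
Local Notation lk := (blk D).
Local Notation be := (bet D).
Implicit Types (x y g p : G) (u v w : 'S_n).

Lemma bpi1 : pi 1 = 1.
Proof. exact: mulg_hom1 (bpiM D). Qed.

Lemma bpiV x : pi x^-1 = (pi x)^-1.
Proof. exact: mulg_homV (bpiM D) x. Qed.

Lemma blk1 i j : lk 1 i j = 0.
Proof.
have := blkM D 1 1 i j; rewrite mulg1 bpi1 !perm1 => /eqP.
by rewrite -subr_eq0 opprD addrA subrr sub0r oppr_eq0 => /eqP.
Qed.

Lemma blkV x i j : lk x^-1 (pi x i) (pi x j) = (- lk x i j)%R.
Proof. by apply/eqP; rewrite -addr_eq0 addrC -blkM mulgV blk1. Qed.

Lemma blk_conj g p i j : pi p = 1 -> lk (g * p * g^-1) i j = lk p (pi g i) (pi g j).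
Proof.
by move=> p1; rewrite !blkM bpiM p1 mulg1 blkV addrAC subrr add0r.
Qed.

Lemma blk_pure p q i j : pi p = 1 -> lk (p * q) i j = (lk p i j + lk q i j)%R.
Proof. by move=> p1; rewrite blkM p1 !perm1. Qed.

Lemma bpi_conj g p : pi p = 1 -> pi (g * p * g^-1) = 1.
Proof. by move=> p1; rewrite !bpiM p1 mulg1 bpiV mulgV. Qed.

Lemma bet1 : be 1 = 1.
Proof.
apply: (mulgI (be 1)); rewrite betM ?mulg1 // => i j; rewrite !perm1 => ij.
by rewrite ltnNge ltnW.
Qed.

Lemma blkV_bet w i j : lk (be w)^-1 i j = (- lk (be w) (w^-1%g i) (w^-1%g j))%R.
Proof. by have := blkV (be w) (w^-1 i) (w^-1 j); rewrite bpi_bet !permKV. Qed.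

Lemma blk_sym x i j : lk x i j = lk x j i.
Proof.
move: x i j; apply: (bet_gen (b := D)).
- by move=> i j; rewrite !blk1.
- by move=> x w h i j; rewrite !blkM h !blk_bet orbC.
- by move=> x w h i j; rewrite !blkM h !blkV_bet !blk_bet orbC.
Qed.

Lemma blk_diag x i : lk x i i = 0.
Proof.
move: x i; apply: (bet_gen (b := D)).
- by move=> i; rewrite !blk1.
- by move=> x w h i; rewrite !blkM h !blk_bet ltnn.
- by move=> x w h i; rewrite !blkM h !blkV_bet !blk_bet ltnn.
Qed.

Lemma adj_inv (a b i j : 'I_n) : b = a.+1 :> nat -> (i < j)%N ->
  (tperm a b j < tperm a b i)%N -> i = a /\ j = b.
Proof.
have neq (k l : 'I_n) : k <> l -> (k : nat) <> l by move=> kl /val_inj.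
move=> ba; case: (tpermP a b j) => [->|->|/neq ja /neq jb];
  case: (tpermP a b i) => [->|->|/neq ia /neq ib] //; rewrite ?ltnn //; lia.
Qed.

(** An adjacent transposition is absorbed by [w] on the left when it
    increases the number of inversions. *)
Lemma bet_adjL (a b : 'I_n) w : b = a.+1 :> nat -> (w a < w b)%N ->
  be (tperm a b) * be w = be (tperm a b * w).
Proof.
move=> ba wab; apply: betM => i j ij /(adj_inv ba ij)[-> ->].
by rewrite tpermL tpermR.
Qed.

Lemma bet_adjR (a b : 'I_n) w : b = a.+1 :> nat -> (w^-1 a < w^-1 b)%N ->
  be w * be (tperm a b) = be (w * tperm a b).
Proof.
move=> ba wab; apply: betM => i j ij wij; apply/negPn/negP; rewrite -leqNgt leq_eqVlt.
case/orP => [/eqP/val_inj/perm_inj ji|].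
  by move: wij; rewrite ji ltnn.
move=> /(adj_inv ba wij)[ja ib]; move: wab; rewrite -ja -ib !permK.
by rewrite ltnNge ltnW.
Qed.

End Basics.

Lemma adjacent_increasing n (w : 'S_n) :
  (forall a b : 'I_n, b = a.+1 :> nat -> (w a < w b)%N) ->
  forall i j : 'I_n, (i < j)%N -> (w i < w j)%N.
Proof.
move=> h i j; have [k] := ubnP (j - i); elim: k i j => // k IH i j jik ij.
have in_ : (i.+1 < n)%N by apply: leq_ltn_trans ij (ltn_ord j).
have h1 := h i (Ordinal in_) erefl.
have [e|ne] := eqVneq i.+1 (j : nat).
  by have -> : j = Ordinal in_ by apply: val_inj.
apply: ltn_trans h1 (IH _ _ _ _) => /=; lia.
Qed.

(** A measure that increases when an adjacent inversion is removed; it serves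
    to prove statements on permutations by sorting. *)
Definition perm_weight n (w : 'S_n) : nat := (\sum_(i < n) i * w i)%N.

Lemma perm_weight_adj n (w : 'S_n) (a b : 'I_n) : b = a.+1 :> nat -> (w b < w a)%N ->
  (perm_weight w < perm_weight (tperm a b * w)%g)%N.
Proof.
move=> ba wba; rewrite /perm_weight.
have ab : a != b by apply: contraTneq wba => ->; rewrite ltnn.
have split (u : 'S_n) : (\sum_(i < n) i * u i)%N =
    (a * u a + (b * u b + \sum_(i < n | (i != a) && (i != b)) i * u i))%N.
  by rewrite (bigD1 a) //= (bigD1 b) 1?eq_sym.
rewrite !split !permM tpermL tpermR.
have -> : (\sum_(i < n | (i != a) && (i != b)) i * (tperm a b * w)%g i)%N =
    (\sum_(i < n | (i != a) && (i != b)) i * w i)%N.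
  by apply: eq_bigr => i /andP[ia ib]; rewrite permM tpermD // eq_sym.
by rewrite !addnA ltn_add2r ba; nia.
Qed.

Lemma perm_weight_bound n (w : 'S_n) : (perm_weight w <= n * (n * n))%N.
Proof.
apply: (@leq_trans (\sum_(i < n) n * n)%N); last by rewrite sum_nat_const card_ord.
by apply: leq_sum => i _; apply: leq_mul; exact: ltnW.
Qed.

(** * The pure subgroup *)

Section Pure.
Variables (m : nat) (G : groupType).
Local Notation n := m.+2.
Variable D : braid_data n G.
Local Notation pi := (bpi D).
Local Notation lk := (blk D).
Local Notation be := (bet D).
Implicit Types (x y g p : G) (u v w z : 'S_n).

Definition o0 : 'I_n := ord0.
Definition o1 : 'I_n := lift ord0 ord0.
Definition s01 : 'S_n := tperm o0 o1.
(** The crossing of the first two strands. Its square generates the pure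
    subgroup as a normal subgroup. *)
Definition sg : G := be s01.

Lemma o1E : o1 = o0.+1 :> nat. Proof. by []. Qed.
Lemma o01 : o0 != o1. Proof. by []. Qed.

Lemma bpi_sg2 : pi (sg * sg) = 1.
Proof. by rewrite bpiM !bpi_bet tperm2. Qed.

(** All adjacent crossings are conjugate to the first one. *)
Lemma bet_conj_sg (a b : 'I_n) z : b = a.+1 :> nat -> z a = o0 -> z b = o1 ->
  be (tperm a b) = be z * sg * (be z)^-1.
Proof.
move=> ba za zb; rewrite /sg (bet_adjR D (w := z) o1E); last first.
  by rewrite -za -zb !permK ba.
have -> : z * s01 = tperm a b * z.
  apply/permP => i; rewrite !permM; case: (tpermP a b i) => [->|->|ia ib].
  - by rewrite za zb tpermL.
  - by rewrite za zb tpermR.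
  - rewrite tpermD //; apply/eqP.
      by rewrite -za => /perm_inj/esym.
    by rewrite -zb => /perm_inj/esym.
by rewrite -bet_adjL ?mulgK // za zb.
Qed.

Lemma sg_commute z : z o0 = o0 -> z o1 = o1 -> be z * sg = sg * be z.
Proof.
by move=> z0 z1; have := bet_conj_sg o1E z0 z1; rewrite -/sg => {2}->; rewrite mulgVK.
Qed.

(** A permutation sending [i] to 0 and [j] to 1 (for distinct [i] and [j]). *)
Definition to01 (i j : 'I_n) : 'S_n := tperm i o0 * tperm (tperm i o0 j) o1.

Lemma to01l i j : i != j -> to01 i j i = o0.
Proof.
move=> ij; have h : tperm i o0 j != tperm i o0 i by rewrite (inj_eq perm_inj) eq_sym.
by rewrite tpermL in h; rewrite permM tpermL [LHS]tpermD.
Qed.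

Lemma to01r i j : i != j -> to01 i j j = o1.
Proof. by move=> ij; rewrite permM tpermL. Qed.

Lemma to01Vl i j : i != j -> (to01 i j)^-1 o0 = i.
Proof. by move=> ij; rewrite -[in LHS](to01l ij) permK. Qed.

Lemma to01Vr i j : i != j -> (to01 i j)^-1 o1 = j.
Proof. by move=> ij; rewrite -[in LHS](to01r ij) permK. Qed.

(** The pure subgroup is the normal closure of [sg * sg]. Modulo this normal
    closure [w |-> bet w] is multiplicative, as seen by induction on the
    first factor, because the adjacent crossings become involutions; hence
    every [g] is congruent to [bet (bpi g)]. *)
Lemma pure_ind (S : G -> Prop) : S 1 -> (forall x y, S x -> S y -> S (x * y)) ->
  (forall x, S x -> S x^-1) -> (forall g x, S x -> S (g * x * g^-1)) ->
  S (sg * sg) -> forall p, pi p = 1 -> S p.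
Proof.
move=> S1 SM SV SJ Ssg.
have Sadj (a b : 'I_n) : b = a.+1 :> nat -> S (be (tperm a b) * be (tperm a b)).
  move=> ba; have ab : a != b by rewrite -(inj_eq val_inj) /= ba neq_ltn ltnSn.
  rewrite (bet_conj_sg ba (to01l ab) (to01r ab)).
  by rewrite !mulgA mulgVK -(mulgA (be _) sg); exact: SJ.
have Sadj2 (a b : 'I_n) u : b = a.+1 :> nat ->
    S (be (tperm a b) * be u * (be (tperm a b * u))^-1).
  move=> ba; case: (ltngtP (u a) (u b)) => [uab|uba|/val_inj/perm_inj ab].
  - by rewrite bet_adjL // mulgV.
  - have -> : be u = be (tperm a b) * be (tperm a b * u).
      rewrite bet_adjL // ?permM ?tpermL ?tpermR //.
      by rewrite mulgA tperm2 mul1g.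
    by rewrite mulgA mulgK; exact: Sadj.
  - by move: ba; rewrite ab => /esym/eqP; rewrite gtn_eqF.
have SC u : forall v, S (be u * be v * (be (u * v))^-1).
  have [k] := ubnP (n * (n * n) - perm_weight u); elim: k u => // k IH u uk v.
  have [[a b] /= /andP[/eqP ba uba]|nd] :=
      pickP (fun q : 'I_n * 'I_n => (nat_of_ord q.2 == q.1.+1) && (u q.2 < u q.1)%N).
    pose u' := tperm a b * u.
    have uE : u = tperm a b * u' by rewrite /u' mulgA tperm2 mul1g.
    have beu : be u = be (tperm a b) * be u'.
      by rewrite bet_adjL // ?permM ?tpermL ?tpermR // -uE.
    have Su' : S (be u' * be v * (be (u' * v))^-1).
      apply: IH; have := perm_weight_adj ba uba; rewrite -/u'.
      have := perm_weight_bound u'; lia.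
    have := SM _ _ (SJ (be (tperm a b)) _ Su') (Sadj2 a b (u' * v) ba).
    by rewrite beu uE !mulgA !mulgVK.
  have -> : u = 1.
    apply: perm_mono1; apply: adjacent_increasing => a b ba.
    have := nd (a, b); rewrite /= ba eqxx /= => /negbT; rewrite -leqNgt leq_eqVlt.
    case/orP => // /eqP/val_inj/perm_inj ab.
    by move: ba; rewrite ab => /esym/eqP; rewrite gtn_eqF.
  by rewrite bet1 !mul1g mulgV.
suff h g : S (g * (be (pi g))^-1).
  by move=> p p1; have := h p; rewrite p1 bet1 invg1 mulg1.
apply: (bet_gen (b := D) (S := fun g => S (g * (be (pi g))^-1))) => {g}.
- by rewrite bpi1 bet1 mulgV.
- move=> g w Sg; rewrite bpiM bpi_bet.
  have := SM _ _ Sg (SC (pi g) w); by rewrite !mulgA mulgVK.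
- move=> g w Sg; rewrite bpiM bpiV bpi_bet.
  have := SM _ _ Sg (SV _ (SC (pi g * w^-1) w)); rewrite mulgVK !invgM invgK !mulgA.
  by rewrite mulgVK.
Qed.

(** The full twist of the strands [i] and [j], a conjugate of [sg * sg]. Up
    to conjugation by pure elements it depends only on [i] and [j]. *)
Definition gen (i j : 'I_n) : G := be (to01 i j) * (sg * sg) * (be (to01 i j))^-1.

Lemma pi_gen i j : pi (gen i j) = 1.
Proof. by apply: bpi_conj; exact: bpi_sg2. Qed.

Lemma blk_sg (i j : 'I_n) : lk sg i j = ((i == o0) && (j == o1) || (i == o1) && (j == o0) : nat)%:Z.
Proof.
rewrite /sg blk_bet; congr (nat_of_bool _)%:Z.
have ltE (a b : 'I_n) : (a < b)%N && (s01 b < s01 a)%N = (a == o0) && (b == o1).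
  apply/idP/andP => [/andP[ab /(adj_inv o1E ab)[-> ->]]|[/eqP-> /eqP->]] //.
  by rewrite tpermL tpermR.
by rewrite !ltE [in X in _ || X]andbC.
Qed.

Lemma blk_sg2 i j : lk (sg * sg) i j =
  ((if (i == o0) && (j == o1) || (i == o1) && (j == o0) then 2 else 0)%N)%:Z.
Proof.
rewrite blkM !blk_sg bpi_bet.
have s0 (k : 'I_n) : (s01 k == o0) = (k == o1) by rewrite -[X in _ == X](tpermR o0 o1) (inj_eq perm_inj).
have s1 (k : 'I_n) : (s01 k == o1) = (k == o0) by rewrite -[X in _ == X](tpermL o0 o1) (inj_eq perm_inj).
by rewrite !s0 !s1 orbC; case: (_ || _).
Qed.

Lemma blk_gen (i j k l : 'I_n) : i != j -> lk (gen i j) k l =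
  ((if (k == i) && (l == j) || (k == j) && (l == i) then 2 else 0)%N)%:Z.
Proof.
move=> ij; rewrite blk_conj ?bpi_sg2 // bpi_bet blk_sg2.
by rewrite -(to01l ij) -(to01r ij) !(inj_eq perm_inj).
Qed.

(** Homomorphisms from the pure subgroup to the integers, as functions on the
    whole group with arbitrary values elsewhere. *)
Definition pure_hom (h : G -> int) :=
  forall p q, pi p = 1 -> pi q = 1 -> h (p * q) = (h p + h q)%R.

Section Hom.
Variable h : G -> int.
Hypothesis hM : pure_hom h.

Lemma pure_hom1 : h 1 = 0.
Proof.
have := hM (bpi1 D) (bpi1 D); rewrite mulg1 => /eqP.
by rewrite -subr_eq0 opprD addrA subrr sub0r oppr_eq0 => /eqP.
Qed.

Lemma pure_homV p : pi p = 1 -> h p^-1 = (- h p)%R.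
Proof.
move=> p1; apply/eqP; rewrite -addr_eq0 -hM // ?mulVg ?pure_hom1 //.
by rewrite bpiV p1 invg1.
Qed.

Lemma pure_homJ p q : pi p = 1 -> pi q = 1 -> h (p * q * p^-1) = h q.
Proof.
move=> p1 q1; have pV : pi p^-1 = 1 by rewrite bpiV p1 invg1.
rewrite !hM ?bpiM ?p1 ?q1 ?mulg1 // pure_homV //.
by rewrite addrAC subrr add0r.
Qed.

Lemma pure_homX p k : pi p = 1 -> h (p ^+ k) = (h p * k%:Z)%R.
Proof.
move=> p1; have pX l : pi (p ^+ l) = 1.
  by elim: l => [|l IH]; rewrite ?expg0 ?bpi1 // expgS bpiM p1 IH mulg1.
elim: k => [|k IH]; first by rewrite expg0 pure_hom1 mulr0.
by rewrite expgS hM // IH intS mulrDr mulr1.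
Qed.

Lemma pure_hom_class g g' : pi g = pi g' -> h (g * (sg * sg) * g^-1) = h (g' * (sg * sg) * g'^-1).
Proof.
move=> gg; have p1 : pi (g' * g^-1) = 1 by rewrite bpiM bpiV gg mulgV.
have c1 := bpi_conj g bpi_sg2.
rewrite -(pure_homJ p1 c1); congr h; rewrite invgM invgK !mulgA.
by rewrite !mulgVK.
Qed.

(** The conjugates of [sg * sg] are the full twists, up to pure conjugation. *)
Lemma pure_hom_conj g : h (g * (sg * sg) * g^-1) = h (gen ((pi g)^-1 o0) ((pi g)^-1 o1)).
Proof.
set i := (pi g)^-1 o0; set j := (pi g)^-1 o1.
have ij : i != j by rewrite (inj_eq perm_inj).
pose z := (pi g)^-1 * to01 i j.
have z0 : z o0 = o0 by rewrite permM to01l.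
have z1 : z o1 = o1 by rewrite permM to01r.
rewrite /gen (@pure_hom_class (be (to01 i j)) (g * be z)); last first.
  by rewrite bpiM !bpi_bet /z mulgA mulgV mul1g.
congr h; rewrite invgM !mulgA; congr (_ * _).
rewrite -!mulgA; congr (_ * _).
by have zs := sg_commute z0 z1; rewrite !mulgA zs -(mulgA sg (be z)) zs mulgA mulgK.
Qed.

Lemma pure_hom_genJ g i j : i != j -> h (g * gen i j * g^-1) = h (gen ((pi g)^-1 i) ((pi g)^-1 j)).
Proof.
move=> ij; rewrite /gen -{1}[be (to01 i j)]/(be (to01 i j)).
have -> : g * (be (to01 i j) * (sg * sg) * (be (to01 i j))^-1) * g^-1 =
    (g * be (to01 i j)) * (sg * sg) * (g * be (to01 i j))^-1 by rewrite invgM !mulgA.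
rewrite pure_hom_conj bpiM bpi_bet invgM !permM.
by rewrite to01Vl // to01Vr.
Qed.

Lemma pure_hom_gen_sym i j : i != j -> h (gen i j) = h (gen j i).
Proof.
move=> ij.
pose g := be (to01 i j) * sg.
have pg : pi g = to01 i j * s01 by rewrite bpiM !bpi_bet.
have := pure_hom_conj g; rewrite pg [(to01 i j * s01)^-1]invgM /s01 tpermV !permM tpermL tpermR.
rewrite to01Vl // to01Vr // => <-.
congr h; rewrite /g /gen invgM !mulgA; congr (_ * _).
by rewrite mulgK.
Qed.

End Hom.

Lemma pure_hom_comp_conj h g : pure_hom h -> pure_hom (fun x => h (g * x * g^-1)).
Proof.
move=> hM p q p1 q1; rewrite -hM ?bpi_conj //; congr h.
by rewrite !mulgA mulgVK.
Qed.

(** The crossing numbers and the full twists are bases, dual up to a factor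
    2, of the homomorphisms on the pure subgroup and of its abelianization.
    Each unordered pair occurs twice in the sum and a full twist has two
    crossings, whence the factor 4. *)
Lemma pure_hom_expand h p : pure_hom h -> pi p = 1 ->
  (4 * h p = \sum_i \sum_(j | j != i) h (gen i j) * lk p i j)%R.
Proof.
move=> hM p1.
pose E h q : int := (\sum_i \sum_(j | j != i) h (gen i j) * lk q i j)%R.
have EM h' x y : pi x = 1 -> E h' (x * y) = (E h' x + E h' y)%R.
  move=> x1; rewrite -big_split; apply: eq_bigr => i _; rewrite -big_split.
  by apply: eq_bigr => j _; rewrite blk_pure // mulrDr.
have E1 h' : E h' 1 = 0.
  by apply: big1 => i _; apply: big1 => j _; rewrite blk1 mulr0.
suff H : pi p = 1 /\ forall h', pure_hom h' -> (4 * h' p = E h' p)%R by apply: H.2.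
apply: (pure_ind (S := fun x => pi x = 1 /\ forall h', pure_hom h' -> (4 * h' x = E h' x)%R)) p1.
- by split; [exact: bpi1|move=> h' hM'; rewrite E1 pure_hom1 // mulr0].
- move=> x y [x1 hx] [y1 hy]; split; first by rewrite bpiM x1 y1 mulg1.
  by move=> h' hM'; rewrite EM // hM' // mulrDr hx // hy.
- move=> x [x1 hx]; have xV : pi x^-1 = 1 by rewrite bpiV x1 invg1.
  split => // h' hM'; rewrite pure_homV // mulrN hx //; apply/eqP.
  by rewrite eq_sym -addr_eq0 -EM // mulVg E1.
- move=> g x [x1 hx]; split; first exact: bpi_conj.
  move=> h' hM'; have := hx _ (pure_hom_comp_conj g hM') => ->.
  rewrite /E (reindex_inj (@perm_inj _ (pi g))) /=; apply: eq_bigr => i _.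
  rewrite (reindex_inj (@perm_inj _ (pi g))) /=; apply: eq_big => j.
    by rewrite (inj_eq perm_inj).
  move=> ji; have ij : pi g i != pi g j by rewrite eq_sym.
  by rewrite pure_hom_genJ // !permK blk_conj.
- split; first exact: bpi_sg2.
  move=> h' hM'; rewrite /E (bigD1 o0) //= (bigD1 o1) //= [X in (_ = _ + X)%R](bigD1 o1) //=.
  rewrite [X in (_ = _ + (X + _))%R](bigD1 o0) //=.
  rewrite !blk_sg2 /= big1 => [|j /andP[j0 j1]]; last by rewrite blk_sg2 (negbTE j1) mulr0.
  rewrite big1 => [|j /andP[j0 j1]]; last by rewrite blk_sg2 (negbTE j1) mulr0.
  rewrite big1 => [|i /andP[i0 i1]]; last first.
    by apply: big1 => j _; rewrite blk_sg2 (negbTE i0) (negbTE i1) mulr0.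
  have <- : h' (gen o0 o1) = h' (sg * sg).
    have := pure_hom_conj hM' 1; rewrite mul1g invg1 mulg1 bpi1 invg1 !perm1 => ->.
    by [].
  rewrite -(pure_hom_gen_sym hM' o01); lia.
Qed.

End Pure.

(** * Differences of total linking numbers *)

Section Lambda.
Variables (m : nat) (G : groupType).
Local Notation n := m.+2.
Variable D : braid_data n G.
Local Notation pi := (bpi D).
Local Notation lk := (blk D).
Local Notation be := (bet D).
Implicit Types (x y g p : G) (a b i j k l : 'I_n).
Local Open Scope ring_scope.

(** The difference of the total numbers of crossings of the strands [a] and
    [b] with all strands. *)
Definition lam a b p : int := \sum_l lk p a l - \sum_l lk p b l.

Lemma lam_hom a b : pure_hom D (lam a b).
Proof.
move=> p q p1 q1; rewrite /lam.
have e c : \sum_l lk (p * q)%g c l = \sum_l lk p c l + \sum_l lk q c l.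
  by rewrite -big_split; apply: eq_bigr => l _; rewrite blk_pure.
by rewrite !e; ring.
Qed.

Lemma lam_conj a b g p : pi p = 1%g -> lam a b (g * p * g^-1)%g = lam (pi g a) (pi g b) p.
Proof.
move=> p1; rewrite /lam.
have e c : \sum_l lk (g * p * g^-1)%g c l = \sum_l lk p (pi g c) l.
  rewrite [RHS](reindex_inj (@perm_inj _ (pi g))) /=.
  by apply: eq_bigr => l _; rewrite blk_conj.
by rewrite !e.
Qed.

Lemma lam_swap a b p : lam b a p = - lam a b p.
Proof. by rewrite /lam opprB. Qed.

(** The total number of crossings of the strand [a] in a full twist. *)
Lemma tau_gen a i j : i != j -> \sum_l lk (gen D i j) a l = ((a == i)%:Z + (a == j)%:Z) * 2.
Proof.
move=> ij; rewrite (eq_bigr (fun l => ((a == i)%:Z * (l == j)%:Z + (a == j)%:Z * (l == i)%:Z) * 2)); last first.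
  move=> l _; rewrite blk_gen //.
  have [ai|ai] := eqVneq a i; have [aj|aj] := eqVneq a j => /=.
  - by move: ij; rewrite -ai -aj eqxx.
  - by case: eqP.
  - by case: eqP.
  - by rewrite !mul0r.
rewrite -big_distrl /= big_split /= -!big_distrr /=.
have e k : \sum_(l < n) (l == k)%:Z = 1.
  by rewrite (bigD1 k) //= eqxx big1 ?addr0 // => l /negbTE ->.
by rewrite !e !mulr1.
Qed.

Lemma lam_gen a b c : a != b -> c != a -> c != b -> lam a b (gen D a c) = 2.
Proof.
rewrite eq_sym => ba; rewrite eq_sym => ac; rewrite eq_sym => bc.
by rewrite /lam !(tau_gen _ ac) eqxx (negbTE ac) (negbTE ba) (negbTE bc).
Qed.

(** Up to a factor, [lam a b] is the only homomorphism on the pure subgroup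
    that the transposition of [a] and [b] changes into its opposite and that
    the disjoint transpositions fix: its values on the full twists of [i] and
    [j] vanish unless exactly one of [i] and [j] is in the pair [a], [b], and
    then they are determined by one of them. *)
Lemma lam_rigid a b c (h : G -> int) : a != b -> c != a -> c != b -> pure_hom D h ->
  (forall p, pi p = 1%g -> h (be (tperm a b) * p * (be (tperm a b))^-1)%g = - h p) ->
  (forall k l p, k != a -> k != b -> l != a -> l != b -> k != l -> pi p = 1%g ->
     h (be (tperm k l) * p * (be (tperm k l))^-1)%g = h p) ->
  exists x : int, forall p, pi p = 1%g -> 2 * h p = x * lam a b p.
Proof.
move=> ab ca cb hM hab hkl; pose H i j := h (gen D i j); pose x := H a c.
have Hsym i j : i != j -> H i j = H j i by move=> ij; exact: pure_hom_gen_sym.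
have Hab i j : i != j -> H (tperm a b i) (tperm a b j) = - H i j.
  move=> ij; rewrite -hab ?pi_gen // pure_hom_genJ // bpi_bet tpermV //.
have Hkl k l i j : k != a -> k != b -> l != a -> l != b -> k != l -> i != j ->
    H (tperm k l i) (tperm k l j) = H i j.
  move=> ka kb la lb kl ij; rewrite /H -(hkl k l (gen D i j)) ?pi_gen //.
  by rewrite pure_hom_genJ // bpi_bet tpermV.
have H0 i j : i != j -> (tperm a b i == i) && (tperm a b j == j) || (tperm a b i == j) && (tperm a b j == i) -> H i j = 0.
  move=> ij /orP[/andP[/eqP e1 /eqP e2]|/andP[/eqP e1 /eqP e2]].
    by have := Hab i j ij; rewrite e1 e2; lia.
  by have := Hab i j ij; rewrite e1 e2 -Hsym //; lia.
have Hal l : l != a -> l != b -> H a l = x.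
  move=> la lb; have [->//|lc] := eqVneq l c.
  have al : a != l by rewrite eq_sym.
  have := @Hkl l c a l la lb ca cb lc al.
  by rewrite tpermL tpermD // eq_sym.
have Hbl l : l != a -> l != b -> H b l = - x.
  move=> la lb; rewrite -(Hal l) // -Hab 1?eq_sym //.
  by rewrite tpermL tpermD // eq_sym.
pose chi i : int := (i == a)%:Z - (i == b)%:Z.
have ba : b != a by rewrite eq_sym.
have chia : chi a = 1 by rewrite /chi eqxx (negbTE ab).
have chib : chi b = -1 by rewrite /chi eqxx (negbTE ba).
have chi0 i : i != a -> i != b -> chi i = 0 by rewrite /chi => /negbTE -> /negbTE ->.
have Hab0 : H a b = 0 by rewrite H0 // tpermL tpermR !eqxx orbT.
have HE i j : i != j -> H i j = x * (chi i + chi j).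
  move=> ij; have ji : j != i by rewrite eq_sym.
  have [ia|ia] := eqVneq i a.
    rewrite ia in ij ji *; have [->|jb] := eqVneq j b.
      by rewrite Hab0 chia chib subrr mulr0.
    by rewrite Hal // chia chi0 // addr0 mulr1.
  have [ib|ib] := eqVneq i b.
    rewrite ib in ij ji *; have [->|ja] := eqVneq j a.
      by rewrite Hsym // Hab0 chia chib addNr mulr0.
    by rewrite Hbl // chib chi0 // addr0 mulrN1.
  rewrite (chi0 i) // add0r Hsym //.
  have [->|ja] := eqVneq j a; first by rewrite Hal // chia mulr1.
  have [->|jb] := eqVneq j b; first by rewrite Hbl // chib mulrN1.
  by rewrite chi0 // mulr0 H0 // !tpermD ?eqxx //= eq_sym.
exists x => p p1.
suff : 4 * h p = 2 * (x * lam a b p) by lia.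
rewrite (pure_hom_expand hM p1).
have -> : \sum_i \sum_(j | j != i) h (gen D i j) * lk p i j =
    \sum_i \sum_j x * (chi i + chi j) * lk p i j.
  apply: eq_bigr => i _; rewrite [RHS](bigD1 i) //= blk_diag mulr0 add0r.
  by apply: eq_bigr => j ji; rewrite -/(H i j) HE // eq_sym.
have chiS (F : 'I_n -> int) : \sum_i chi i * F i = F a - F b.
  rewrite (bigD1 a) //= (bigD1 b) //= chia chib.
  by rewrite big1 => [|i /andP[ia ib]]; [ring|rewrite chi0 ?mul0r].
have e1 : \sum_i \sum_j x * chi i * lk p i j = x * lam a b p.
  rewrite /lam -(chiS (fun i => \sum_l lk p i l)) big_distrr; apply: eq_bigr => i _ /=.
  by rewrite mulrA big_distrr.
have e2 : \sum_i \sum_j x * chi j * lk p i j = x * lam a b p.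
  rewrite exchange_big -e1; apply: eq_bigr => j _; apply: eq_bigr => i _.
  by rewrite blk_sym.
have -> : 2 * (x * lam a b p) = x * lam a b p + x * lam a b p by ring.
rewrite -{1}e1 -e2 -big_split; apply: eq_bigr => i _.
by rewrite -big_split; apply: eq_bigr => j _ /=; ring.
Qed.
End Lambda.

(** * Twisted norms and infinitely many classes *)

Section Norm.
Variables (G : groupType) (phi : {multiplicative G -> G}).

(** The product x * phi x * ... * phi^(k-1) x. Passing to the twisted class
    by [g] changes it into [g * _ * (phi^k g)^-1], so twisted classes of
    [phi] map to twisted classes of its k-th iterate. *)
Fixpoint twisted_norm (k : nat) (x : G) : G :=
  if k is k'.+1 then twisted_norm k' x * iter k' phi x else 1.

Lemma phi1 : phi 1 = 1.
Proof. by apply: (mulgI (phi 1)); rewrite -gmulfM !mulg1. Qed.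
Lemma phiV x : phi x^-1 = (phi x)^-1.
Proof. by apply: (mulgI (phi x)); rewrite -gmulfM !mulgV phi1. Qed.

Lemma iter_phiM k x y : iter k phi (x * y) = iter k phi x * iter k phi y.
Proof. by elim: k => //= k ->; rewrite gmulfM. Qed.
Lemma iter_phiV k x : iter k phi x^-1 = (iter k phi x)^-1.
Proof. by elim: k => //= k ->; rewrite phiV. Qed.
Lemma iter_phi1 k : iter k phi 1 = 1.
Proof. by elim: k => //= k ->; rewrite phi1. Qed.

Lemma twisted_norm_class k g x :
  twisted_norm k (g * x * phi g^-1) = g * twisted_norm k x * (iter k phi g)^-1.
Proof.
elim: k => [|k IH] /=; first by rewrite mulg1 mulgV.
rewrite IH !iter_phiM phiV iter_phiV -iterSr iterS !mulgA.
by rewrite mulgVK.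
Qed.
End Norm.

(** Finitely many classes are impossible if, for infinitely many [z t], the
    norms differ from a fixed element [y0] by pure elements on which an
    invariant [L] takes distinct values. Otherwise infinitely many [z t] are
    twisted conjugates of one representative, by elements [h t] that take
    only finitely many permutations; for two of them with the same
    permutation the conjugating element is pure and the values of [L] agree. *)
Lemma infinite_classes (G : groupType) (phi : {multiplicative G -> G}) (n : nat)
    (pi : G -> 'S_n) (k : nat) (y0 : G) (L : G -> int) (z : nat -> G) :
  (forall x y, pi (x * y) = pi x * pi y) ->
  (forall p, pi p = 1 -> pi (iter k phi p) = 1) ->
  (forall p q, pi p = 1 -> pi q = 1 -> L (p * q) = (L p + L q)%R) ->
  (forall p, pi p = 1 -> L (y0 * iter k phi p * y0^-1) = L p) ->
  (forall t, pi (twisted_norm phi k (z t) * y0^-1) = 1) ->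
  injective (fun t => L (twisted_norm phi k (z t) * y0^-1)) ->
  infinite_set (reidemeister_classes phi).
Proof.
move=> piM piphi LM Ly zP zinj fin.
have pi1 : pi 1 = 1 by exact: mulg_hom1 piM.
have piV x : pi x^-1 = (pi x)^-1 by exact: mulg_homV piM x.
pose cl t := reidemeister_class phi (z t).
pose rep (C : set G) : G := if pselect (C !=set0)%classic is left e then sval (cid e) else 1.
have rep_cl t : exists h, z t = h * rep (cl t) * phi h^-1.
  have : cl t (rep (cl t)).
    rewrite /rep; case: pselect => [e|[]]; first exact: svalP (cid e).
    by exists (z t), 1; rewrite invg1 phi1 mul1g mulg1.
  move=> [g gE]; exists g^-1; rewrite gE invgK !mulgA mulVg mul1g.
  by rewrite -mulgA -gmulfM mulVg phi1 mulg1.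
have [h hE] := choice rep_cl.
pose F t := (cl t, pi (h t)).
(* Among infinitely many [t], two share their class and the permutation of
   [h t]. *)
have Finj : injective F.
  move=> t s [clE pih]; apply: zinj.
  pose g := h t * (h s)^-1.
  have pg : pi g = 1 by rewrite piM piV pih mulgV.
  have zts : z t = g * z s * phi g^-1.
    rewrite (hE t) (hE s) clE /g invgM invgK gmulfM !mulgA.
    rewrite mulgVK; congr (_ * _); rewrite -[LHS]mulg1 -!mulgA; do 2 congr (_ * _).
    by rewrite -gmulfM mulVg phi1.
  have -> : twisted_norm phi k (z t) * y0^-1 =
      g * (twisted_norm phi k (z s) * y0^-1) * (y0 * iter k phi g * y0^-1)^-1.
    by rewrite zts twisted_norm_class !invgM invgK !mulgA mulgVK.
  have pyg : pi (y0 * iter k phi g * y0^-1) = 1.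
    by rewrite !piM piphi // mulg1 piV mulgV.
  have LV p : pi p = 1 -> L p^-1 = (- L p)%R.
    move=> pp; have L1 : L 1 = 0.
      have := LM 1 1 pi1 pi1; rewrite mulg1; lia.
    have := LM p p^-1 pp; rewrite mulgV L1 piV pp invg1 => /(_ erefl); lia.
  set q := twisted_norm _ _ _ * _ in zP *; set y := y0 * _ * _ in pyg *.
  have pq : pi q = 1 by exact: zP.
  have pgq : pi (g * q) = 1 by rewrite piM pg pq mulg1.
  have pyV : pi y^-1 = 1 by rewrite piV pyg invg1.
  rewrite (LM _ _ pgq pyV) (LM _ _ pg pq) (LV _ pyg) /y Ly //.
  by rewrite addrAC subrr add0r.
have finF : finite_set (reidemeister_classes phi `*` [set: 'S_n])%classic.
  by apply: finite_setX => //; exact: finite_finset.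
apply: infinite_nat.
have := @finite_preimage _ _ _ F _ finF.
suff -> : (F @^-1` (reidemeister_classes phi `*` [set: 'S_n]))%classic = [set: nat]%classic.
  by apply => s t _ _; exact: Finj.
by apply/seteqP; split => // t _; split => //; exists (z t).
Qed.

(** The situation of the previous lemma for [z t = kap ^+ t * x0], where
    [lam a b] of the norms grows linearly with [t]. *)
Lemma infinite_classes_linear (G : groupType) (phi : {multiplicative G -> G}) (n : nat)
    (pi : G -> 'S_n) (lam : 'I_n -> 'I_n -> G -> int) (k : nat) (a b : 'I_n) (x0 kap : G) :
  (forall x y, pi (x * y) = pi x * pi y) ->
  (forall i j p q, pi p = 1 -> pi q = 1 -> lam i j (p * q) = (lam i j p + lam i j q)%R) ->
  (forall i j g p, pi p = 1 -> lam i j (g * p * g^-1) = lam (pi g i) (pi g j) p) ->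
  (forall p, pi p = 1 -> pi (iter k phi p) = 1) ->
  (forall p, pi p = 1 -> lam (pi (twisted_norm phi k x0) a) (pi (twisted_norm phi k x0) b)
     (iter k phi p) = lam a b p) ->
  (forall j, (j < k)%N -> pi (iter j phi kap) = 1) ->
  (\sum_(j < k) lam (pi (twisted_norm phi j x0) a) (pi (twisted_norm phi j x0) b)
     (iter j phi kap) != 0)%R ->
  infinite_set (reidemeister_classes phi).
Proof.
move=> piM lamM lamJ piphi lam_k kapP Lam0.
have pi1 : pi 1 = 1 by exact: mulg_hom1 piM.
have piV x : pi x^-1 = (pi x)^-1 by exact: mulg_homV piM x.
have piX p t : pi p = 1 -> pi (p ^+ t) = 1.
  by move=> pp; elim: t => [|t IH]; rewrite ?expg0 // expgS piM pp IH mulg1.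
have lam1 i j : lam i j 1 = 0.
  have := lamM i j 1 1 pi1 pi1; rewrite mulg1 => /eqP.
  by rewrite -subr_eq0 opprD addrA subrr sub0r oppr_eq0 => /eqP.
have lamX i j p t : pi p = 1 -> lam i j (p ^+ t) = (lam i j p * t%:Z)%R.
  move=> pp; elim: t => [|t IH]; first by rewrite expg0 mulr0.
  by rewrite expgS lamM ?piX // IH intS mulrDr mulr1.
have iterX j t : iter j phi (kap ^+ t) = iter j phi kap ^+ t.
  by elim: t => [|t IH]; rewrite ?expg0 ?iter_phi1 // !expgS iter_phiM IH.
pose N := twisted_norm phi.
have key t j : (j <= k)%N -> pi (N j (kap ^+ t * x0) * (N j x0)^-1) = 1 /\
    lam a b (N j (kap ^+ t * x0) * (N j x0)^-1) =
    ((\sum_(i < j) lam (pi (N i x0) a) (pi (N i x0) b) (iter i phi kap)) * t%:Z)%R.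
  elim: j => [|j IH] jk; first by rewrite big_ord0 mul0r mulgV.
  have [q1 qL] := IH (ltnW jk); have kj := piX _ t (kapP j jk).
  have -> : N j.+1 (kap ^+ t * x0) * (N j.+1 x0)^-1 =
      (N j (kap ^+ t * x0) * (N j x0)^-1) * (N j x0 * iter j phi kap ^+ t * (N j x0)^-1).
    by rewrite /N /= iter_phiM iterX invgM !mulgA mulgK mulgVK.
  have c1 : pi (N j x0 * iter j phi kap ^+ t * (N j x0)^-1) = 1.
    by rewrite !piM kj mulg1 piV mulgV.
  split; first by rewrite piM q1 c1 mulg1.
  rewrite lamM // qL.
  by rewrite lamJ // lamX ?kapP // big_ord_recr mulrDl.
apply: (@infinite_classes G phi n pi k (N k x0) (lam a b) (fun t => kap ^+ t * x0)) => //.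
- by move=> p q; exact: lamM.
- move=> p p1; rewrite [LHS](lamJ a b (N k x0) (iter k phi p) (piphi _ p1)) lam_k //.
- by move=> t; exact: (key t k (leqnn k)).1.
- move=> s t /=; rewrite !(key _ k (leqnn k)).2.
  by move/(mulfI Lam0) => [].
Qed.

(** * Finite permutation groups *)

Section Perms.
Variable n : nat.
Implicit Types (u v w : 'S_n) (i j k l a b c : 'I_n).

Lemma ex_notin (s : seq 'I_n) : (size s < n)%N -> exists k, k \notin s.
Proof.
move=> sn; have [k /= ks|h] := pickP [pred k : 'I_n | k \notin s]; first by exists k.
have : (#|'I_n| <= size s)%N.
  apply: leq_trans (card_size s); apply/subset_leq_card/fintype.subsetP => k _.
  by have /= := h k; move/negbT; rewrite negbK.
by rewrite card_ord leqNgt sn.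
Qed.

(** The number of fixed points. *)
Definition fixed w := #|[pred i | w i == i]|.

Lemma fixed_tperm a b : a != b -> fixed (tperm a b) = (n - 2)%N.
Proof.
move=> ab; rewrite /fixed -[n in RHS]card_ord -(cardC (pred2 a b)) card2 ab addKn.
apply: eq_card => i; rewrite !inE; case: tpermP => [->|->|/eqP/negbTE-> /eqP/negbTE->].
- by rewrite eqxx /= eq_sym (negbTE ab).
- by rewrite eqxx orbT (negbTE ab).
- by rewrite eqxx.
Qed.

Lemma tperm_of_fixed w : (2 <= n)%N -> fixed w = (n - 2)%N ->
  exists a b, a != b /\ w = tperm a b.
Proof.
move=> n2 wf.
have c2 : #|[pred i | w i != i]| = 2.
  have := cardC [pred i | w i == i]; rewrite card_ord -/(fixed w) wf.
  rewrite (eq_card (B := [pred i | w i != i])); last by move=> i; rewrite !inE.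
  lia.
have [a wa] : exists a, w a != a.
  have /card_gt0P[a] : (0 < #|[pred i | w i != i]|)%N by rewrite c2.
  by rewrite inE => wa; exists a.
exists a, (w a); split; first by rewrite eq_sym.
have wwa : w (w a) != w a by rewrite (inj_eq perm_inj).
have wE : [pred i | w i != i] =i pred2 a (w a).
  apply/fsym/subset_cardP; first by rewrite c2 card2 eq_sym wa.
  by apply/fintype.subsetP => i; rewrite !inE => /orP[] /eqP ->.
apply/permP => i; case: tpermP => [->//|->|/eqP ia /eqP iwa].
  have := wE (w (w a)); rewrite !inE (inj_eq perm_inj) (inj_eq perm_inj) wa /= => /esym.
  by rewrite (negbTE wa) orbF => /eqP.
by have := wE i; rewrite !inE (negbTE ia) (negbTE iwa) => /negbT; rewrite negbK => /eqP.
Qed.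

Lemma tperm_disjoint a b k l : a != b -> k != l -> tperm k l != tperm a b ->
  tperm k l * tperm a b = tperm a b * tperm k l -> tperm k l a = a /\ tperm k l b = b.
Proof.
move=> ab kl ne cm.
have h : tperm a b ^ tperm k l = tperm a b by rewrite /conjg -cm mulKg.
move: h; rewrite tpermJ.
move=> e.
have := congr1 (fun s : 'S_n => s (tperm k l a)) e; rewrite /= tpermL.
case: (tpermP a b (tperm k l a)) => [ka|kb|_ _]; last first.
- by move=> /perm_inj/esym/eqP; rewrite (negbTE ab).
- move=> kab; exfalso; move: ne.
  have : tperm k l = tperm a b; last by move=> ->; rewrite eqxx.
  have [ak|ak] := eqVneq a k; first by move: kb; rewrite ak tpermL => ->.
  have [al|al] := eqVneq a l; first by move: kb; rewrite al tpermR => ->; rewrite tpermC.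
  by move: kb; rewrite tpermD 1?eq_sym // => /eqP; rewrite (negbTE ab).
- by move=> ->.
Qed.

(** A nontrivial normal subgroup contains the alternating group if [4 < n]:
    otherwise its intersection with that simple group is trivial, so it
    centralizes the alternating group. *)
Lemma normal_Alt (N : {group 'S_n}) : (4 < n)%N -> [set: 'S_n] \subset 'N(N) ->
  N :!=: 1 -> 'Alt_('I_n) \subset N.
Proof.
move=> n4 nN N1.
have simA : simple 'Alt_('I_n) by apply: simple_Alt5; rewrite card_ord.
have nNA : normal (N :&: 'Alt_('I_n)) 'Alt_('I_n).
  rewrite /normal finset.subsetIr /=; apply: normsI; last exact: normG.
  exact: fintype.subset_trans (finset.subsetT _) nN.
have [_ /(_ _ nNA)] := simpleP _ simA; case=> [NA|<-]; last exact: finset.subsetIl.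
have cNA : N \subset 'C('Alt_('I_n)).
  apply/commG1P/trivgP; rewrite -NA commg_subI // finset.subsetI subxx /=.
    exact: fintype.subset_trans (finset.subsetT _) (Alt_norm _).
  exact: fintype.subset_trans (finset.subsetT _) nN.
exfalso; move: N1; apply/negP/negPn/trivgPn => -[u uN u1].
have [i ui] : exists i, u i != i.
  have [i ui|h] := pickP [pred i | u i != i]; first by exists i.
  case/eqP: u1; apply/permP => i; rewrite perm1; apply/eqP.
  by have /= := h i; move/negbT; rewrite negbK.
have [k] : exists k, k \notin [:: i; u i] by apply: ex_notin => /=; lia.
rewrite !inE negb_or => /andP[ki kui].
have [l] : exists l, l \notin [:: i; u i; k] by apply: ex_notin => /=; lia.
rewrite !inE !negb_or => /and3P[li lui lk].
pose a := tperm (u i) k * tperm k l.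
have aA : a \in 'Alt_('I_n).
  by rewrite Alt_even odd_permM !odd_tperm eq_sym kui eq_sym lk.
have /centP/(_ _ aA) cu := fintype.subsetP cNA _ uN.
have ai : a i = i by rewrite permM tpermD // tpermD // eq_sym.
have au : a (u i) = l by rewrite permM tpermL tpermL.
have := congr1 (fun s : 'S_n => s i) cu; rewrite /= (permM u a) (permM a u) ai au => /eqP.
by rewrite (negbTE lui).
Qed.

Lemma Alt_2trans a b c d : (3 < n)%N -> a != b -> c != d ->
  exists2 w, w \in 'Alt_('I_n) & w a = c /\ w b = d.
Proof.
move=> n3 ab cd.
pose u := tperm a c * tperm (tperm a c b) d.
have ua : u a = c.
  rewrite /u permM tpermL tpermD //; last by rewrite eq_sym.
  by rewrite -{2}(tpermL a c) (inj_eq perm_inj) eq_sym.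
have ub : u b = d by rewrite /u permM tpermL.
have [uo|ue] := boolP (odd_perm u); last first.
  by exists u; rewrite ?Alt_even.
have [k] : exists k, k \notin [:: c; d] by apply: ex_notin => /=; lia.
rewrite !inE negb_or => /andP[kc kd].
have [l] : exists l, l \notin [:: c; d; k] by apply: ex_notin => /=; lia.
rewrite !inE !negb_or => /and3P[lc ld lk].
exists (u * tperm k l).
  by rewrite Alt_even odd_permM uo odd_tperm eq_sym lk.
by rewrite !(permM u (tperm k l)) ua ub !tpermD.
Qed.

Lemma Alt_nonabelian : (3 < n)%N -> exists u v : 'S_n,
  [/\ u \in 'Alt_('I_n), v \in 'Alt_('I_n) & [~ u, v] != 1].
Proof.
move=> n3; have n0 : (0 < n)%N by lia.
pose i : 'I_n := Ordinal n0.
have [j] : exists j, j \notin [:: i] by apply: ex_notin => /=; lia.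
rewrite !inE => ji.
have [k] : exists k, k \notin [:: i; j] by apply: ex_notin => /=; lia.
rewrite !inE negb_or => /andP[ki kj].
have [l] : exists l, l \notin [:: i; j; k] by apply: ex_notin => /=; lia.
rewrite !inE !negb_or => /and3P[li lj lk].
pose u := tperm i j * tperm j k; pose v := tperm j k * tperm k l.
exists u, v; split.
- by rewrite Alt_even odd_permM !odd_tperm eq_sym ji eq_sym kj.
- by rewrite Alt_even odd_permM !odd_tperm eq_sym kj eq_sym lk.
- apply/negP => /commgP/(congr1 (fun s : 'S_n => s i)).
  have ui : u i = k by rewrite permM !tpermL.
  have vi : v i = i by rewrite permM !tpermD // eq_sym.
  have vk : v k = j by rewrite permM tpermR tpermD // eq_sym.
  by rewrite /= (permM u v) (permM v u) ui vi vk ui => /eqP; rewrite eq_sym (negbTE kj).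
Qed.

End Perms.

(** * Automorphisms that preserve the pure subgroup *)

Section Transfer.
Variables (m : nat) (G : groupType).
Local Notation n := m.+2.
Variable D : braid_data n G.
Local Notation pi := (bpi D).
Local Notation lk := (blk D).
Local Notation be := (bet D).
Implicit Types (x y g p : G) (i j : 'I_n).

(** Mutually inverse automorphisms [psi] and [psi'] of [G] that induce maps
    [al] and [al'] on the permutations. *)
Record pure_aut (psi psi' : G -> G) (al al' : 'S_n -> 'S_n) : Prop := PureAut {
  psiM : forall x y, psi (x * y) = psi x * psi y;
  psiK : forall x, psi' (psi x) = x;
  pi_psi : forall x, pi (psi x) = al (pi x);
  psiM' : forall x y, psi' (x * y) = psi' x * psi' y;
  psiK' : forall x, psi (psi' x) = x;
  pi_psi' : forall x, pi (psi' x) = al' (pi x) }.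

Lemma pure_aut_sym psi psi' al al' : pure_aut psi psi' al al' -> pure_aut psi' psi al' al.
Proof. by case=> ? ? ? ? ? ?; split. Qed.

Section One.
Variables (psi psi' : G -> G) (al al' : 'S_n -> 'S_n).
Hypothesis H : pure_aut psi psi' al al'.

Lemma psi1 : psi 1 = 1.
Proof. exact: mulg_hom1 (psiM H). Qed.
Lemma psiV x : psi x^-1 = (psi x)^-1.
Proof. exact: mulg_homV (psiM H) x. Qed.
Lemma al1 : al 1 = 1.
Proof. by rewrite -(bpi1 D) -(pi_psi H) psi1. Qed.
Lemma psi_pure p : pi p = 1 -> pi (psi p) = 1.
Proof. by move=> p1; rewrite (pi_psi H) p1 al1. Qed.
Lemma alM u v : al (u * v) = al u * al v.
Proof. by rewrite -(bpi_bet D u) -(bpi_bet D v) -bpiM -!(pi_psi H) (psiM H) bpiM. Qed.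
Lemma alK u : al' (al u) = u.
Proof. by rewrite -(bpi_bet D u) -(pi_psi H) -(pi_psi' H) (psiK H). Qed.
Lemma psiJ g p : psi (g * p * g^-1) = psi g * psi p * (psi g)^-1.
Proof. by rewrite !(psiM H) psiV. Qed.

Lemma psi_hom (h : G -> int) : pure_hom D h -> pure_hom D (h \o psi).
Proof. by move=> hM p q p1 q1 /=; rewrite (psiM H) hM // psi_pure. Qed.

End One.

Lemma blk_hom i j : pure_hom D (fun x => lk x i j).
Proof. by move=> p q p1 q1; rewrite blk_pure. Qed.

Local Open Scope ring_scope.

(** Up to a factor, the trace of the conjugation by [bet w] on the
    abelianized pure subgroup, written in the dual bases of full twists and
    crossing numbers. *)
Definition perm_trace (w : 'S_n) : int :=
  \sum_i \sum_(j | j != i) lk (gen D i j) (w i) (w j).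

(** An automorphism conjugates the action of [bet w] into that of an element
    over [al w]. The identity tr (A B) = tr (B A) is the exchange of the four
    sums. *)
Lemma perm_trace_inv psi psi' al al' w : pure_aut psi psi' al al' ->
  perm_trace (al w) = perm_trace w.
Proof.
move=> H; have H' := pure_aut_sym H.
pose B i j := (psi (be w) * gen D i j * (psi (be w))^-1)%g.
have pB i j : pi (B i j) = 1%g by apply/bpi_conj/pi_gen.
have step1 i j : 4 * lk (gen D i j) (w i) (w j) =
    \sum_k \sum_(l | l != k) lk (psi' (B k l)) i j * lk (psi (gen D i j)) k l.
  have hh := psi_hom H' (blk_hom (w i) (w j)).
  have := pure_hom_expand hh (psi_pure H (pi_gen D i j)).
  rewrite /= (psiK H) => ->; apply: eq_bigr => k _; apply: eq_bigr => l lk_.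
  congr (_ * _); rewrite /B (psiJ H') (psiK H) blk_conj ?bpi_bet //.
  by rewrite (pi_psi' H) pi_gen (al1 H').
have step2 k l : \sum_i \sum_(j | j != i) lk (psi' (B k l)) i j * lk (psi (gen D i j)) k l =
    4 * lk (gen D k l) (al w k) (al w l).
  have hh := psi_hom H (blk_hom k l).
  have := pure_hom_expand hh (psi_pure H' (pB k l)).
  rewrite /= (psiK' H) => e; apply: etrans (etrans (esym e) _).
    by apply: eq_bigr => i _; apply: eq_bigr => j _; rewrite mulrC.
  by rewrite /B blk_conj ?pi_gen // (pi_psi H) bpi_bet.
apply/eqP; rewrite -(inj_eq (mulfI (_ : 4 != 0 :> int))) //; apply/eqP.
rewrite /perm_trace [RHS]big_distrr [LHS]big_distrr /=.
transitivity (\sum_k \sum_(l | l != k) \sum_i \sum_(j | j != i)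
    lk (psi' (B k l)) i j * lk (psi (gen D i j)) k l).
  apply: eq_bigr => k _; rewrite big_distrr; apply: eq_bigr => l _.
  by rewrite /= step2.
transitivity (\sum_i \sum_(j | j != i) \sum_k \sum_(l | l != k)
    lk (psi' (B k l)) i j * lk (psi (gen D i j)) k l); last first.
  apply: eq_bigr => i _; rewrite big_distrr; apply: eq_bigr => j _.
  by rewrite /= step1.
rewrite (eq_bigr (fun k => \sum_i \sum_(l | l != k) \sum_(j | j != i)
    lk (psi' (B k l)) i j * lk (psi (gen D i j)) k l)); last first.
  by move=> k _; rewrite exchange_big.
rewrite exchange_big; apply: eq_bigr => i _ /=.
rewrite (eq_bigr (fun k => \sum_(j | j != i) \sum_(l | l != k)
    lk (psi' (B k l)) i j * lk (psi (gen D i j)) k l)); last first.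
  by move=> k _; rewrite exchange_big.
by rewrite exchange_big.
Qed.

(** The trace of an involution, by counting the pairs that it preserves. *)
Lemma perm_traceE w : (w * w = 1)%g ->
  perm_trace w = 2 * ((fixed w)%:Z * (fixed w)%:Z - 2 * (fixed w)%:Z + n%:Z).
Proof.
move=> w2; have wK i : w (w i) = i by rewrite -permM w2 perm1.
pose fx i : int := (w i == i)%:Z.
have fxS : \sum_i fx i = (fixed w)%:Z.
  rewrite /fx /fixed -[RHS]natz -sum1_card natr_sum [RHS]big_mkcond /=; apply: eq_bigr => i _.
  by rewrite inE; case: eqP.
have inner i : \sum_(j | j != i) lk (gen D i j) (w i) (w j) =
    2 * (fx i * (fixed w)%:Z - 2 * fx i + 1).
  have -> : \sum_(j | j != i) lk (gen D i j) (w i) (w j) =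
      \sum_(j | j != i) 2 * (fx i * fx j + (j == w i)%:Z).
    apply: eq_bigr => j ji; rewrite blk_gen 1?eq_sym // /fx.
    have -> : (w j == i) = (j == w i) by rewrite -{1}(wK i) (inj_eq perm_inj).
    have -> : (w i == j) = (j == w i) by rewrite eq_sym.
    have [e|_] := eqVneq j (w i); last first.
      by rewrite (eq_sym i (w i)); case: (w i == i); case: (w j == j); rewrite /= ?mulr0 ?mul0r ?mulr1.
    have wij : (w i == i) = false by rewrite -e (negbTE ji).
    by rewrite orbT wij mul0r.
  rewrite -big_distrr /=; congr (2 * _); rewrite big_split /= -big_distrr /=.
  have -> : \sum_(j | j != i) fx j = (fixed w)%:Z - fx i.
    by rewrite -fxS [in RHS](bigD1 i) //= addrAC subrr add0r.
  have -> : \sum_(j | j != i) (j == w i)%:Z = 1 - fx i.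
    rewrite /fx; have [wi|wi] := eqVneq (w i) i.
      by rewrite wi subrr; apply: big1 => j /negbTE ->.
    by rewrite (bigD1 (w i)) //= eqxx big1 ?subr0 ?addr0 // => j /andP[_ /negbTE ->].
  have fx2 : fx i * fx i = fx i by rewrite /fx; case: eqP.
  by rewrite mulrBr fx2; ring.
rewrite /perm_trace (eq_bigr _ (fun i _ => inner i)) -big_distrr /=; congr (2 * _).
rewrite big_split sumrB /= -big_distrl -big_distrr /= fxS.
by rewrite sumr_const card_ord (natz n).
Qed.

End Transfer.

Section Big.
Variables (m : nat) (G : groupType).
Local Notation n := m.+2.
Variable D : braid_data n G.
Local Notation pi := (bpi D).
Implicit Types (x y g p : G) (i j a b c d k l : 'I_n).
Hypothesis n5 : (4 < n)%N.
Local Notation lam := (lam D).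

(** An automorphism that preserves the pure subgroup maps transpositions to
    transpositions. With [f] fixed points, the image is an involution with
    the same trace, so [f] is [n - 2] or [4 - n], and the second is negative.
    For [n = 6] this excludes the exotic automorphisms. *)
Lemma al_tperm psi psi' al al' a b : pure_aut D psi psi' al al' -> a != b ->
  exists c d, c != d /\ al (tperm a b) = tperm c d.
Proof.
move=> H ab; apply: tperm_of_fixed => //.
have w2 : al (tperm a b) * al (tperm a b) = 1 by rewrite -(alM H) tperm2 (al1 H).
have := perm_trace_inv (tperm a b) H; rewrite !perm_traceE ?tperm2 // fixed_tperm //.
have : (fixed (al (tperm a b)) <= n)%N by rewrite -[X in (_ <= X)%N]card_ord; exact: max_card.
move: (fixed _) => f fn e.
have : ((f%:Z - (n%:Z - 2)) * (f%:Z + n%:Z - 4) = 0)%R.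
  have n2 : ((n - 2)%N%:Z = n%:Z - 2)%R by lia.
  rewrite n2 in e; lia.
by move/eqP; rewrite mulf_eq0 => /orP[]/eqP; lia.
Qed.

(** Transpositions that commute with a given one and differ from it are
    disjoint from it, so [lam c d \o psi] satisfies the hypotheses of
    [lam_rigid]. *)
Lemma lam_transfer psi psi' al al' a b c d : pure_aut D psi psi' al al' ->
  a != b -> c != d -> al (tperm a b) = tperm c d ->
  exists x : int, forall p, pi p = 1 -> (2 * lam c d (psi p) = x * lam a b p)%R.
Proof.
move=> H ab cd alab.
have [e] : exists e, e \notin [:: a; b] by apply: ex_notin => /=; lia.
rewrite !inE negb_or => /andP[ea eb].
apply: (lam_rigid (h := lam c d \o psi) ab ea eb).
- exact: (psi_hom H (lam_hom c d)).
- move=> p p1; have pp := psi_pure H p1.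
  rewrite /= (psiJ H) lam_conj // (pi_psi H) bpi_bet alab.
  by rewrite tpermL tpermR lam_swap.
- move=> k l p ka kb la lb kl p1; have pp := psi_pure H p1.
  rewrite /= (psiJ H) lam_conj //.
  rewrite (pi_psi H) bpi_bet.
  have [c' [d' [cd' E]]] := al_tperm H kl.
  have [-> -> //] : al (tperm k l) c = c /\ al (tperm k l) d = d.
  rewrite E; apply: tperm_disjoint => //; rewrite -E -alab.
    apply/eqP => /(congr1 al'); rewrite !(alK H) => /(congr1 (fun s : 'S_n => s a)).
    by rewrite tpermL tpermD // => /eqP; rewrite (negbTE ab).
  rewrite -!(alM H); congr al; apply/permP => i; rewrite !permM.
  have ha : tperm k l a = a by rewrite tpermD.
  have hb : tperm k l b = b by rewrite tpermD.
  case: (tpermP a b i) => [->|->|ia ib]; rewrite ?ha ?hb ?tpermL ?tpermR //.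
  rewrite tpermD //; apply/eqP.
    by move=> e'; apply: ia; apply: (@perm_inj _ (tperm k l)); rewrite -e' tpermD.
  by move=> e'; apply: ib; apply: (@perm_inj _ (tperm k l)); rewrite -e' tpermD.
Qed.

(** Each strand crosses the others an even number of times in a pure braid. *)
Lemma lam_even p i j : pi p = 1 -> exists y : int, (lam i j p = y * 2)%R.
Proof.
suff : pi p = 1 -> pi p = 1 /\ forall i j, exists y : int, (lam i j p = y * 2)%R.
  by move=> h /h[_]; apply.
move: p; apply: pure_ind.
- split; first exact: bpi1.
  by move=> a b; exists 0; rewrite (pure_hom1 (lam_hom (D := D) a b)) mul0r.
- move=> x y [x1 hx] [y1 hy]; split; first by rewrite bpiM x1 y1 mulg1.
  move=> a b; have [u ue] := hx a b; have [v ve] := hy a b; exists (u + v)%R.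
  by rewrite lam_hom // ue ve mulrDl.
- move=> x [x1 hx]; split; first by rewrite bpiV x1 invg1.
  move=> a b; have [u ue] := hx a b; exists (- u)%R.
  by rewrite (pure_homV (lam_hom (D := D) a b)) // ue mulNr.
- move=> g x [x1 hx]; split; first exact: bpi_conj.
  by move=> a b; rewrite lam_conj.
- split; first exact: bpi_sg2.
  move=> a b; have -> : lam a b (sg D * sg D) = lam a b (gen D (o0 m) (o1 m)).
    have := pure_hom_conj (lam_hom (D := D) a b) 1.
    by rewrite mul1g invg1 mulg1 bpi1 invg1 !perm1.
  rewrite /lam !tau_gen //.
  by eexists; rewrite -mulrBl.
Qed.

(** The factor of [lam_transfer] is a unit, by comparison with the inverse
    automorphism; its sign is absorbed by exchanging [a] and [b]. *)
Lemma lam_image psi psi' al al' c d : pure_aut D psi psi' al al' -> c != d ->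
  exists a b, a != b /\ forall p, pi p = 1 -> lam c d (psi p) = lam a b p.
Proof.
move=> H cd; have H' := pure_aut_sym H.
have [a [b [ab E]]] := al_tperm H' cd.
have E' : al (tperm a b) = tperm c d by rewrite -E (alK H').
have [x hx] := lam_transfer H ab cd E'.
have [x' hx'] := lam_transfer H' cd ab E.
have val2 i j : i != j -> exists p, pi p = 1 /\ lam i j p = 2%:Z.
  move=> ij; have [e] : exists e, e \notin [:: i; j] by apply: ex_notin => /=; lia.
  rewrite !inE negb_or => /andP[ei ej].
  by exists (gen D i e); rewrite pi_gen lam_gen.
have even i j (y : int) ps ps' be1 be2 : pure_aut D ps ps' be1 be2 -> i != j -> forall k l,
    (forall p, pi p = 1 -> (2 * lam k l (ps p) = y * lam i j p)%R) -> exists z : int, (y = z * 2)%R.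
  move=> Hp ij k l hy; have [p [p1 pE]] := val2 i j ij.
  have [z ze] := lam_even k l (psi_pure Hp p1); exists z; have := hy p p1; rewrite ze pE; lia.
have [z xz] := even _ _ _ _ _ _ _ H ab c d hx.
have [z' xz'] := even _ _ _ _ _ _ _ H' cd a b hx'.
have zz : (z * z' = 1)%R.
  have [p [p1 pE]] := val2 c d cd.
  have p1' := psi_pure H' p1.
  have := hx _ p1'; rewrite (psiK' H) pE xz.
  have := hx' _ p1; rewrite pE xz' => e1 e2; nia.
have [z1|z1] : (z = 1 \/ z = -1)%R.
  by have /eqP := congr1 absz zz; rewrite abszM muln_eq1 => /andP[/eqP z1 _]; lia.
  exists a, b; split => // p p1; have := hx p p1; rewrite xz z1; lia.
exists b, a; split; first by rewrite eq_sym.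
by move=> p p1; have := hx p p1; rewrite xz z1 (lam_swap _ a b); lia.
Qed.
End Big.

(** * Five or more strands *)

Section Iterates.
Variables (n : nat) (G : groupType) (D : braid_data n G).
Local Notation pi := (bpi D).
Local Notation be := (bet D).
Variable phi : {multiplicative G -> G}.
Hypothesis phib : bijective phi.

(** The permutation of the image under the j-th iterate of [phi]. *)
Definition pij (j : nat) (x : G) : 'S_n := pi (iter j phi x).

Lemma pijM j x y : pij j (x * y) = pij j x * pij j y.
Proof. by rewrite /pij iter_phiM bpiM. Qed.
Lemma pijV j x : pij j x^-1 = (pij j x)^-1.
Proof. by rewrite /pij iter_phiV bpiV. Qed.
Lemma pij1 j : pij j 1 = 1.
Proof. by rewrite /pij iter_phi1 bpi1. Qed.

Lemma iter_phi_surj j y : exists x, iter j phi x = y.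
Proof.
have [f _ fK] := phib.
by elim: j y => [|j IH] y /=; [exists y|have [x xE] := IH (f y); exists x; rewrite xE fK].
Qed.

Lemma pij_surj j w : exists x, pij j x = w.
Proof.
by have [x xE] := iter_phi_surj j (be w); exists x; rewrite /pij xE bpi_bet.
Qed.

(** There are finitely many homomorphisms to the permutations, so two of the
    [pij j] coincide. *)
Lemma pij_return : exists2 k, (0 < k)%N & forall x, pij k x = pi x.
Proof.
pose F j : {ffun 'S_n -> 'S_n} := [ffun w => pij j (be w)].
have [i [j [ij Fij]]] : exists i j, (i < j)%N /\ F i = F j.
  apply: contrapT => h; apply: infinite_nat.
  have -> : [set: nat]%classic = (F @^-1` [set: {ffun 'S_n -> 'S_n}])%classic by [].
  apply: finite_preimage; last exact: finite_finset.
  move=> i j _ _ Fij; apply/eqP; apply: contrapT => /negP.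
  rewrite neq_ltn => /orP[] h'; apply: h; first by exists i, j.
  by exists j, i.
exists (j - i)%N; first by rewrite subn_gt0.
have Eij x : pij i x = pij j x.
  have Ew w : pij i (be w) = pij j (be w).
    by have := congr1 (fun f : {ffun _} => f w) Fij; rewrite !ffunE.
  apply: (bet_gen (b := D) (S := fun x => pij i x = pij j x)) => {x}.
  - by rewrite !pij1.
  - by move=> x w h; rewrite !pijM h Ew.
  - by move=> x w h; rewrite !pijM h !pijV Ew.
move=> y; have [x <-] := iter_phi_surj i y.
by rewrite /pij -iterD subnK ?(ltnW ij) // -[RHS]/(pij i x) Eij.
Qed.

(** Two surjections onto the same finite group with nested kernels have equal
    kernels. *)
Lemma ker_sub_eq (f g : G -> 'S_n) :
  (forall x y, f (x * y) = f x * f y) -> (forall x y, g (x * y) = g x * g y) ->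
  (forall w, exists x, f x = w) -> (forall w, exists x, g x = w) ->
  (forall x, f x = 1 -> g x = 1) -> forall x, g x = 1 -> f x = 1.
Proof.
move=> fM gM fs gs fg.
have f1 : f 1 = 1 by exact: mulg_hom1 fM.
have g1 : g 1 = 1 by exact: mulg_hom1 gM.
have fV x : f x^-1 = (f x)^-1 by exact: mulg_homV fM x.
have gV x : g x^-1 = (g x)^-1 by exact: mulg_homV gM x.
have [s sE] := choice fs; have [t tE] := choice gs.
have gsf x : g (s (f x)) = g x.
  have := fg (x^-1 * s (f x)); rewrite fM sE fV mulVg => /(_ erefl).
  by rewrite gM gV => e; rewrite -[LHS](mulKVg (g x)) e mulg1.
have inj : injective (fun w => f (t w)).
  by move=> u v e; rewrite -(tE u) -(tE v) -(gsf (t u)) e gsf.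
have [r _ rK] := injF_bij inj.
have key x : g x = 1 -> f (t 1) = f x.
  move=> gx1; have : g (t (r (f x))) = 1 by rewrite -gsf rK gsf.
  by rewrite tE => r1; have := rK (f x); rewrite r1.
by move=> x gx1; rewrite -(key x gx1) (key 1 g1).
Qed.
End Iterates.

Section Final5.
Variables (m : nat) (G : groupType).
Local Notation n := m.+2.
Variable D : braid_data n G.
Local Notation pi := (bpi D).
Local Notation be := (bet D).
Hypothesis n5 : (4 < n)%N.
Local Notation lam := (lam D).

(** Let k be the least positive integer such that the pure subgroup contains
    the kernel of [pij k]; the two are then equal, and the k-th iterate psi
    of phi satisfies [lam 0 1 (psi p) = lam a b p] on pure elements. By
    minimality of k, the common kernel of [pij 1], ..., [pij (k-1)] maps onto
    a group containing the alternating group ([altP]): this is proved by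
    adding one kernel at a time, the commutator of elements of two normal
    subgroups lying in both. One thus finds [x0] in this common kernel whose
    permutation sends [a], [b] to 0, 1, which makes [lam a b] invariant as
    [infinite_classes_linear] requires. *)
Lemma R_infty_ge5 : R_infty G.
Proof.
move=> phi phib; pose pj := pij D phi.
pose returns k := (0 < k)%N && `[< forall x, pj k x = 1 -> pi x = 1 >].
have [k /andP[k0 /asboolP pk] kmin] : exists2 k, returns k & forall j, returns j -> (k <= j)%N.
  have [k0 k00 k0E] := pij_return D phib.
  have ex : exists k, returns k.
    by exists k0; rewrite /returns k00; apply/asboolP => x; rewrite /pj k0E.
  by exists (ex_minn ex); case: ex_minnP.
have pk' x : pi x = 1 -> pj k x = 1.
  apply: (ker_sub_eq (pijM D phi k) (bpiM D) (pij_surj D phib k)) => // w.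
  by exists (be w); rewrite bpi_bet.
have [f fK Kf] := phib.
pose psi := iter k phi; pose psi' := iter k f.
have psiK0 x : psi' (psi x) = x.
  by rewrite /psi' /psi; elim: (k) x => //= j IH x; rewrite -iterS iterSr /= fK IH.
have psiK0' x : psi (psi' x) = x.
  by rewrite /psi' /psi; elim: (k) x => //= j IH x; rewrite -iterS iterSr /= Kf IH.
have psiM0 x y : psi (x * y) = psi x * psi y by exact: iter_phiM.
have psiM0' x y : psi' (x * y) = psi' x * psi' y.
  by rewrite -{1}(psiK0' x) -{1}(psiK0' y) -psiM0 psiK0.
have pk2 x : pi x = 1 -> pi (psi' x) = 1.
  by move=> x1; apply: pk; rewrite /pj /pij -/psi psiK0'.
have H : pure_aut D psi psi' (fun w => pi (psi (be w))) (fun w => pi (psi' (be w))).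
  have e x : pi ((be (pi x))^-1 * x) = 1 by rewrite bpiM bpiV bpi_bet mulVg.
  split => // x.
    rewrite -{1}(mulKVg (be (pi x)) x) psiM0 bpiM.
    by have := pk' _ (e x); rewrite /pj /pij -/psi => ->; rewrite mulg1.
  by rewrite -{1}(mulKVg (be (pi x)) x) psiM0' bpiM (pk2 _ (e x)) mulg1.
have [a [b [ab lamab]]] := lam_image n5 H (o01 m).
(* The common kernel of the first j maps still has all even permutations as
   images. *)
have altP j : (j < k)%N -> forall w, w \in 'Alt_('I_n) ->
    exists x, pi x = w /\ forall i, (0 < i <= j)%N -> pj i x = 1.
  elim: j => [|j IH] jk.
    by move=> w _; exists (be w); rewrite bpi_bet; split => // i; lia.
  have im_alt (P : G -> Prop) : P 1 -> (forall x y, P x -> P y -> P (x * y)) ->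
      (forall g x, P x -> P (g * x * g^-1)) ->
      (exists2 x, P x & pi x != 1) -> forall w, w \in 'Alt_('I_n) -> exists2 x, P x & pi x = w.
    move=> P1 PM PJ [x0 Px0 x01].
    pose N : {set 'S_n} := [set w | `[< exists2 x, P x & pi x = w >]].
    have NP w : reflect (exists2 x, P x & pi x = w) (w \in N) by rewrite inE; apply: asboolP.
    have gN : group_set N.
      apply/group_setP; split; first by apply/NP; exists 1; rewrite ?bpi1.
      move=> u v /NP[x Px <-] /NP[y Py <-]; apply/NP; exists (x * y); first exact: PM.
      exact: bpiM.
    have nN : [set: 'S_n] \subset 'N(Group gN).
      apply/fintype.subsetP => w _; rewrite inE; apply/fintype.subsetP => _ /imsetP[u /NP[x Px <-] ->].
      apply/NP; exists ((be w)^-1 * x * (be w)^-1^-1); first exact: PJ.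
      by rewrite invgK !bpiM bpiV bpi_bet conjgE mulgA.
    have N1 : (Group gN :!=: 1).
      apply/trivgPn; exists (pi x0) => //; apply/NP; by exists x0.
    by move=> w wA; apply/NP; exact: (fintype.subsetP (normal_Alt n5 nN N1)).
  have [x0 x01 px0] : exists2 x, pj j.+1 x = 1 & pi x != 1.
    apply: contrapT => h; have : returns j.+1.
      rewrite /returns /=; apply/asboolP => x x1; apply/eqP/negPn/negP => px; apply: h.
      by exists x.
    by move/kmin; lia.
  have A1 := im_alt (fun x => pj j.+1 x = 1) (pij1 _ _ _) _ _ _.
  have {}A1 : forall w, w \in 'Alt_('I_n) -> exists2 x, pj j.+1 x = 1 & pi x = w.
    apply: A1; last by exists x0.
      by move=> x y h1 h2; rewrite /pj pijM -/pj h1 h2 mulg1.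
    by move=> g x h1; rewrite /pj !pijM pijV -/pj h1 mulg1 mulgV.
  have A2 := IH (ltnW jk).
  have [|u [v [uA vA uv]]] := @Alt_nonabelian n; first exact: ltnW.
  have [x [xu xP]] := A2 u uA; have [y yP yv] := A1 v vA.
  move=> w wA.
  have [z zP zw] : exists2 z, (forall i, (0 < i <= j.+1)%N -> pj i z = 1) & pi z = w.
    apply: (im_alt (fun z => forall i, (0 < i <= j.+1)%N -> pj i z = 1)) wA.
    - by move=> i _; exact: pij1.
    - by move=> x' y' h1 h2 i ij; rewrite /pj pijM -/pj h1 // h2 // mulg1.
    - by move=> g x' h1 i ij; rewrite /pj !pijM pijV -/pj h1 // mulg1 mulgV.
    exists (x^-1 * (y^-1 * x * y)).
      move=> i /andP[i0]; rewrite leq_eqVlt => /orP[/eqP->|ij].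
        by rewrite /pj !pijM !pijV -/pj yP invg1 mul1g mulg1 mulVg.
      have xi : pj i x = 1 by apply: xP; rewrite i0.
      by rewrite /pj !pijM !pijV -/pj xi invg1 mul1g mulg1 mulVg.
    by rewrite !bpiM !bpiV xu yv; move: uv; rewrite commgEl conjgE !mulgA.
  by exists z.
have Apre : forall w, w \in 'Alt_('I_n) ->
    exists x, pi x = w /\ forall i, (0 < i < k)%N -> pj i x = 1.
  move=> w wA; have [|x [xw xP]] := altP k.-1 _ w wA; first by rewrite prednK.
  by exists x; split => // i ik; apply: xP; lia.
have n4 : (3 < n)%N by exact: ltnW.
have [w0 w0A [w0a w0b]] := Alt_2trans n4 ab (o01 m).
have [x0 [x0w x0P]] := Apre w0 w0A.
have ba : b != a by rewrite eq_sym.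
have [w1 w1A [w1a w1b]] := Alt_2trans n4 ab ba.
have [y [yw yP]] := Apre w1 w1A.
have [c] : exists c, c \notin [:: a; b] by apply: ex_notin => /=; lia.
rewrite !inE negb_or => /andP[ca cb].
pose M := #|[set: 'S_n]|.
(* The exponent is the order of the symmetric group, so all iterates of [kap]
   are pure. *)
pose kap := gen D a c ^+ M.
have piX p t j : pj j (p ^+ t) = pj j p ^+ t.
  by elim: t => [|t IH]; rewrite ?expg0 /pj ?pij1 // !expgS pijM -/pj IH.
have kapP j : pj j kap = 1.
  by rewrite piX; apply/eqP; rewrite -order_dvdn; apply: order_dvdG; rewrite inE.
have N_pi j : (0 < j <= k)%N -> pi (twisted_norm phi j x0) = w0.
  elim: j => // j IH jk; rewrite /= bpiM.
  case: j IH jk => [|j] IH jk; first by rewrite /= bpi1 mul1g x0w.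
  rewrite IH; last by lia.
  by have := x0P j.+1; rewrite /pj /pij => ->; rewrite ?mulg1 //; lia.
pose Lam kp := (\sum_(j < k) lam (pi (twisted_norm phi j x0) a)
  (pi (twisted_norm phi j x0) b) (iter j phi kp))%R.
have LamE kp : Lam kp = (lam a b kp + \sum_(j < k.-1) lam (o0 m) (o1 m) (iter j.+1 phi kp))%R.
  rewrite /Lam; case: (k) k0 N_pi => // k' _ N_pi; rewrite big_ord_recl; congr (_ + _)%R.
    by rewrite /= bpi1 !perm1.
  apply: eq_bigr => j _; have jE : lift ord0 j = j.+1 :> nat by [].
  by rewrite jE N_pi ?w0a ?w0b //; have := ltn_ord j; lia.
have concl kp : (forall j, (j < k)%N -> pj j kp = 1) -> Lam kp != 0%R ->
    infinite_set (reidemeister_classes phi).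
  move=> kpP kp0; apply: (@infinite_classes_linear G phi n pi lam k a b x0 kp) => //.
  - exact: bpiM.
  - by move=> i j p q p1 q1; rewrite lam_hom.
  - by move=> i j g p p1; rewrite lam_conj.
  - by move=> p p1; rewrite N_pi ?w0a ?w0b ?k0 ?leqnn //; exact: lamab.
(* If the growth rate of [kap] vanishes, conjugate [kap] by an element [y] of
   the common kernel that exchanges [a] and [b]: this changes the sign of the
   first term [lam a b kap], which is not zero, and fixes the others. *)
have [L0|L0] := eqVneq (Lam kap) 0%R; last by apply: concl L0 => j _.
apply: (concl (y * kap * y^-1)).
  by move=> j _; rewrite /pj !pijM pijV -/pj kapP mulg1 mulgV.
have kap1 : pi kap = 1 := kapP 0.
move: L0; rewrite !LamE lam_conj // yw w1a w1b.
rewrite [in X in _ -> X](eq_bigr (fun j : 'I_k.-1 => lam (o0 m) (o1 m) (iter j.+1 phi kap))).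
  set S := (\sum_(j < k.-1) lam (o0 m) (o1 m) (iter j.+1 phi kap))%R.
  rewrite (lam_swap _ a b) => L0.
  have : lam a b kap != 0%R.
    rewrite (pure_homX (lam_hom (D := D) a b)) ?pi_gen // lam_gen //.
    by rewrite mulf_neq0 // /M cardsT -lt0n; apply/card_gt0P; exists 1.
  by apply: contra_neq => e; move: L0 e; move: S (lam a b kap) => s t; lia.
move=> j _; rewrite !iter_phiM iter_phiV lam_conj; last exact: (kapP j.+1).
have := yP j.+1; rewrite /pj /pij => ->; rewrite ?perm1 //.
by have := ltn_ord j; lia.
Qed.
End Final5.

(** * Groups mapping onto the symmetric group of degree three *)

Section S3.
Implicit Types (u v w : 'S_3) (i j k l a b c : 'I_3).

Lemma fixed_S3 u i : u i = i -> u != 1 -> fixed u = 1%N.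
Proof.
move=> ui u1; apply/eqP; rewrite eqn_leq; apply/andP; split; last first.
  by apply/card_gt0P; exists i; rewrite inE ui.
have [x ux] : exists x, u x != x.
  have [x ux|h] := pickP [pred i | u i != i]; first by exists x.
  case/eqP: u1; apply/permP => x; rewrite perm1; apply/eqP.
  by have /= := h x; move/negbT; rewrite negbK.
have e := cardC [pred i | u i == i]; rewrite card_ord in e.
have h : (2 <= #|[predC [pred i | u i == i]]|)%N.
  by rewrite (cardD1 x) (cardD1 (u x)) !inE ux /= (inj_eq perm_inj) ux.
by rewrite /fixed -(leq_add2r #|[predC [pred i | u i == i]]|) e; exact: (leq_add (leqnn 1) h).
Qed.

Lemma odd_S3 w : odd_perm w -> exists a b, a != b /\ w = tperm a b.
Proof.
move=> wodd; pose i := ord0 : 'I_3; pose u := w * tperm (w i) i.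
have ui : u i = i by rewrite permM tpermL.
have wE : w = u * tperm (w i) i by rewrite /u -mulgA tperm2 mulg1.
have [u1|u1] := eqVneq u 1.
  have wE' : w = tperm (w i) i by rewrite {1}wE u1 mul1g.
  exists (w i), i; split => //; apply: contraTneq wodd => e.
  by rewrite wE' e tperm1 odd_perm1.
have [a [b [ab uE]]] := tperm_of_fixed (isT : (2 <= 3)%N) (fixed_S3 ui u1).
exists a, b; split => //; rewrite -uE.
have [wi|wi] := eqVneq (w i) i; first by rewrite /u wi tperm1 mulg1.
by move: wodd; rewrite {1}wE odd_permM uE !odd_tperm ab wi.
Qed.

Lemma commuting_tperm_S3 a b k l : a != b -> k != l ->
  tperm k l * tperm a b = tperm a b * tperm k l -> tperm k l = tperm a b.
Proof.
move=> ab kl cm; apply/eqP; apply: contraT => ne.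
have [ha hb] := tperm_disjoint ab kl ne cm.
have nk x : tperm k l x = x -> (x != k) && (x != l).
  move=> e; apply/andP; split; apply: contraNneq kl => h; move: e; rewrite h ?tpermL ?tpermR => ->.
    by rewrite eqxx.
  by rewrite eqxx.
have /andP[ak al] := nk a ha; have /andP[bk bl] := nk b hb.
have uq : uniq [:: a; b; k; l] by rewrite /= !inE !negb_or ab ak al bk bl kl.
have := max_card (mem [:: a; b; k; l]); rewrite (card_uniqP uq) card_ord /=.
by [].
Qed.

Lemma involution_S3 w : w * w = 1 -> w != 1 -> exists a b, a != b /\ w = tperm a b.
Proof.
move=> w2 w1; apply: odd_S3; apply: contraT => we.
have : w ^+ #|'Alt_('I_3)| = 1.
  apply/eqP; rewrite -order_dvdn; apply: order_dvdG.
  by rewrite Alt_even.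
have -> : #|'Alt_('I_3)| = 3.
  have := @card_Alt 'I_3; rewrite card_ord => /(_ isT) e; have : (2 * #|'Alt_('I_3)| = 6)%N by rewrite e.
  lia.
by rewrite !expgS expg0 mulg1 w2 mulg1 => e; rewrite e eqxx in w1.
Qed.

(** The argument for a surjection [pi] onto the symmetric group of degree 3
    whose kernel is killed by every other surjection onto that group, hence
    is preserved by all automorphisms. The functions [lam i j] on the kernel
    play the role of the differences of total crossing numbers; here [e] is
    the generator of their values. As a transposition goes to a
    transposition, [lam 0 1 \o phi] is proportional to some [lam a b], and
    the factor is a unit because the inverse automorphism gives an inverse
    factor; then [infinite_classes_linear] applies to [phi] itself. *)
Lemma S3_R_infty (G : groupType) (pi : G -> 'S_3) (lam : 'I_3 -> 'I_3 -> G -> int) (e : int) :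
  (forall x y, pi (x * y) = pi x * pi y) ->
  (forall w, exists x, pi x = w) ->
  (forall i j p q, pi p = 1 -> pi q = 1 -> lam i j (p * q) = (lam i j p + lam i j q)%R) ->
  (forall i j g p, pi p = 1 -> lam i j (g * p * g^-1) = lam (pi g i) (pi g j) p) ->
  (forall i j p, lam j i p = (- lam i j p)%R) ->
  e != 0%R ->
  (forall i j p, pi p = 1 -> exists y, lam i j p = (y * e)%R) ->
  (forall i j, i != j -> exists2 p, pi p = 1 & lam i j p = e) ->
  (forall i j (h : G -> int), i != j ->
     (forall p q, pi p = 1 -> pi q = 1 -> h (p * q) = (h p + h q)%R) ->
     (forall g p, pi g = tperm i j -> pi p = 1 -> h (g * p * g^-1) = (- h p)%R) ->
     exists x, forall p, pi p = 1 -> (e * h p = x * lam i j p)%R) ->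
  (forall f : G -> 'S_3, (forall x y, f (x * y) = f x * f y) ->
     (forall w, exists x, f x = w) -> forall p, pi p = 1 -> f p = 1) ->
  R_infty G.
Proof.
move=> piM pis lamM lamJ lamN e0 even val rigid kerP phi phib.
have pi1 : pi 1 = 1 by exact: mulg_hom1 piM.
have piV x : pi x^-1 = (pi x)^-1 by exact: mulg_homV piM x.
have [f fK Kf] := phib.
have fM x y : f (x * y) = f x * f y by rewrite -{1}(Kf x) -{1}(Kf y) -gmulfM fK.
have fV x : f x^-1 = (f x)^-1.
  exact: mulg_homV fM x.
have pp p : pi p = 1 -> pi (phi p) = 1.
  apply: (kerP (pi \o phi)) => [x y|w] /=; first by rewrite gmulfM piM.
  by have [x xE] := pis w; exists (f x); rewrite Kf.
have ppf p : pi p = 1 -> pi (f p) = 1.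
  apply: (kerP (pi \o f)) => [x y|w] /=; first by rewrite fM piM.
  by have [x xE] := pis w; exists (phi x); rewrite fK.
have pi_eq x y : pi x = pi y -> pi (phi x) = pi (phi y).
  move=> xy; have : pi (x^-1 * y) = 1 by rewrite piM piV xy mulVg.
  by move/pp; rewrite gmulfM piM phiV piV => h; rewrite -[RHS](mulKVg (pi (phi x))) h mulg1.
have pif_eq x y : pi x = pi y -> pi (f x) = pi (f y).
  move=> xy; have : pi (x^-1 * y) = 1 by rewrite piM piV xy mulVg.
  by move/ppf; rewrite fM piM fV piV => h; rewrite -[RHS](mulKVg (pi (f x))) h mulg1.
pose i0 : 'I_3 := ord0; pose i1 : 'I_3 := lift ord0 ord0.
have [s sE] := pis (tperm i0 i1).
have s2 : pi (f s) * pi (f s) = 1.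
  rewrite -piM -fM; apply: ppf; by rewrite piM sE tperm2.
have s1 : pi (f s) != 1.
  apply/eqP => /pp; rewrite Kf sE => /(congr1 (fun w : 'S_3 => w i0)).
  by rewrite tpermL perm1.
have [a [b [ab fsE]]] := involution_S3 s2 s1.
have [x hx] : exists x, forall p, pi p = 1 -> (e * lam i0 i1 (phi p) = x * lam a b p)%R.
  apply: (rigid a b (fun p => lam i0 i1 (phi p))) => //.
    by move=> p q p1 q1; rewrite gmulfM lamM // pp.
  move=> g p gE p1; have pp1 := pp _ p1; rewrite !gmulfM phiV lamJ //.
  have -> : pi (phi g) = tperm i0 i1.
    by rewrite (pi_eq g (f s)) ?Kf // gE fsE.
  by rewrite tpermL tpermR lamN.
have [x' hx'] : exists x, forall p, pi p = 1 -> (e * lam a b (f p) = x * lam i0 i1 p)%R.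
  apply: (rigid i0 i1 (fun p => lam a b (f p))) => //.
    by move=> p q p1 q1; rewrite fM lamM // ppf.
  move=> g p gE p1; have pp1 := ppf _ p1; rewrite !fM fV lamJ //.
  have -> : pi (f g) = tperm a b.
    by rewrite (pif_eq g s) ?sE.
  by rewrite tpermL tpermR lamN.
have [p1 pp1 v1] := val a b ab.
have [p2 pp2 v2] := val i0 i1 isT.
have [z xz] : exists z, x = (z * e)%R.
  have [z zE] := even i0 i1 _ (pp _ pp1); exists z.
  by have := hx _ pp1; rewrite zE v1 mulrC => /(mulIf e0).
have [z' xz'] : exists z, x' = (z * e)%R.
  have [w wE] := even a b _ (ppf _ pp2); exists w.
  by have := hx' _ pp2; rewrite wE v2 mulrC => /(mulIf e0).
have zz : (z * z' = 1)%R.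
  have v' : lam a b (f p2) = (z' * e)%R.
    by have := hx' _ pp2; rewrite v2 xz' mulrC => /(mulIf e0).
  have E := hx _ (ppf _ pp2); rewrite Kf v2 xz v' in E.
  apply: (mulIf (mulf_neq0 e0 e0)); rewrite mul1r [RHS]E; ring.
have lamab : exists c d, c != d /\ forall p, pi p = 1 -> lam i0 i1 (phi p) = lam c d p.
  have [z1|z1] : (z = 1 \/ z = -1)%R.
    by have /eqP := congr1 absz zz; rewrite abszM muln_eq1 => /andP[/eqP z1 _]; lia.
    exists a, b; split => // p p_1; apply: (mulfI e0); rewrite hx // xz z1 mul1r //.
  exists b, a; split; first by rewrite eq_sym.
  by move=> p p_1; apply: (mulfI e0); rewrite hx // xz z1 (lamN a b) mulN1r mulrN mulNr.
have [c [d [cd lamcd]]] := lamab.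
have [w _ [wc wd]] : exists2 w : 'S_3, true & w c = i0 /\ w d = i1.
  exists (tperm c i0 * tperm (tperm c i0 d) i1) => //; split; last by rewrite permM tpermL.
  have h : tperm c i0 d != tperm c i0 c by rewrite (inj_eq perm_inj) eq_sym.
  by rewrite tpermL in h; rewrite permM tpermL [LHS]tpermD.
have [x0 x0E] := pis w.
have [kap kapP kapv] := val c d cd.
apply: (@infinite_classes_linear G phi 3 pi lam 1 c d x0 kap) => //.
- by move=> p p_1 /=; rewrite mul1g x0E wc wd; exact: lamcd.
- by move=> [].
- by rewrite big_ord1 /= pi1 !perm1 kapv.
Qed.
End S3.

(** * Three strands *)

Section Generators.
Variables (m : nat) (G : groupType).
Local Notation n := m.+2.
Variable D : braid_data n G.
Local Notation pi := (bpi D).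
Local Notation be := (bet D).
Local Notation sg := (sg D).

(** Induction on permutations by adding adjacent inversions on the left. *)
Lemma bet_ind (S : 'S_n -> Prop) : S 1 ->
  (forall (a b : 'I_n) (w : 'S_n), b = a.+1 :> nat -> (w a < w b)%N -> S w -> S (tperm a b * w)) ->
  forall w, S w.
Proof.
move=> S1 SS u; have [k] := ubnP (n * (n * n) - perm_weight u); elim: k u => // k IH u uk.
have [[a b] /= /andP[/eqP ba uba]|nd] :=
    pickP (fun q : 'I_n * 'I_n => (nat_of_ord q.2 == q.1.+1) && (u q.2 < u q.1)%N).
  have -> : u = tperm a b * (tperm a b * u) by rewrite mulgA tperm2 mul1g.
  apply: SS => //; first by rewrite !permM tpermL tpermR.
  apply: IH; have := perm_weight_adj ba uba.
  have := perm_weight_bound (tperm a b * u); lia.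
have -> : u = 1; last by [].
apply: perm_mono1; apply: adjacent_increasing => a b ba.
have := nd (a, b); rewrite /= ba eqxx /= => /negbT; rewrite -leqNgt leq_eqVlt.
case/orP => // /eqP/val_inj/perm_inj ab.
by move: ba; rewrite ab => /esym/eqP; rewrite gtn_eqF.
Qed.

(** The group is the normal closure of [sg]. *)
Lemma sg_ind (S : G -> Prop) : S 1 -> (forall x y, S x -> S y -> S (x * y)) ->
  (forall x, S x -> S x^-1) -> (forall g x, S x -> S (g * x * g^-1)) ->
  S sg -> forall x, S x.
Proof.
move=> S1 SM SV SJ Ssg.
have Sbe w : S (be w).
  elim/bet_ind: w => [|a b w ba wab Sw]; first by rewrite bet1.
  have ab : a != b by rewrite -(inj_eq val_inj) /= ba neq_ltn ltnSn.
  rewrite -bet_adjL //; apply: SM => //.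
  by rewrite (bet_conj_sg D ba (to01l ab) (to01r ab)); exact: SJ.
by apply: (bet_gen (b := D)) => // x w Sx; apply: SM => //; exact: SV.
Qed.

Lemma surj_S3_sg (f : G -> 'S_3) : (forall x y, f (x * y) = f x * f y) ->
  (forall w, exists x, f x = w) -> exists a b, a != b /\ f sg = tperm a b.
Proof.
move=> fM fs; apply: odd_S3; apply: contraT => /negbTE sgE.
have f1 : f 1 = 1 by exact: mulg_hom1 fM.
have fV x : f x^-1 = (f x)^-1 by exact: mulg_homV fM x.
have ev x : odd_perm (f x) = false.
  apply: (sg_ind (S := fun x => odd_perm (f x) = false)) => [|y z hy hz|y hy|g y hy|//].
  - by rewrite f1 odd_perm1.
  - by rewrite fM odd_permM hy hz.
  - by rewrite fV odd_permV.
  - by rewrite !fM fV !odd_permM odd_permV hy addbF addbb.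
have [x xE] := fs (tperm ord0 (lift ord0 ord0)).
by have := ev x; rewrite xE odd_tperm.
Qed.

(** A surjection onto the symmetric group of degree 3 maps [sg] to an odd
    element, that is to a transposition, hence kills [sg * sg]. *)
Lemma surj_S3_pure (f : G -> 'S_3) : (forall x y, f (x * y) = f x * f y) ->
  (forall w, exists x, f x = w) -> forall p, pi p = 1 -> f p = 1.
Proof.
move=> fM fs.
have f1 : f 1 = 1 by exact: mulg_hom1 fM.
have fV x : f x^-1 = (f x)^-1 by exact: mulg_homV fM x.
apply: pure_ind => [//|x y hx hy|x hx|g x hx|].
- by rewrite fM hx hy mulg1.
- by rewrite fV hx invg1.
- by rewrite !fM hx fV mulg1 mulgV.
- by have [a [b [_ E]]] := surj_S3_sg fM fs; rewrite fM E tperm2.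
Qed.
End Generators.

Lemma R_infty_3 (G : groupType) (D : braid_data 3 G) : R_infty G.
Proof.
have other (i j : 'I_3) : i != j -> exists c, c != i /\ c != j.
  move=> ij; have [c] : exists c, c \notin [:: i; j] by apply: ex_notin.
  by rewrite !inE negb_or => /andP[]; exists c.
apply: (@S3_R_infty G (bpi D) (lam D) 2) => //.
- exact: bpiM.
- by move=> w; exists (bet D w); rewrite bpi_bet.
- by move=> i j p q p1 q1; rewrite lam_hom.
- by move=> i j g p p1; rewrite lam_conj.
- by move=> i j p; rewrite lam_swap.
- by move=> i j p p1; exact: lam_even.
- move=> i j ij; have [c [ci cj]] := other i j ij.
  by exists (gen D i c); [exact: pi_gen|rewrite lam_gen].
- move=> i j h ij hM hab; have [c [ci cj]] := other i j ij.
  apply: (lam_rigid ij ci cj hM).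
    by move=> p p1; apply: hab; rewrite ?bpi_bet.
  move=> k l p ki kj li lj kl _; exfalso.
  have uq : uniq [:: i; j; k; l].
    by rewrite /= !inE !negb_or ij !(eq_sym i) !(eq_sym j) ki li kj lj kl.
  by have := max_card (mem [:: i; j; k; l]); rewrite (card_uniqP uq) card_ord.
- exact: surj_S3_pure.
Qed.

(** * The affine structure of four points *)
Reserved Notation "x '<+>' y" (at level 50, left associativity).

Section Four.
Definition xor_table : seq (seq nat) :=
  [:: [:: 0; 1; 2; 3]; [:: 1; 0; 3; 2]; [:: 2; 3; 0; 1]; [:: 3; 2; 1; 0]]%N.
Lemma xor4_lt (i j : 'I_4) : (nth 0 (nth [::] xor_table i) j < 4)%N.
Proof. by case: i j => [[|[|[|[|//]]]] ?] [[|[|[|[|//]]]] ?]. Qed.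
(** Addition in the Klein group, on the indices 0, 1, 2, 3 written in base 2. *)
Definition xor4 (i j : 'I_4) : 'I_4 := Ordinal (xor4_lt i j).

Local Notation "x '<+>' y" := (xor4 x y).
Implicit Types (i j k l c d : 'I_4).

Lemma xor4C i j : i <+> j = j <+> i.
Proof. by apply: val_inj; case: i j => [[|[|[|[|//]]]] ?] [[|[|[|[|//]]]] ?]. Qed.
Lemma xor4A i j k : i <+> (j <+> k) = i <+> j <+> k.
Proof.
by apply: val_inj; case: i j k => [[|[|[|[|//]]]] ?] [[|[|[|[|//]]]] ?] [[|[|[|[|//]]]] ?].
Qed.
Lemma xor40 i : i <+> ord0 = i.
Proof. by apply: val_inj; case: i => [[|[|[|[|//]]]] ?]. Qed.
Lemma xor4K i : i <+> i = ord0.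
Proof. by apply: val_inj; case: i => [[|[|[|[|//]]]] ?]. Qed.
Lemma xor4KA i c : i <+> c <+> c = i.
Proof. by rewrite -xor4A xor4K xor40. Qed.
Lemma xor4_inj c : injective (xor4^~ c).
Proof. by move=> i j e; rewrite -(xor4KA i c) e xor4KA. Qed.
Lemma xor4_eq0 i j : (i <+> j == ord0) = (i == j).
Proof.
apply/eqP/eqP => [e|->]; last exact: xor4K.
by rewrite -(xor4KA i j) e xor4C xor40.
Qed.

Lemma xor4_all i j k l : uniq [:: i; j; k; l] -> i <+> j <+> k <+> l = ord0.
Proof.
move=> h; apply: val_inj; move: h.
by case: i j k l => [[|[|[|[|//]]]] ?] [[|[|[|[|//]]]] ?] [[|[|[|[|//]]]] ?] [[|[|[|[|//]]]] ?].
Qed.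

(** Every permutation of four points is affine over the field with two
    elements, because four distinct points have sum 0. *)
Lemma perm4_affine (w : 'S_4) i j c : w i <+> w j = w (i <+> c) <+> w (j <+> c).
Proof.
have [->|ij] := eqVneq i j; first by rewrite !xor4K.
have [->|c0] := eqVneq c ord0; first by rewrite !xor40.
have [cE|cij] := eqVneq c (i <+> j).
  have -> : i <+> c = j by rewrite cE xor4A xor4K xor4C xor40.
  have -> : j <+> c = i by rewrite cE xor4C xor4KA.
  exact: xor4C.
have uq : uniq [:: w i; w j; w (i <+> c); w (j <+> c)].
  rewrite -[X in uniq X]/(map w [:: i; j; i <+> c; j <+> c]).
  rewrite (map_inj_uniq (@perm_inj _ w)) /=.
  have nc x : x != x <+> c.
    by rewrite -xor4_eq0 xor4A xor4K xor4C xor40.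
  have e1 : i != j <+> c.
    by apply: contraNneq cij => e; rewrite e -xor4A (xor4C c) xor4A xor4K xor4C xor40.
  have e2 : j != i <+> c.
    by apply: contraNneq cij => e; rewrite e xor4A xor4K xor4C xor40.
  by rewrite !inE !negb_or ij nc nc e1 e2 /= (inj_eq (@xor4_inj c)) ij.
have := xor4_all uq; rewrite -!xor4A => /eqP; rewrite xor4A xor4_eq0 => /eqP.
by [].
Qed.

(** The three nonzero elements of the Klein group. *)
Definition up (k : 'I_3) : 'I_4 := lift ord0 k.

Lemma lin_ex (w : 'S_4) (k : 'I_3) : exists l : 'I_3, up l = w ord0 <+> w (up k).
Proof.
have [l lE|e] := unliftP ord0 (w ord0 <+> w (up k)); first by exists l.
have /eqP := e; rewrite xor4_eq0 (inj_eq perm_inj) => /eqP/esym/eqP.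
by rewrite eq_sym (negbTE (neq_lift _ _)).
Qed.

Definition lin_fun (w : 'S_4) (k : 'I_3) : 'I_3 := sval (cid (lin_ex w k)).
Lemma lin_funE (w : 'S_4) (k : 'I_3) : up (lin_fun w k) = w ord0 <+> w (up k).
Proof. exact: svalP (cid (lin_ex w k)). Qed.

Lemma up_inj : injective up. Proof. exact: lift_inj. Qed.

Lemma lin_inj w : injective (lin_fun w).
Proof.
move=> k l /(congr1 up); rewrite !lin_funE xor4C [in RHS]xor4C.
by move/xor4_inj/perm_inj/up_inj.
Qed.

(** The linear part of an affine permutation: the surjection of the symmetric
    group of degree 4 onto that of degree 3. *)
Definition lin (w : 'S_4) : 'S_3 := perm (@lin_inj w).

Lemma linE (w : 'S_4) (k : 'I_3) : up (lin w k) = w ord0 <+> w (up k).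
Proof. by rewrite permE lin_funE. Qed.

Lemma lin_diff (w : 'S_4) i j (k : 'I_3) : i <+> j = up k -> w i <+> w j = up (lin w k).
Proof.
move=> ij; rewrite linE (perm4_affine w i j i) xor4K; congr (_ <+> w _).
by rewrite -ij xor4C.
Qed.

Lemma linM (u v : 'S_4) : lin (u * v) = lin u * lin v.
Proof.
apply/permP => k; apply: up_inj; rewrite linE permM !permM.
by rewrite (@lin_diff v _ _ (lin u k)) // linE.
Qed.
End Four.

(** * Four strands *)

Local Notation "x '<+>' y" := (xor4 x y).

Section Affine.
Implicit Types (w : 'S_4) (i j c d : 'I_4) (k l : 'I_3).

Lemma xorK4 i j : i <+> (i <+> j) = j.
Proof. by rewrite xor4A xor4K xor4C xor40. Qed.

Lemma lin_surj (u : 'S_3) : exists w : 'S_4, lin w = u.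
Proof.
exists (lift_perm ord0 ord0 u); apply/permP => k; apply: up_inj.
by rewrite linE lift_perm_id lift_perm_lift xor4C xor40.
Qed.

Lemma lin1 : lin 1 = 1.
Proof. exact: mulg_hom1 linM. Qed.

Lemma linV w : lin w^-1 = (lin w)^-1.
Proof. exact: mulg_homV linM w. Qed.

Lemma lin_eq1 w i : lin w = 1 -> w i = w ord0 <+> i.
Proof.
move=> w1; have [k ->|->] := unliftP ord0 i; last by rewrite xor40.
by rewrite -/(up k) -{2}[k](perm1 k) -w1 linE xorK4.
Qed.

Lemma lin_eq1_inv w : lin w = 1 -> w * w = 1.
Proof.
move=> w1; apply/permP => i; rewrite permM perm1 (lin_eq1 (w i) w1) (lin_eq1 i w1).
exact: xorK4.
Qed.

(** The translations are in the kernel of [lin]. *)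
Lemma transl_ex c : exists2 w : 'S_4, lin w = 1 & forall i, w i = c <+> i.
Proof.
have inj : injective (xor4 c) by move=> i j; rewrite xor4C [in RHS]xor4C => /xor4_inj.
have wE i : perm inj i = c <+> i by rewrite permE.
exists (perm inj) => //; apply/permP => k; apply: up_inj.
by rewrite linE !wE perm1 xor40 xorK4.
Qed.

(** The first and the last adjacent transpositions have the same linear part,
    as their product is a translation. *)
Lemma lin_tperm_adj : lin (tperm (o0 2) (o1 2) * tperm (inord 2) (inord 3)) = 1.
Proof.
have tE (a b i : 'I_4) : tperm a b i = if i == a then b else if i == b then a else i.
  by case: tpermP => [->|->|/eqP/negbTE-> /eqP/negbTE->]; rewrite ?eqxx //; case: eqP.
have [w w1 wE] := transl_ex (o1 2); rewrite -[RHS]w1; congr lin.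
apply/permP => i; rewrite wE permM !tE; apply: val_inj.
by case: i => [[|[|[|[|//]]]] ?]; rewrite -!(inj_eq val_inj) /= ?inordK //= ?inordK.
Qed.
End Affine.

Section R4.
Variables (G : groupType) (D : braid_data 4 G).
Local Notation lk := (blk D).
Local Notation be := (bet D).
Local Notation sg := (sg D).
Local Notation s3 := (be (tperm (inord 2) (inord 3))).
Local Notation pi g := (lin (bpi D g)).
Implicit Types (g p q x y : G) (i j : 'I_4) (a b c k : 'I_3).

Lemma lpiM x y : pi (x * y) = pi x * pi y.
Proof. by rewrite bpiM linM. Qed.

Lemma lpi1 : pi 1 = 1.
Proof. by rewrite bpi1 lin1. Qed.

Lemma lpiV x : pi x^-1 = (pi x)^-1.
Proof. by rewrite bpiV linV. Qed.

Lemma lpi_pure p : bpi D p = 1 -> pi p = 1.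
Proof. by move=> ->; exact: lin1. Qed.

Lemma lpi_sg_s3 : pi (sg * s3^-1) = 1.
Proof. by rewrite bpiM bpiV !bpi_bet tpermV lin_tperm_adj. Qed.

Lemma lpi_conj g p : pi p = 1 -> pi (g * p * g^-1) = 1.
Proof. by move=> p1; rewrite !lpiM p1 mulg1 lpiV mulgV. Qed.

(** The kernel of [G] onto the symmetric group of degree 3 is the normal
    closure of [sg * sg] and [sg * s3^-1], where [s3] is the crossing of the
    last two strands: the permutation of the second element is a translation,
    and all nontrivial translations are conjugate. *)
Lemma ker_lin_ind (S : G -> Prop) : S 1 -> (forall x y, S x -> S y -> S (x * y)) ->
  (forall x, S x -> S x^-1) -> (forall g x, S x -> S (g * x * g^-1)) ->
  S (sg * sg) -> S (sg * s3^-1) -> forall p, pi p = 1 -> S p.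
Proof.
move=> S1 SM SV SJ Ssg Sss p p1; have Sp := pure_ind S1 SM SV SJ Ssg.
have [c0|c0] := eqVneq (bpi D p ord0) ord0.
  by apply: Sp; apply/permP => i; rewrite (lin_eq1 i p1) perm1 c0 xor4C xor40.
set c := bpi D p ord0 in c0; pose w := tperm c (o1 2); pose y := be w * (sg * s3^-1) * (be w)^-1.
have Sy : S y by exact: SJ.
suff py : bpi D (p * y^-1) = 1 by rewrite -(mulgVK y p); apply: SM => //; exact: Sp.
have y1 : pi y = 1 by apply: lpi_conj; exact: lpi_sg_s3.
have -> : bpi D (p * y^-1) = bpi D p * (bpi D y)^-1 by rewrite bpiM bpiV.
suff -> : bpi D y = bpi D p by rewrite mulgV.
have x1 := lpi_sg_s3.
suff y0 : bpi D y ord0 = c.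
  by apply/permP => i; rewrite (lin_eq1 _ y1) y0 (lin_eq1 i p1).
have w0 : w ord0 = ord0 by rewrite tpermD.
rewrite !bpiM !bpiV !bpi_bet !permM w0 tpermL /w !tpermV.
by rewrite (@tpermD _ _ _ (o1 2)) ?tpermR // -(inj_eq val_inj) /= inordK.
Qed.

Local Open Scope ring_scope.

(** The crossings of the pairs of strands whose sum is [up c], that is of the
    two pairs of one of the three partitions of the four strands into pairs.
    Each crossing is counted twice. *)
Definition tau c g : int := \sum_i lk g i (i <+> up c).

Lemma tauM c g x : tau c (g * x)%g = tau c g + tau (pi g c) x.
Proof.
rewrite /tau [X in _ = _ + X](reindex_inj (@perm_inj _ (bpi D g))) -big_split.
apply: eq_bigr => i _; rewrite blkM; congr (_ + lk _ _ _).
by rewrite -(@lin_diff (bpi D g) i (i <+> up c)) ?xorK4.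
Qed.

Definition lam4 a b p : int := tau a p - tau b p.

Lemma tau_pure c p q : pi p = 1%g -> tau c (p * q)%g = tau c p + tau c q.
Proof. by move=> p1; rewrite tauM p1 perm1. Qed.

Lemma tau1 c : tau c 1%g = 0.
Proof. by apply: big1 => i _; rewrite blk1. Qed.

Lemma tauV c g : tau (pi g c) g^-1%g = - tau c g.
Proof. by apply/eqP; rewrite -addr_eq0 addrC -tauM mulgV tau1. Qed.

Lemma tau_conj c g p : pi p = 1%g -> tau c (g * p * g^-1)%g = tau (pi g c) p.
Proof.
move=> p1; rewrite !tauM lpiM p1 mulg1 tauV; ring.
Qed.

Lemma tau4_gen c i j : i != j -> tau c (gen D i j) = if i <+> j == up c then 4 else 0.
Proof.
move=> ij; rewrite /tau; under eq_bigr => k _ do rewrite blk_gen //.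
rewrite (bigD1 i) //= (bigD1 j) /=; last by rewrite eq_sym.
rewrite big1 => [|k /andP[ki kj]]; last first.
  by rewrite (negbTE ki) (negbTE kj).
have e (x y : 'I_4) : (x <+> up c == y) = (x <+> y == up c).
  by apply/eqP/eqP => [<-|<-]; rewrite xorK4.
rewrite !eqxx !e (negbTE ij) (eq_sym j) (negbTE ij) /= orbF (xor4C j i).
by case: ifP.
Qed.

Lemma sg2_gen : (sg * sg)%g = gen D (o0 2) (o1 2).
Proof.
have t1 : to01 (o0 2) (o1 2) = 1%g.
  by rewrite /to01 tperm1 mul1g perm1 tperm1.
by rewrite /gen t1 bet1 mul1g invg1 mulg1.
Qed.

Lemma tau_adj c (i j : 'I_4) : j = i.+1 :> nat ->
  tau c (be (tperm i j)) = if i <+> j == up c then 2 else 0.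
Proof.
move=> ij; have ne : i != j by rewrite -(inj_eq val_inj) /= ij neq_ltn ltnSn.
have ltE (k l : 'I_4) :
    (k < l)%N && (tperm i j l < tperm i j k)%N = (k == i) && (l == j).
  apply/idP/andP => [/andP[kl /(adj_inv ij kl)[-> ->]]|[/eqP-> /eqP->]] //.
  by rewrite tpermL tpermR ij ltnSn.
rewrite /tau; under eq_bigr => k _ do rewrite blk_bet !ltE [in X in _ || X]andbC.
rewrite (bigD1 i) //= (bigD1 j) /=; last by rewrite eq_sym.
rewrite big1 => [|k /andP[ki kj]]; last first.
  by rewrite (negbTE ki) (negbTE kj).
have e (x y : 'I_4) : (x <+> up c == y) = (x <+> y == up c).
  by apply/eqP/eqP => [<-|<-]; rewrite xorK4.
rewrite !eqxx !e (negbTE ne) (eq_sym j) (negbTE ne) /= orbF (xor4C j i).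
by case: ifP.
Qed.

Lemma lpi_sg : pi sg = pi s3.
Proof.
apply: (mulIg (pi s3)^-1%g); rewrite mulgV -lpiV -lpiM; exact: lpi_sg_s3.
Qed.

Lemma tau_sg_s3 c : tau c (sg * s3^-1)%g = 0.
Proof.
rewrite tauM lpi_sg tauV !tau_adj //=; last by rewrite !inordK.
suff -> : (inord 2 : 'I_4) <+> inord 3 = o0 2 <+> o1 2 by rewrite subrr.
by apply: val_inj; rewrite /= !inordK.
Qed.

Lemma tau_ker p : pi p = 1%g -> forall c, exists z : int, tau c p = z * 4.
Proof.
move=> p1; suff : pi p = 1%g /\ forall c, exists z : int, tau c p = z * 4 by case.
move: p1; apply: (ker_lin_ind
  (S := fun p => pi p = 1%g /\ forall c, exists z : int, tau c p = z * 4)) => {p}.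
- by split; [exact: lpi1|move=> c; exists 0; rewrite tau1].
- move=> x y [x1 hx] [y1 hy]; split; first by rewrite lpiM x1 y1 mulg1.
  move=> c; have [u uE] := hx c; have [v vE] := hy c.
  by exists (u + v); rewrite tau_pure // uE vE mulrDl.
- move=> x [x1 hx]; split; first by rewrite lpiV x1 invg1.
  move=> c; have [u uE] := hx c; exists (- u).
  by rewrite mulNr -uE -tauV x1 perm1.
- move=> g x [x1 hx]; split; first exact: lpi_conj.
  by move=> c; have [u uE] := hx (pi g c); exists u; rewrite tau_conj.
- split; first by apply: lpi_pure; exact: bpi_sg2.
  move=> c; rewrite sg2_gen tau4_gen //; case: ifP => _; first by exists 1.
  by exists 0.
- split; first exact: lpi_sg_s3.
  by move=> c; exists 0; rewrite tau_sg_s3.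
Qed.

(** The analogue of [lam_rigid]. Translations fix the restriction of [h] to
    the pure subgroup, so the value [K c] of [h] on the full twist of [i] and
    [j] depends only on their sum [up c]. As [h] changes sign under the
    elements above the transposition of [a] and [b], [K] takes opposite
    values at [a] and [b] and vanishes elsewhere. This determines [h] on the
    squares, which are pure. *)
Lemma lam4_rigid a b (h : G -> int) : a != b ->
  (forall p q, pi p = 1%g -> pi q = 1%g -> h (p * q)%g = h p + h q) ->
  (forall g p, pi g = tperm a b -> pi p = 1%g -> h (g * p * g^-1)%g = - h p) ->
  exists z : int, forall p, pi p = 1%g -> 4 * h p = z * lam4 a b p.
Proof.
move=> ab hM hab.
have hP : pure_hom D h by move=> p q p1 q1; apply: hM; exact: lpi_pure.
pose K c := h (gen D ord0 (up c)).
have n0 c : ord0 != up c by exact: neq_lift.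
have genE i j c : i <+> j = up c -> h (gen D i j) = K c.
  move=> ijc; have ij : i != j.
    by rewrite -xor4_eq0 ijc eq_sym.
  have [w w1 wE] := transl_ex i.
  have p1 : pi (be w) = 1%g by rewrite bpi_bet.
  have pV : pi (be w)^-1 = 1%g by rewrite lpiV p1 invg1.
  have g1 : pi (gen D i j) = 1%g by apply: lpi_pure; exact: pi_gen.
  have hJ : h (be w * gen D i j * (be w)^-1)%g = h (gen D i j).
    have h1 : h 1%g = 0 by have := hM _ _ lpi1 lpi1; rewrite mulg1; lia.
    have := hM _ _ p1 pV; rewrite mulgV h1 => hV.
    have pg1 : pi (be w * gen D i j)%g = 1%g by rewrite lpiM p1 g1 mulg1.
    by rewrite (hM _ _ pg1 pV) (hM _ _ p1 g1); lia.
  rewrite -hJ pure_hom_genJ // bpi_bet.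
  have wV (k : 'I_4) : w^-1%g k = i <+> k by apply: (@perm_inj _ w); rewrite permKV wE xorK4.
  by rewrite !wV xor4K ijc.
have Kab c : K (tperm a b c) = - K c.
  have [w wE] := lin_surj (tperm a b).
  have lw : lin w^-1%g = tperm a b by rewrite linV wE tpermV.
  have pw : pi (be w) = tperm a b by rewrite bpi_bet.
  rewrite /K -(hab (be w)) //; last by apply: lpi_pure; exact: pi_gen.
  rewrite pure_hom_genJ // bpi_bet; apply/esym/genE.
  by rewrite -lw; apply: lin_diff; rewrite xor4C xor40.
have Kb : K b = - K a by rewrite -Kab tpermL.
have K0 c : c != a -> c != b -> K c = 0.
  move=> ca cb; have := Kab c; rewrite tpermD 1?eq_sym //; lia.
have KS (F : 'I_3 -> int) : \sum_c K c * F c = K a * (F a - F b).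
  rewrite (bigD1 a) //= (bigD1 b) /= ?(eq_sym b) // big1 => [|c /andP[ca cb]].
    by rewrite Kb addr0; ring.
  by rewrite K0 // mul0r.
have pureE p : bpi D p = 1%g -> 4 * h p = K a * lam4 a b p.
  move=> p1; rewrite (pure_hom_expand hP p1) -(KS (tau^~ p)).
  rewrite /tau; under [RHS]eq_bigr => c _ do rewrite big_distrr /=.
  rewrite [RHS]exchange_big; apply: eq_bigr => i _ /=.
  rewrite [LHS](reindex_onto (fun c => i <+> up c) (fun j => odflt ord0 (unlift ord0 (i <+> j)))) /=.
    apply: eq_big => [c|c _].
      rewrite xorK4 liftK /= eqxx andbT -[X in _ != X]xor40 (xor4C i) (xor4C i) (inj_eq (@xor4_inj i)).
      by rewrite eq_sym.
    by congr (_ * _); apply: genE; rewrite xorK4.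
  move=> j ji; have [k kE|e] := unliftP ord0 (i <+> j); first by rewrite /= /up -kE xorK4.
  by move/eqP: e; rewrite xor4_eq0 eq_sym (negbTE ji).
exists (K a) => p p1; have pp1 : bpi D (p * p)%g = 1%g by rewrite bpiM lin_eq1_inv.
have := pureE _ pp1; rewrite hM // /lam4 !tau_pure //; lia.
Qed.

(** The images of [sg] and [s3] are commuting transpositions of three
    letters, hence are equal. *)
Lemma surj_S3_ker (f : G -> 'S_3) : (forall x y, f (x * y)%g = (f x * f y)%g) ->
  (forall w, exists x, f x = w) -> forall p, pi p = 1%g -> f p = 1%g.
Proof.
move=> fM fs; have fP := surj_S3_pure fM fs (D := D).
have f1 : f 1%g = 1%g by exact: mulg_hom1 fM.
have fV x : f x^-1%g = (f x)^-1%g by exact: mulg_homV fM x.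
apply: ker_lin_ind => //.
- by move=> x y hx hy; rewrite fM hx hy mulg1.
- by move=> x hx; rewrite fV hx invg1.
- by move=> g x hx; rewrite !fM hx fV mulg1 mulgV.
- by apply: fP; exact: bpi_sg2.
have [a [b [ab sE]]] := surj_S3_sg D fM fs.
have cj (u v : 'S_3) : (u * v * u^-1 = v ^ u^-1)%g by rewrite conjgE invgK mulgA.
pose o2 : 'I_4 := inord 2; pose o3 : 'I_4 := inord 3.
have o23 : o3 = o2.+1 :> nat by rewrite !inordK.
have n23 : o2 != o3 by rewrite -(inj_eq val_inj) /= !inordK.
have cm : (sg * s3 = s3 * sg)%g.
  have s0 : tperm o2 o3 (o0 2) = o0 2 by rewrite tpermD // -(inj_eq val_inj) /= inordK.
  have s1 : tperm o2 o3 (o1 2) = o1 2 by rewrite tpermD // -(inj_eq val_inj) /= inordK.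
  by rewrite (sg_commute D s0 s1).
have := @bet_conj_sg 2 G D o2 o3 (to01 o2 o3) o23 (to01l n23) (to01r n23).
move=> /(congr1 f); rewrite !fM fV sE cj tpermJ => s3E.
have E : f s3 = tperm a b.
  rewrite s3E; apply: commuting_tperm_S3 => //.
    by rewrite (inj_eq perm_inj).
  by rewrite -s3E -sE -!fM cm.
by rewrite fV E mulgV.
Qed.
End R4.

Lemma R_infty_4 (G : groupType) (D : braid_data 4 G) : R_infty G.
Proof.
apply: (@S3_R_infty G (fun g => lin (bpi D g)) (lam4 D) 4%R) => //.
- exact: lpiM.
- by move=> w; have [v vE] := lin_surj w; exists (bet D v); rewrite bpi_bet.
- by move=> i j p q p1 q1; rewrite /lam4 !tau_pure //; ring.
- by move=> i j g p p1; rewrite /lam4 !tau_conj.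
- by move=> i j p; rewrite /lam4 opprB.
- move=> i j p p1; have [y yE] := tau_ker p1 i; have [z zE] := tau_ker p1 j.
  by exists (y - z)%R; rewrite /lam4 yE zE mulrBl.
- move=> i j ij; exists (gen D ord0 (up i)); first by rewrite pi_gen lin1.
  rewrite /lam4 !tau4_gen ?neq_lift // ![xor4 ord0 _]xor4C !xor40 eqxx.
  by rewrite (inj_eq up_inj) (negbTE ij) subr0.
- by move=> i j h ij; exact: lam4_rigid.
- exact: surj_S3_ker.
Qed.

(** * At most two strands, and the conclusion *)

Section Inverse.
Variable G : groupType.
Hypothesis mulC : forall x y : G, x * y = y * x.

Let inv_morph : {morph (fun x : G => x^-1) : x y / x * y}.
Proof. by move=> x y; rewrite invgM mulC. Qed.

(** Inversion is an automorphism of a commutative group. *)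
Definition inversion : {multiplicative G -> G} :=
  HB.pack (fun x : G => x^-1) (isMultiplicative.Build G G (fun x : G => x^-1) inv_morph).
End Inverse.

(** The classes of the inversion automorphism in a group generated by [s] are
    those of 1 and [s], since twisted conjugation by [g] is multiplication by
    [g * g]. *)
Lemma cyclic_not_R_infty (G : groupType) (s : G) :
  (forall S : G -> Prop, S 1 -> (forall x, S x -> S (x * s)) ->
     (forall x, S x -> S (x * s^-1)) -> forall x, S x) ->
  ~ R_infty G.
Proof.
move=> ind.
have sC x : x * s = s * x.
  move: x; refine (ind (fun x => x * s = s * x) _ _ _) => [|x h|x h]; first by rewrite mul1g mulg1.
    by rewrite {1}h mulgA.
  by rewrite mulgVK mulgA -h mulgK.
have mulC (x y : G) : x * y = y * x.
  move: y; refine (ind (fun y => x * y = y * x) _ _ _) => [|y h|y h]; first by rewrite mul1g mulg1.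
    by rewrite mulgA h -!mulgA sC.
  rewrite mulgA h -!mulgA; congr (_ * _).
  by apply: (mulgI s); apply: (mulIg s); rewrite mulKVg -!mulgA mulVg mulg1 sC.
move=> /(_ (inversion mulC)) []; first by exists (inversion mulC) => x; exact: invgK.
pose cl := reidemeister_class (inversion mulC).
have clE g r : cl (g * r * g) = cl r.
  apply/seteqP; split => y [h ->]; rewrite /inversion /= invgK.
    by exists (h * g); rewrite /inversion /= invgK !mulgA -!(mulgA (_ * r)) (mulC g h).
  exists (h * g^-1); rewrite /inversion /= !invgM !invgK !mulgA mulgVK.
  by rewrite -!mulgA (mulC g) -!mulgA mulVg mulg1.
apply: (@sub_finite_set _ _ [set cl 1; cl s]%classic); last exact: finite_set2.
move=> C [x _ <-].
have [g [->|->]] : exists g, x = g * 1 * g \/ x = g * s * g.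
- move: x; refine (ind (fun x => exists g, x = g * 1 * g \/ x = g * s * g) _ _ _).
  + by exists 1; left; rewrite !mulg1.
  + move=> x [g [->|->]]; first by exists g; right; rewrite mulg1 -!mulgA sC.
    by exists (g * s); left; rewrite mulg1 !mulgA.
  + move=> x [g [->|->]]; last first.
      by exists g; left; rewrite -!mulgA (mulC s) !mulgA mulgVK mulg1.
    by exists (g * s^-1); right; rewrite mulgVK mulg1 mulgA.
- by left; exact: clE.
- by right; exact: clE.
Qed.

(** With at most two strands there is at most one nontrivial permutation
    braid. *)
Lemma braid_le2_not_R_infty n (G : groupType) (D : braid_data n G) :
  (1 <= n <= 2)%N -> ~ R_infty G.
Proof.
move=> n12.
have [s hs] : exists s : 'S_n, forall w, w = 1 \/ w = s.
  case: n D n12 => [|[|[|//]]] D // _.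
    exists 1 => w; left; apply/permP => i; by rewrite (ord1 (w i)) (ord1 (_ i)).
  exists (tperm ord0 ord_max) => w.
  have o2 (i : 'I_2) : i = ord0 \/ i = ord_max.
    by case: i => [[|[|//]] h]; [left|right]; exact: val_inj.
  have [w0|w0] := o2 (w ord0); have [w1|w1] := o2 (w ord_max).
  - by have /perm_inj := etrans w0 (esym w1).
  - by left; apply/permP => i; rewrite perm1; have [->|->] := o2 i.
  - by right; apply/permP => i; have [->|->] := o2 i; rewrite ?tpermL ?tpermR.
  - by have /perm_inj := etrans w0 (esym w1).
apply: (@cyclic_not_R_infty G (bet D s)) => S S1 SM SV.
apply: (bet_gen (b := D)) => // x w Sx; have [->|->] := hs w.
- by rewrite bet1 mulg1.
- exact: SM.
- by rewrite bet1 invg1 mulg1.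
- exact: SV.
Qed.

Theorem theorem5p3 (R : realType) (n : nat) (n_ge1 : (1 <= n)%N)
    (b : unordered_conf n (disk R)) :
  R_infty (braid_group b) <-> (2 < n)%N.
Proof.
have D := braid_data_disk b; split.
  by case: ltnP => // n2 /(braid_le2_not_R_infty D) []; rewrite n_ge1.
case: n n_ge1 b D => [|[|[|[|[|m]]]]] //= _ b D _; first exact: R_infty_3.
  exact: R_infty_4.
exact: (R_infty_ge5 D).
Qed.
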